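(* Let $q\in(0,1)$, $j\in\{\tfrac12,1,\tfrac32,\dots\}$, and let $(\eta(s))_{s\ge0}$ be the infinite-volume ASEP$(q,j)$ on $\mathbb Z$. Let $J_i(t)$ be the total integrated current through the bond $(i-1,i)$ in $[0,t]$. Then the total integrated current of a trajectory $(\eta(s))_{0\le s\le t}$ is given by $$J_i(t)=N_i(\eta(t))-N_i(\eta(0)),\qquad N_i(\eta)=\sum_{k\ge i}\eta_k .$$ Moreover, the first $q$-exponential moment of the current when the process is started from a configuration $\eta\in\{0,\dots,2j\}^{\mathbb Z}$ at time $0$ is given, for $i\in\mathbb Z$ and $t\ge0$, by $$\mathbb E_\eta\left[q^{2J_i(t)}\right]=q^{2(N(\eta)-N_i(\eta))}-\sum_{k=-\infty}^{i-1}q^{-4jk}\;\mathbf E_k\left[q^{4jx(t)}\left(1-q^{-2\eta_{x(t)}}\right)q^{2(N_{x(t)}(\eta)-N_i(\eta))}\right],$$ where $N(\eta)=\sum_{k\in\mathbb Z}\eta_k$ is the total number of particles, $x(t)$ is the continuous-time asymmetric random walk on $\mathbb Z$ jumping left (by one) at rate $q^{2j}[2j]_q$ and right (by one) at rate $q^{-2j}[2j]_q$, and $\mathbf E_k$ is expectation for $x(\cdot)$ started at $k$ at time $0$. Here $N(\eta)-N_i(\eta)=\sum_{k<i}\eta_k$, and the first term on the right-hand side is zero when $\eta$ has infinitely many particles to the left of $i$.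
   Context: $[n]_q=\frac{q^n-q^{-n}}{q-q^{-1}}$. The infinite-volume ASEP$(q,j)$ is the Markov process on $\{0,1,\dots,2j\}^{\mathbb Z}$ with generator $\sum_{i\in\mathbb Z}\mathcal L_{i,i+1}$ (on local functions), where $$(\mathcal L_{i,i+1}f)(\eta)=q^{\eta_i-\eta_{i+1}-(2j+1)}[\eta_i]_q[2j-\eta_{i+1}]_q\,(f(\eta^{i,i+1})-f(\eta))+q^{\eta_i-\eta_{i+1}+(2j+1)}[2j-\eta_i]_q[\eta_{i+1}]_q\,(f(\eta^{i+1,i})-f(\eta)),$$ and $\eta^{i,k}$ is obtained from $\eta$ by moving one particle from $i$ to $k$. The total integrated current $J_i(t)$ is the net number of particles that cross the bond $(i-1,i)$ to the right during $[0,t]$: the number of jumps $i-1\to i$ minus the number of jumps $i\to i-1$ in $[0,t]$. Conventions: for configurations with $N_i(\eta)=\infty$, the difference $N_x(\eta)-N_i(\eta)$ denotes the finite number $\sum_{k=x}^{i-1}\eta_k$ if $x\le i$ and $-\sum_{k=i}^{x-1}\eta_k$ if $x>i$; the identity $J_i(t)=N_i(\eta(t))-N_i(\eta(0))$ is meant literally when $N_i(\eta(0))<\infty$, and otherwise $N_i(\eta(t))-N_i(\eta(0))$ is understood as the (finite) net number of particles having entered $\{k\ge i\}$. *)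

(* Defs.v *)
From mathcomp Require Import all_boot all_order all_algebra finmap.
From mathcomp Require Import all_classical all_reals all_analysis.

Set Implicit Arguments.
Unset Strict Implicit.
Unset Printing Implicit Defensive.

Import Order.TTheory GRing.Theory Num.Theory.
Import numFieldNormedType.Exports.

Local Open Scope classical_set_scope.
Local Open Scope ring_scope.

Section Markov.
Context {R : realType} {T : topologicalType}.

(* C_b(T); it is C(T) when T is compact. *)
Definition bcont (f : T -> R) : Prop :=
  continuous f /\ exists M : R, forall x, `|f x| <= M.

(* The operators [S t] are only meaningful for [0 <= t] and on [bcont]. *)
Record markov_semigroup (S : R -> (T -> R) -> (T -> R)) : Prop := {
  ms_bcont : forall t f, 0 <= t -> bcont f -> bcont (S t f);
  ms_linear : forall t a f g, 0 <= t -> bcont f -> bcont g ->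
    S t (fun x => a * f x + g x) = (fun x => a * S t f x + S t g x);
  ms_ge0 : forall t f, 0 <= t -> bcont f -> (forall x, 0 <= f x) ->
    forall x, 0 <= S t f x;
  ms_one : forall t, 0 <= t -> S t (fun=> 1) = (fun=> 1);
  ms_zero : forall f, bcont f -> S 0 f = f;
  ms_add : forall s t f, 0 <= s -> 0 <= t -> bcont f ->
    S (s + t) f = S s (S t f);
  ms_rcont : forall t f, 0 <= t -> bcont f ->
    {uniform, (fun s => S s f) @ t^'+ --> S t f} }.

(* The infinitesimal generator of [S] extends the operator [L] defined on the
   set of functions [D]. *)
Definition has_generator (S : R -> (T -> R) -> (T -> R))
    (D : set (T -> R)) (L : (T -> R) -> (T -> R)) : Prop :=
  forall f, D f ->
    {uniform, (fun h x => h^-1 * (S h f x - f x)) @ 0^'+ --> L f}.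

Definition natural_filtration {Omega : Type} (X : R -> Omega -> T) (s : R) :
    set (set Omega) :=
  <<s [set A | exists r U, [/\ 0 <= r <= s, open U & A = X r @^-1` U]] >>.

Definition cadlag (w : R -> T) : Prop :=
  (forall t, 0 <= t -> w s @[s --> t^'+] --> w t) /\
  (forall t, 0 < t -> exists l : T, w s @[s --> t^'-] --> l).

(* The process is indexed by [0 <= t]; the law of [X 0] is arbitrary.
   [mp_markov] is E[f(X_(s+t)) | F_s] = (S_t f)(X_s), with the conditional
   expectation written through its defining identity. *)
Record markov_process_of {d : measure_display} {Omega : measurableType d}
    (P : probability Omega R) (S : R -> (T -> R) -> (T -> R))
    (X : R -> Omega -> T) : Prop := {
  mp_measurable : forall t U, 0 <= t -> open U -> measurable (X t @^-1` U);
  mp_cadlag : forall w, cadlag (X ^~ w);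
  mp_markov : forall s t f A, 0 <= s -> 0 <= t -> bcont f ->
    natural_filtration X s A ->
    (\int[P]_(w in A) (f (X (s + t) w))%:E =
     \int[P]_(w in A) (S t f (X s w))%:E)%E }.

Definition markov_process {d : measure_display} {Omega : measurableType d}
    (P : probability Omega R) (D : set (T -> R)) (L : (T -> R) -> (T -> R))
    (X : R -> Omega -> T) : Prop :=
  exists S, [/\ markov_semigroup S, has_generator S D L &
                markov_process_of P S X].

Definition started_from {d : measure_display} {Omega : measurableType d}
    (P : probability Omega R) (X : R -> Omega -> T) (x : T) : Prop :=
  {ae P, forall w, X 0 w = x}.

End Markov.

(* From here on, [n] stands for 2j, with j a positive half-integer. *)

Definition conf (n : nat) : Type := {ptws int -> discrete_topology 'I_n.+1}.

Definition occ {n : nat} (eta : conf n) (k : int) : nat :=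
  nat_of_ord (eta k : 'I_n.+1).

(* eta^{x,y}; meaningful if x <> y, 0 < eta_x and eta_y < n.  Otherwise the
   value is irrelevant: the generator multiplies it by a zero rate. *)
Definition move {n : nat} (x y : int) (eta : conf n) : conf n :=
  fun k => if k == x then inord (occ eta k).-1
           else if k == y then inord (occ eta k).+1
           else eta k.

Section ASEP.
Context {R : realType}.

Definition qint (q : R) (m : int) : R := (q ^ m - q ^ (- m)) / (q - q^-1).

Definition local_fun {n : nat} (f : conf n -> R) : Prop :=
  exists A : seq int, forall eta xi : conf n,
    (forall k, k \in A -> eta k = xi k) -> f eta = f xi.

Definition asep_bond (q : R) {n : nat} (i : int) (f : conf n -> R)
    (eta : conf n) : R :=
  let a : int := Posz (occ eta i) in
  let b : int := Posz (occ eta (i + 1)) in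
  let N : int := Posz n in
  q ^ (a - b - (N + 1)) * qint q a * qint q (N - b)
    * (f (move i (i + 1) eta) - f eta)
  + q ^ (a - b + (N + 1)) * qint q (N - a) * qint q b
    * (f (move (i + 1) i eta) - f eta).

(* For a local [f] only finitely many terms are nonzero. *)
Definition asep_gen (q : R) {n : nat} (f : conf n -> R) (eta : conf n) : R :=
  \sum_(i \in [set: int]) asep_bond q i f eta.

Definition is_asep (q : R) (n : nat) {d : measure_display}
    {Omega : measurableType d} (P : probability Omega R)
    (X : R -> Omega -> conf n) : Prop :=
  markov_process P (@local_fun n) (@asep_gen q n) X.

(* A particle jumps from [x] to [y] at time [s]; [zeta] is the configuration
   just before [s]. *)
Definition jump {n : nat} (w : R -> conf n) (x y : int) (s : R) : Prop :=
  exists zeta : conf n,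
    [/\ w r @[r --> s^'-] --> zeta, (0 < occ zeta x)%N, (occ zeta y < n)%N
      & w s = move x y zeta].

(* Number of times in ]0, t] satisfying [A]; [fset_set] is meaningful on finite
   sets.  A cadlag path changes the occupation number of a given site finitely
   often in ]0, t], so that the two sets in [current] are finite. *)
Definition ntimes (A : set R) (t : R) : int :=
  Posz #|` fset_set [set s | 0 < s <= t /\ A s]|.

(* J_i(t) *)
Definition current {n : nat} (w : R -> conf n) (i : int) (t : R) : int :=
  ntimes (jump w (i - 1) i) t - ntimes (jump w i (i - 1)) t.

(* Net number of particles having entered {k >= i} during ]0, t], wherever they
   come from and land. *)
Definition net_entered {n : nat} (w : R -> conf n) (i : int) (t : R) : int :=
  ntimes (fun s => exists x y, [/\ x < i, i <= y & jump w x y s]) t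
  - ntimes (fun s => exists x y, [/\ x < i, i <= y & jump w y x s]) t.

(* N_i(eta) *)
Definition Nright {n : nat} (eta : conf n) (i : int) : \bar R :=
  \esum_(k in [set k : int | i <= k]) ((occ eta k)%:R)%:E.

(* N(eta) - N_i(eta) = sum_(k < i) eta_k *)
Definition Nleft {n : nat} (eta : conf n) (i : int) : \bar R :=
  \esum_(k in [set k : int | k < i]) ((occ eta k)%:R)%:E.

(* N_i(eta(t)) - N_i(eta(0)) *)
Definition Nright_incr {n : nat} (w : R -> conf n) (i : int) (t : R) : \bar R :=
  if (Nright (w 0%R) i < +oo)%E then (Nright (w t) i - Nright (w 0%R) i)%E
  else ((net_entered w i t)%:~R)%:E.

(* N_x(eta) - N_i(eta) *)
Definition Ndiff {n : nat} (eta : conf n) (x i : int) : int :=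
  if x <= i then \sum_(0 <= m < `|i - x|%N) Posz (occ eta (x + Posz m))
  else - \sum_(0 <= m < `|x - i|%N) Posz (occ eta (i + Posz m)).

(* q^(2 (N(eta) - N_i(eta))), with q^(+oo) = 0 *)
Definition qpow_Nleft (q : R) {n : nat} (eta : conf n) (i : int) : R :=
  if Nleft eta i is r%:E then q `^ (2 * r) else 0.

Definition walk_gen (q : R) (n : nat) (f : discrete_topology int -> R)
    (x : discrete_topology int) : R :=
  let y : int := x in
  q ^ (Posz n) * qint q (Posz n) * (f (y - 1) - f y)
  + q ^ (- Posz n) * qint q (Posz n) * (f (y + 1) - f y).

(* On the discrete space int, [bcont] is the set of all bounded functions; the
   generator is a bounded operator there. *)
Definition is_walk (q : R) (n : nat) {d : measure_display}
    {Omega : measurableType d} (P : probability Omega R)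
    (x : R -> Omega -> discrete_topology int) : Prop :=
  markov_process P bcont (walk_gen q n) x.

End ASEP.

(* Main.v *)
(* Put v k = q^(2 (N_k - N_i)(eta)) E[q^(2 J_k(t))], the expected Hopf-Cole
   transform at site k.  The bond rates satisfy an identity that turns its drift
   into the lattice operator G of the reversed walk.  Cut [0,t] into N cells; over
   one cell the generator gives the change of v up to o(1/N), and letting N tend
   to infinity, |v k - sum_(p < P) t^p (G^p v_0) k / p!| <= W k (C t)^P / P! for a
   weight W, so v = exp(tG) v_0.  The walk expectations E_k have the same
   expansion for the walk generator, to which G is conjugate through the
   reversible weight q^(-2 n k).  Hence the k-th summand of the theorem is
   v k - v (k + 1), and the sum telescopes down to the limit of v at -oo.

   The identity for the current is pathwise: almost surely every discontinuity is
   a single nearest-neighbour jump and, when there are finitely many particles to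
   the right, some far bond is not crossed up to time t, since the p-th bond past
   the last particle is crossed with probability of order (c t)^p / p!. *)

Require Import Defs.
From mathcomp Require Import all_boot all_order all_algebra finmap ring lra zify.
From mathcomp Require Import all_classical all_reals all_analysis measurable_realfun.

Set Implicit Arguments.
Unset Strict Implicit.
Unset Printing Implicit Defensive.

Import Order.TTheory GRing.Theory Num.Theory.
Import numFieldNormedType.Exports.

Local Open Scope classical_set_scope.
Local Open Scope ring_scope.

(** * Power series of lattice operators *)

(** The current is a functional of the path, and counts of particles may be infinite, while the
    generator is known only on local functions and only as the time step tends to 0. On each cell
    q^(2 J) is therefore replaced by a weight that reads the two sites of the bond at both ends of
    the cell; the moment becomes an iterate T^m 1 of a weighted kernel. These iterates need not be
    local, so T^(m+1) 1 is read as T^m (T 1) and the generator meets only the local weight inside T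
    1. The drift leaves factors th^(eta_(k-1)) and th^(-eta_k), th = q^2, under T^m. Conservation of
    particles at a site lets them be pulled out up to o(1), at the price of moving the bond to k - 1
    or k + 1: this closes the system. The errors are small at each site but not uniformly in k, so
    no equation in a function space is solved. A Taylor polynomial at k involves finitely many sites
    only, which makes sitewise control enough; the weight W then bounds the remainder. *)

Section LatticeTaylor.
Context {R : realType}.
Implicit Types (f F W : int -> R) (h t e : R).

Definition lat (a b c : R) (f : int -> R) (k : int) : R :=
  a * f (k - 1) + b * f (k + 1) - c * f k.

(** Discrete counterpart of integrating s^p / p! to s^(p+1) / (p+1)!: by Pascal's rule ['C(m, p)] is
    the increment of ['C(m, p.+1)]. This is where the factorials of the Taylor and propagation
    estimates come from. *)
Lemma le_binomial_sum (f : nat -> R) (h B e : R) (p N : nat) : 0 <= h ->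
  f 0%N <= 0 ->
  (forall m, (m < N)%N ->
    f m.+1 - f m <= h * (B * (h ^+ p * 'C(m, p)%:R) + e)) ->
  forall m, (m <= N)%N ->
    f m <= B * (h ^+ p.+1 * 'C(m, p.+1)%:R) + m%:R * h * e.
Proof.
move=> h0 f0 fS; elim=> [|m IH] mN; first by rewrite bin0n /= !mulr0 !mul0r addr0.
have := IH (ltnW mN); have := fS _ mN.
rewrite binS natrD -natr1 exprS.
set x := h ^+ p; set y := 'C(m, p)%:R; set z := 'C(m, p.+1)%:R => H1 H2.
have -> : B * (h * x * (z + y)) + (m%:R + 1) * h * e =
  (B * (h * x * z) + m%:R * h * e) + h * (B * (x * y) + e) by ring.
lra.
Qed.

Variables a b c : R.
Local Notation G := (lat a b c).

(** The terms of degree below [P] in [G] of the Euler scheme (1 + h G)^m [F]. *)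
Definition newton h (P m : nat) F (k : int) : R :=
  \sum_(p < P) h ^+ p * 'C(m, p)%:R * iter p G F k.

Lemma newton_rec h P m F k :
  newton h P.+1 m.+1 F k - newton h P.+1 m F k = h * G (newton h P m F) k.
Proof.
rewrite /newton -sumrB big_ord_recl /= !bin0 subrr add0r /lat.
rewrite !mulr_sumr -big_split /= -sumrB mulr_sumr; apply: eq_bigr => p _.
rewrite /bump /= add1n binS natrD exprS /lat; ring.
Qed.

(** Induction on [P]: the bounds of order [P] at [k - 1], [k], [k + 1] are inserted in the one-step
    equation and summed over [m] by [le_binomial_sum]; order 0 is the a priori bound [W]. Finitely
    many sites enter at a given order, so the rank from which [N] is large may depend on [k]. *)
Lemma newton_taylor (v : nat -> nat -> int -> R) F W (C t : R) :
  0 <= t -> 0 <= C -> (forall k, 0 <= W k) ->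
  (forall k, `|a| * W (k - 1) + `|b| * W (k + 1) + `|c| * W k <= C * W k) ->
  (forall N k, v N 0%N k = F k) ->
  (forall k, \forall N \near \oo,
     forall m, (m <= N)%N -> `|v N m k| <= W k) ->
  (forall k e, 0 < e -> \forall N \near \oo, forall m, (m < N)%N ->
     `|v N m.+1 k - v N m k - t / N%:R * G (v N m) k| <= t / N%:R * e) ->
  forall P k e, 0 < e -> \forall N \near \oo, forall m, (m <= N)%N ->
    `|v N m k - newton (t / N%:R) P m F k| <=
      C ^+ P * W k * ((t / N%:R) ^+ P * 'C(m, P)%:R) + e.
Proof.
move=> t0 C0 W0 CW v0 vW vS; elim=> [|P IH] k e e0.
  near=> N => m mN; rewrite /newton big_ord0 subr0 !expr0 bin0 !mul1r mulr1.
  by apply: ler_wpDr; [exact: ltW|move: m mN; near: N; exact: vW].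
(* [A] dominates the coefficients of [G] and the horizon [t]. The accuracy [d] is asked of the
   one-step error and of the three inductive bounds, so that their accumulation over time [t] stays
   below [e]. *)
pose A : R := `|a| + `|b| + `|c| + t + 1.
have A1 : 1 <= A by rewrite /A; have := normr_ge0 a; have := normr_ge0 b;
  have := normr_ge0 c; lra.
have A0 : 0 < A by exact: lt_le_trans A1.
pose d := e / (A * (A + 1)).
have d0 : 0 < d by rewrite divr_gt0// mulr_gt0// ltr_wpDr.
have tAd : t * (d + A * d) <= e.
  have -> : e = A * (d + A * d).
    by rewrite /d; field; apply/andP; split; rewrite gt_eqF// addr_gt0.
  apply: ler_wpM2r; first exact: addr_ge0 (ltW d0) (mulr_ge0 (ltW A0) (ltW d0)).
  by rewrite /A; have := normr_ge0 a; have := normr_ge0 b; have := normr_ge0 c; lra.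
near=> N.
have H1 : forall m, (m <= N)%N -> `|v N m (k - 1) - newton (t / N%:R) P m F (k - 1)| <=
      C ^+ P * W (k - 1) * ((t / N%:R) ^+ P * 'C(m, P)%:R) + d.
  by near: N; exact: IH.
have H2 : forall m, (m <= N)%N -> `|v N m (k + 1) - newton (t / N%:R) P m F (k + 1)| <=
      C ^+ P * W (k + 1) * ((t / N%:R) ^+ P * 'C(m, P)%:R) + d.
  by near: N; exact: IH.
have H3 : forall m, (m <= N)%N -> `|v N m k - newton (t / N%:R) P m F k| <=
      C ^+ P * W k * ((t / N%:R) ^+ P * 'C(m, P)%:R) + d.
  by near: N; exact: IH.
have H4 : forall m, (m < N)%N ->
     `|v N m.+1 k - v N m k - t / N%:R * G (v N m) k| <= t / N%:R * d.
  by near: N; exact: vS.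
have N0 : (0 < N)%N by near: N; exact: nbhs_infty_gt.
have h0 : 0 <= t / N%:R by rewrite divr_ge0.
have step m : (m < N)%N ->
    `|(v N m.+1 k - newton (t / N%:R) P.+1 m.+1 F k) -
      (v N m k - newton (t / N%:R) P.+1 m F k)| <=
    t / N%:R * (C ^+ P.+1 * W k * ((t / N%:R) ^+ P * 'C(m, P)%:R) + (d + A * d)).
  move=> mN; have mN' := ltnW mN.
  have -> : (v N m.+1 k - newton (t / N%:R) P.+1 m.+1 F k) -
      (v N m k - newton (t / N%:R) P.+1 m F k) =
      (v N m.+1 k - v N m k - t / N%:R * G (v N m) k) +
      t / N%:R * (G (v N m) k - G (newton (t / N%:R) P m F) k).
    have := newton_rec (t / N%:R) P m F k.
    move: (newton _ _ _ _) (newton _ _ _ _) => x y E.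
    by rewrite [X in _ = _ + X]mulrBr -E; ring.
  apply: le_trans (ler_normD _ _) _; rewrite normrM (ger0_norm h0).
  set S := (t / N%:R) ^+ P * 'C(m, P)%:R in H1 H2 H3 *.
  have S0 : 0 <= S by rewrite mulr_ge0// exprn_ge0.
  have -> : t / N%:R * (C ^+ P.+1 * W k * S + (d + A * d)) =
    t / N%:R * d + t / N%:R * (C ^+ P.+1 * W k * S + A * d) by ring.
  apply: lerD; first exact: H4.
  apply: ler_wpM2l => //; rewrite /lat.
  have -> : a * v N m (k - 1) + b * v N m (k + 1) - c * v N m k -
    (a * newton (t / N%:R) P m F (k - 1) + b * newton (t / N%:R) P m F (k + 1) -
     c * newton (t / N%:R) P m F k) =
    a * (v N m (k - 1) - newton (t / N%:R) P m F (k - 1)) +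
    b * (v N m (k + 1) - newton (t / N%:R) P m F (k + 1)) -
    c * (v N m k - newton (t / N%:R) P m F k) by ring.
  apply: le_trans (ler_normB _ _) _; rewrite normrM.
  apply: le_trans (lerD (ler_normD _ _) (lexx _)) _; rewrite !normrM.
  have K1 := ler_wpM2l (normr_ge0 a) (H1 m mN').
  have K2 := ler_wpM2l (normr_ge0 b) (H2 m mN').
  have K3 := ler_wpM2l (normr_ge0 c) (H3 m mN').
  apply: le_trans (lerD (lerD K1 K2) K3) _.
  have CP : 0 <= C ^+ P by exact: exprn_ge0.
  have := ler_wpM2l (mulr_ge0 CP S0) (CW k).
  have -> : C ^+ P * S * (C * W k) = C ^+ P.+1 * W k * S by rewrite exprS; ring.
  have : (`|a| + `|b| + `|c|) * d <= A * d by rewrite ler_wpM2r ?(ltW d0)// /A; lra.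
  rewrite -/S; clear; move: (W (k - 1)) (W (k + 1)) (W k) (C ^+ P) S A d => w1 w2 w3 cp S A d; lra.
(* [le_binomial_sum] is one-sided: it is applied to the error and to its opposite. *)
have bnd (s : R) : `|s| = 1 -> forall m, (m <= N)%N ->
    s * (v N m k - newton (t / N%:R) P.+1 m F k) <=
      C ^+ P.+1 * W k * ((t / N%:R) ^+ P.+1 * 'C(m, P.+1)%:R) +
      m%:R * (t / N%:R) * (d + A * d).
  move=> s1; apply: le_binomial_sum => //.
    rewrite v0 /newton big_ord_recl /= bin0 mulr1 expr0 mul1r.
    rewrite big1 ?addr0 ?subrr ?mulr0// => i _.
    by rewrite /bump /= add1n bin0n /= mulr0 mul0r.
  move=> m mN; rewrite -mulrBr; apply: le_trans (ler_norm _) _.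
  by rewrite normrM s1 mul1r; exact: step.
move=> m mN.
have B1 := bnd 1 (normr1 _) m mN; have B2 := bnd (-1) (normrN1 _) m mN.
have mt : m%:R * (t / N%:R) * (d + A * d) <= e.
  apply: le_trans tAd; apply: ler_wpM2r; first exact: addr_ge0 (ltW d0) (mulr_ge0 (ltW A0) (ltW d0)).
  rewrite mulrCA ler_piMr//.
  by rewrite ler_pdivrMr ?ltr0n// mul1r ler_nat.
rewrite mul1r in B1; rewrite mulN1r in B2; rewrite ler_norml; apply/andP; split; lra.
Unshelve. all: by end_near.
Qed.

Lemma binomial_le h t (N p m : nat) : (m <= N)%N -> 0 <= t -> h = t / N%:R ->
  h ^+ p * 'C(m, p)%:R <= t ^+ p / p`!%:R.
Proof.
move=> mN t0 ->; elim: p => [|p IH]; first by rewrite !expr0 bin0 fact0 divr1 mulr1.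
(* For [N = 0] the mesh [t / 0] is 0 by convention and the left-hand side vanishes. *)
have [->|N0] := posnP N.
  by rewrite invr0 mulr0 expr0n /= mul0r divr_ge0// exprn_ge0.
have -> : (t / N%:R) ^+ p.+1 * 'C(m, p.+1)%:R =
  ((t / N%:R) ^+ p * 'C(m, p)%:R) * ((t * ((m - p)%:R / N%:R)) / p.+1%:R).
  have : p.+1%:R * 'C(m, p.+1)%:R = (m - p)%:R * 'C(m, p)%:R :> R.
    by rewrite -!natrM mul_bin_left.
  move: 'C(m, p.+1)%:R 'C(m, p)%:R => x y E; rewrite exprS.
  have -> : x = (m - p)%:R * y / p.+1%:R.
    by rewrite -E mulrAC divff ?mul1r// pnatr_eq0.
  by field; rewrite nat1r !pnatr_eq0/= -lt0n.
have -> : t ^+ p.+1 / (p.+1)`!%:R = t ^+ p / p`!%:R * (t / p.+1%:R).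
  rewrite exprS factS natrM; field.
  by rewrite nat1r !pnatr_eq0/= -!lt0n fact_gt0.
apply: ler_pM => //.
- by rewrite mulr_ge0// exprn_ge0// divr_ge0.
- by rewrite divr_ge0// mulr_ge0// divr_ge0.
- rewrite ler_wpM2r ?invr_ge0// ler_piMr// ler_pdivrMr ?ltr0n// mul1r ler_nat.
  exact: leq_trans (leq_subr _ _) mN.
Qed.

Lemma cvg_binomial t p :
  (t / N%:R) ^+ p * 'C(N, p)%:R @[N --> \oo] --> t ^+ p / p`!%:R.
Proof.
elim: p => [|p IH].
  rewrite expr0 fact0 divr1; apply: cvg_near_cst.
  by near=> N; rewrite expr0 bin0 mulr1.
(* The ratio of consecutive terms is t (1 - p / N) / (p + 1). *)
have -> : t ^+ p.+1 / (p.+1)`!%:R = t ^+ p / p`!%:R * (t * (1 - p%:R * 0) / p.+1%:R).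
  rewrite exprS factS natrM; field.
  by rewrite nat1r !pnatr_eq0/= -!lt0n fact_gt0.
have H : (fun N : nat => ((t / N%:R) ^+ p * 'C(N, p)%:R) *
    (t * (1 - p%:R * N%:R^-1) / p.+1%:R)) @ \oo -->
    t ^+ p / p`!%:R * (t * (1 - p%:R * 0) / p.+1%:R).
  apply: cvgM => //; apply: cvgM; last exact: cvg_cst.
  apply: cvgM; first exact: cvg_cst.
  apply: cvgB; first exact: cvg_cst.
  apply: cvgM; first exact: cvg_cst.
  exact/gtr0_cvgV0/cvgr_idn/nbhs_infty_gtr.
apply: cvg_trans H; apply: near_eq_cvg; near=> N.
have pN : (p <= N)%N by near: N; exact: nbhs_infty_ge.
have N0 : (0 < N)%N by near: N; exact: nbhs_infty_gt.
have : p.+1%:R * 'C(N, p.+1)%:R = (N%:R - p%:R) * 'C(N, p)%:R :> R.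
  by rewrite -natrB// -!natrM mul_bin_left.
move: 'C(N, p.+1)%:R 'C(N, p)%:R => x y E; rewrite exprS.
have -> : x = (N%:R - p%:R) * y / p.+1%:R.
  by rewrite -E mulrAC divff ?mul1r// pnatr_eq0.
by field; rewrite nat1r !pnatr_eq0/= -lt0n.
Unshelve. all: by end_near.
Qed.

Definition texp t (P : nat) F (k : int) : R :=
  \sum_(p < P) t ^+ p / p`!%:R * iter p G F k.

Lemma cvg_newton t P F k : newton (t / N%:R) P N F k @[N --> \oo] --> texp t P F k.
Proof.
elim: P => [|P IH].
  rewrite /texp big_ord0; apply: cvg_near_cst.
  by near=> N; rewrite /newton big_ord0.
rewrite /texp big_ord_recr -/(texp t P F k) /=; rewrite /newton.
under eq_fun do rewrite big_ord_recr /=.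
by apply: cvgD => //; apply: cvgMl; exact: cvg_binomial.
Unshelve. all: by end_near.
Qed.

Lemma cvg_exprn_fact (C : R) : C ^+ P / P`!%:R @[P --> \oo] --> (0 : R).
Proof. exact: cvg_series_cvg_0 (is_cvg_series_exp_coeff C). Qed.

Lemma cvg_of_exp_bound (u : nat -> R) (K C L : R) :
  (forall P, `|L - u P| <= K * (C ^+ P / P`!%:R)) -> u P @[P --> \oo] --> L.
Proof.
move=> H.
have KC : K * (C ^+ P / P`!%:R) @[P --> \oo] --> (0 : R).
  by rewrite -(mulr0 K); apply: cvgMr; exact: cvg_exprn_fact.
have NKC : - (K * (C ^+ P / P`!%:R)) @[P --> \oo] --> (0 : R).
  by rewrite -oppr0; exact: cvgN.
have : L - u P @[P --> \oo] --> (0 : R).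
  apply: (squeeze_cvgr _ NKC KC); near=> P; rewrite -ler_norml; exact: H.
move=> /(cvgB (cvg_cst L)); rewrite subr0; apply: cvg_trans.
by apply: near_eq_cvg; near=> P; rewrite /= subKr.
Unshelve. all: by end_near.
Qed.

Lemma newton_taylor_lim (v : nat -> nat -> int -> R) F W (C t : R) k L :
  0 <= t -> 0 <= C -> (forall k, 0 <= W k) ->
  (forall k, `|a| * W (k - 1) + `|b| * W (k + 1) + `|c| * W k <= C * W k) ->
  (forall N k, v N 0%N k = F k) ->
  (forall k, \forall N \near \oo,
     forall m, (m <= N)%N -> `|v N m k| <= W k) ->
  (forall k e, 0 < e -> \forall N \near \oo, forall m, (m < N)%N ->
     `|v N m.+1 k - v N m k - t / N%:R * G (v N m) k| <= t / N%:R * e) ->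
  v N N k @[N --> \oo] --> L ->
  forall P, `|L - texp t P F k| <= W k * ((C * t) ^+ P / P`!%:R).
Proof.
move=> t0 C0 W0 CW v0 vW vS vL P; apply/ler_addgt0Pr => e e0.
have H : `|v N N k - newton (t / N%:R) P N F k| @[N --> \oo] -->
    `|L - texp t P F k|.
  by apply: cvg_norm; apply: cvgB => //; exact: cvg_newton.
apply: (ler_cvg_to H (cvg_cst _)).
have := newton_taylor t0 C0 W0 CW v0 vW vS P k e0; apply: filterS => N HN /=.
apply: le_trans (HN N (leqnn N)) _; rewrite lerD2r.
have := ler_wpM2l (mulr_ge0 (W0 k) (exprn_ge0 P C0)) (binomial_le P (leqnn N) t0 erefl).
by rewrite (mulrC (C ^+ P)) (exprMn P C t) !mulrA.
Qed.

Lemma iter_latB p F F' k :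
  iter p G (fun k => F k - F' k) k = iter p G F k - iter p G F' k.
Proof.
elim: p k => [//|p IH] k; rewrite !iterS {1}/lat !IH /lat; ring.
Qed.

Lemma texpB t P F F' k :
  texp t P (fun k => F k - F' k) k = texp t P F k - texp t P F' k.
Proof.
by rewrite /texp -sumrB; apply: eq_bigr => p _; rewrite iter_latB mulrBr.
Qed.

Lemma iter_lat_shift p F k : iter p G (fun y => F (y + 1)) k = iter p G F (k + 1).
Proof.
elim: p k => [//|p IH] k; rewrite !iterS {1}/lat !IH /lat.
by rewrite (addrAC k (-1)).
Qed.

Lemma texp_shift t P F k : texp t P (fun y => F (y + 1)) k = texp t P F (k + 1).
Proof. by apply: eq_bigr => p _; rewrite iter_lat_shift. Qed.

Lemma iter_lat_le p F W (C : R) k : 0 <= C ->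
  (forall k, `|F k| <= W k) ->
  (forall k, `|a| * W (k - 1) + `|b| * W (k + 1) + `|c| * W k <= C * W k) ->
  `|iter p G F k| <= C ^+ p * W k.
Proof.
move=> C0 FW CW; elim: p k => [|p IH] k /=; first by rewrite expr0 mul1r.
rewrite {1}/lat; apply: le_trans (ler_normB _ _) _.
apply: le_trans (lerD (ler_normD _ _) (lexx _)) _; rewrite !normrM.
have K1 := ler_wpM2l (normr_ge0 a) (IH (k - 1)).
have K2 := ler_wpM2l (normr_ge0 b) (IH (k + 1)).
have K3 := ler_wpM2l (normr_ge0 c) (IH k).
apply: le_trans (lerD (lerD K1 K2) K3) _.
have := ler_wpM2l (exprn_ge0 p C0) (CW k); rewrite exprS.
move: (W (k - 1)) (W (k + 1)) (W k) (C ^+ p) => w1 w2 w3 cp; lra.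
Qed.

(** [G] has range one, so each application enlarges the set of sites read by one on both sides. This
    lets an unbounded function be truncated without changing a given Taylor polynomial. *)
Lemma iter_lat_ext p F F' k : (forall y, (`|y - k| <= p)%N -> F y = F' y) ->
  iter p G F k = iter p G F' k.
Proof.
elim: p k => [|p IH] k H /=; first by apply: H; rewrite subrr.
by rewrite /lat !IH// => y yk; apply: H; lia.
Qed.

Lemma texp_ext t P F F' k : (forall y, (`|y - k| <= P)%N -> F y = F' y) ->
  texp t P F k = texp t P F' k.
Proof.
move=> H; apply: eq_bigr => p _; congr (_ * _); apply: iter_lat_ext => y yk.
by apply: H; rewrite (leq_trans yk)// ltnW.
Qed.

(** In the sup norm weighted by [W] the operator has norm at most [C], so the tail is dominated by
    that of exp(C t). The bound sees [F] only through [W], hence is uniform over truncations of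
    [F]. *)
Lemma texp_tail t P P' F W (C : R) k : 0 <= t -> 0 <= C -> (forall k, 0 <= W k) ->
  (forall k, `|F k| <= W k) ->
  (forall k, `|a| * W (k - 1) + `|b| * W (k + 1) + `|c| * W k <= C * W k) ->
  (P <= P')%N ->
  `|texp t P' F k - texp t P F k| <=
    W k * (expR (C * t) - series (exp_coeff (C * t)) P).
Proof.
move=> t0 C0 W0 FW CW PP'.
have H : `|texp t P' F k - texp t P F k| <=
    W k * (series (exp_coeff (C * t)) P' - series (exp_coeff (C * t)) P).
  rewrite /texp -!(big_mkord predT (fun p => t ^+ p / p`!%:R * iter p G F k)).
  rewrite /series /= !(big_cat_nat (leq0n P) PP') /=.
  rewrite [X in `|X|]addrAC subrr add0r [X in _ * X]addrAC subrr add0r.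
  apply: le_trans (ler_norm_sum _ _ _) _; rewrite mulr_sumr; apply: ler_sum => p _.
  have tp : 0 <= t ^+ p / p`!%:R by rewrite divr_ge0// exprn_ge0.
  rewrite normrM (ger0_norm tp).
  apply: le_trans (ler_wpM2l tp (iter_lat_le p k C0 FW CW)) _.
  by rewrite /exp_coeff /= exprMn le_eqVlt; apply/orP; left; apply/eqP; ring.
apply: le_trans H _; apply: ler_wpM2l => //; rewrite lerD2r.
apply: nondecreasing_cvgn_le; last exact: is_cvg_series_exp_coeff.
apply/nondecreasing_seqP => p; rewrite /series /= big_nat_recr //= lerDl.
by rewrite /exp_coeff /= divr_ge0// exprn_ge0// mulr_ge0.
Qed.

End LatticeTaylor.

(** For r = q^(2n) this exchanges the two jump rates of the walk, which expresses its
    reversibility. *)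
Lemma iter_lat_conj {R : realType} (a b c r : R) p (F : int -> R) k : 0 < r ->
  r ^ (- k) * iter p (lat a b c) (fun y => r ^ y * F y) k =
  iter p (lat (a / r) (b * r) c) F k.
Proof.
move=> r0; have rn : r != 0 by rewrite gt_eqF.
have E m : iter p (lat a b c) (fun y => r ^ y * F y) m =
    r ^ m * iter p (lat (a / r) (b * r) c) F m.
  elim: p m => //= p IH m; rewrite /lat !IH !(expfzDr _ _ rn) expr1z.
  rewrite exprN1; field; exact: rn.
by rewrite E mulrA -expfzDr// addNr expr0z mul1r.
Qed.

(** * Speed of propagation from a half-line *)

Section OneSided.
Context {R : realType}.

(** What starts to the left of [K] needs one integration in time per site travelled, whence a factor
    of order t^p / p! at [K + p]. The 2 in [2 * C] counts the two neighbours, both of which lie at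
    distance at least [p] when [k] is at distance [p + 1]. *)
Lemma propagation_bound (u : nat -> nat -> int -> R) (t C M : R) (K : int) :
  0 <= t -> 0 <= C -> 0 <= M ->
  (forall N k, K <= k -> u N 0%N k <= 0) ->
  (forall N m k, u N m k <= M) ->
  (forall k e, 0 < e -> \forall N \near \oo, forall m, (m < N)%N ->
     u N m.+1 k - u N m k <= t / N%:R * (C * (u N m (k - 1) + u N m (k + 1)) + e)) ->
  forall (p : nat) k e, 0 < e -> K + p%:Z <= k -> \forall N \near \oo,
    forall m, (m <= N)%N ->
    u N m k <= M * ((2 * C) ^+ p) * ((t / N%:R) ^+ p * 'C(m, p)%:R) + e.
Proof.
move=> t0 C0 M0 u0 uM uS; elim=> [|p IH] k e e0 Kk.
  near=> N => m _; rewrite !expr0 bin0 !mulr1; apply: ler_wpDr; [exact: ltW|exact: uM].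
have [A [A1 CA tA]] : exists A : R, [/\ 1 <= A, C <= A & t <= A].
  by exists (t + C + 1); split; lra.
have A0 : 0 < A by exact: lt_le_trans A1.
pose d := e / (A * (2 * A + 1)).
have d0 : 0 < d by rewrite divr_gt0// mulr_gt0//; lra.
have tAd : t * (d + 2 * A * d) <= e.
  have -> : e = A * (d + 2 * A * d).
    by rewrite /d; field; apply/andP; split; rewrite gt_eqF//; lra.
  have : 0 <= d + 2 * A * d by rewrite addr_ge0 ?(ltW d0)// mulr_ge0 ?(ltW d0)//; lra.
  by move=> /ler_wpM2r; apply.
have Kk' : K <= k by clear -Kk; lia.
have Km : K + p%:Z <= k - 1 by clear -Kk; lia.
have Kp : K + p%:Z <= k + 1 by clear -Kk; lia.
have N0 : \forall N \near \oo, (0 < N)%N by exact: nbhs_infty_gt.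
apply: filterS (filterI (filterI (IH _ _ d0 Km) (IH _ _ d0 Kp))
  (filterI (uS k d d0) N0)) => N [[H1 H2] [H3 {}N0]] m mN.
have h0 : 0 <= t / N%:R by rewrite divr_ge0.
have P0 : 0 <= d + 2 * A * d.
  by apply: addr_ge0 (ltW d0) (mulr_ge0 _ (ltW d0)); lra.
have step l : (l < N)%N -> u N l.+1 k - u N l k <= t / N%:R *
    (M * (2 * C) ^+ p.+1 * ((t / N%:R) ^+ p * 'C(l, p)%:R) + (d + 2 * A * d)).
  move=> lN; apply: le_trans (H3 l lN) _; apply: ler_wpM2l => //.
  have := ler_wpM2l C0 (lerD (H1 l (ltnW lN)) (H2 l (ltnW lN))).
  have : C * d <= A * d by exact: (ler_wpM2r (ltW d0) CA).
  rewrite exprS; clear.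
  move: (_ * 'C(l, p)%:R) ((2 * C) ^+ p) (u N l (k - 1)) (u N l (k + 1)) A d.
  by move=> x y z z' A d; lra.
apply: le_trans (le_binomial_sum h0 (u0 N k Kk') step mN) _.
rewrite lerD2l; apply: le_trans tAd; apply: ler_wpM2r => //.
rewrite mulrCA ler_piMr// ler_pdivrMr ?ltr0n// mul1r ler_nat.
exact: mN.
Unshelve. all: by end_near.
Qed.

End OneSided.

(** * Configurations and jumps *)

Section Windows.
Context {n : nat}.
Implicit Types (L : seq int) (eta xi zeta : conf n).

Definition agree L eta xi : Prop := forall k, k \in L -> eta k = xi k.

Lemma agree_refl L eta : agree L eta eta. Proof. by []. Qed.

Lemma agreeC L eta xi : agree L eta xi -> agree L xi eta.
Proof. by move=> H k /H. Qed.

Lemma agree_trans L eta xi zeta : agree L eta xi -> agree L xi zeta -> agree L eta zeta.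
Proof. by move=> H H' k kL; rewrite H// H'. Qed.

Lemma agree_sub L L' eta xi : {subset L <= L'} -> agree L' eta xi -> agree L eta xi.
Proof. by move=> LL' H k /LL'; exact: H. Qed.

Lemma agree_occ L eta xi k : agree L eta xi -> k \in L -> occ eta k = occ xi k.
Proof. by move=> H kL; rewrite /occ H. Qed.

(** A window takes finitely many values. Passing to [win] and back by [fill] turns estimates for
    single local functions into estimates uniform in the configuration. *)
Definition win L eta : (size L).-tuple 'I_n.+1 :=
  map_tuple (fun k => eta k : 'I_n.+1) (in_tuple L).

Definition fill L (z : (size L).-tuple 'I_n.+1) : conf n :=
  fun k => nth ord0 z (index k L).

Lemma fill_win L eta : agree L (fill (win L eta)) eta.
Proof.
by move=> k kL; rewrite /fill /= (nth_map 0) ?nth_index// index_mem.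
Qed.

Lemma win_agree L eta xi : agree L eta xi -> win L eta = win L xi.
Proof. by move=> H; apply: val_inj => /=; apply/eq_in_map => k /H. Qed.

Lemma cvg_coord {T : Type} (F : set_system T) (FF : Filter F) (w : T -> conf n) zeta k :
  w s @[s --> F] --> zeta -> \forall s \near F, w s k = zeta k.
Proof.
move=> H; have : (fun s => w s k) @ F --> (zeta k : discrete_topology 'I_n.+1).
  have := @proj_continuous int (fun=> discrete_topology 'I_n.+1) k zeta.
  exact: (@cvg_comp _ _ _ w (@proj int (fun=> discrete_topology 'I_n.+1) k) _ _ _ H).
by move=> /(_ [set zeta k]); apply; exact: discrete_set1.
Qed.

Lemma cvg_agree {T : Type} (F : set_system T) (FF : Filter F) (w : T -> conf n) zeta L :
  w s @[s --> F] --> zeta -> \forall s \near F, agree L zeta (w s).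
Proof.
move=> H; elim: L => [|k L IH]; first by apply: nearW => s.
apply: filterS2 IH (cvg_coord FF k H) => s sL sk k'.
by rewrite in_cons => /orP[/eqP->//|]; exact: sL.
Qed.

Lemma near_agree L eta : \forall xi \near eta, agree L eta xi.
Proof. exact: (@cvg_agree _ (nbhs eta) _ id eta L). Qed.

Definition loc {Y : Type} L (f : conf n -> Y) : Prop :=
  forall eta xi, agree L eta xi -> f eta = f xi.

Lemma loc_fill {Y : Type} L (f : conf n -> Y) eta : loc L f -> f (fill (win L eta)) = f eta.
Proof. by move=> fL; apply: fL; exact: (@fill_win L). Qed.

Lemma open_loc L (A : set (conf n)) : loc L A -> open A.
Proof.
move=> H; rewrite openE => eta Aeta; have := near_agree L eta.
by apply: filterS => xi /H <-.
Qed.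

Context {R : realType}.

Lemma loc_bcont L (f : conf n -> R) : loc L f -> bcont f.
Proof.
move=> fL; split.
  move=> eta U /nbhs_singleton fU; have := near_agree L eta.
  by apply: filterS => xi A /=; rewrite -(fL _ _ A).
exists (\sum_(z : (size L).-tuple 'I_n.+1) `|f (fill z)|) => eta.
rewrite -(loc_fill eta fL) (bigD1 (win L eta))//= lerDl.
exact: sumr_ge0.
Qed.

Lemma loc_local L (f : conf n -> R) : loc L f -> local_fun f.
Proof. by move=> H; exists L. Qed.

End Windows.

(** * Single jumps seen through finite windows *)

Section Moves.
Context {n : nat}.
Implicit Types (L : seq int) (eta xi zeta : conf n).

Lemma occ_le eta k : (occ eta k <= n)%N.
Proof. by rewrite /occ -ltnS ltn_ord. Qed.

Lemma conf_ext eta xi : (forall k, occ eta k = occ xi k) -> eta = xi.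
Proof. by move=> H; apply/funext => k; apply: val_inj; exact: H. Qed.

Lemma occ_move_src x y eta : occ (move x y eta) x = (occ eta x).-1.
Proof.
by rewrite /move /occ eqxx inordK// ltnS (leq_trans (leq_pred _))// -ltnS ltn_ord.
Qed.

Lemma occ_move_dst x y eta : x != y -> (occ eta y < n)%N ->
  occ (move x y eta) y = (occ eta y).+1.
Proof.
by move=> xy yn; rewrite /move /occ eq_sym (negbTE xy) eqxx inordK.
Qed.

Lemma move_out x y eta k : k != x -> k != y -> move x y eta k = eta k.
Proof. by rewrite /move => /negbTE -> /negbTE ->. Qed.

Lemma occ_move x y eta k : x != y -> (k = y -> (occ eta y < n)%N) ->
  occ (move x y eta) k = if k == x then (occ eta k).-1
                         else if k == y then (occ eta k).+1 else occ eta k.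
Proof.
move=> xy yn; case: eqVneq => [->|kx]; first exact: occ_move_src.
case: eqVneq => [ky|ky]; first by rewrite ky occ_move_dst// yn.
by rewrite /occ move_out.
Qed.

Lemma nbr_neq (x y : int) : y = x + 1 \/ y = x - 1 -> x != y.
Proof. by move=> [->|->]; lia. Qed.

(* [xi] looks, on the sites of [L], like the result of a jump to a
   nearest neighbour (possibly outside [L]). *)
Definition perm L eta xi : Prop := exists x y : int,
  [/\ y = x + 1 \/ y = x - 1, x \in L -> (0 < occ eta x)%N,
      y \in L -> (occ eta y < n)%N & agree L xi (move x y eta)].

Lemma perm_loc L eta eta' xi xi' : agree L eta eta' -> agree L xi xi' ->
  perm L eta xi -> perm L eta' xi'.
Proof.
move=> H H' [x [y [xy x0 yn E]]]; exists x, y; split=> //.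
- by move=> xL; rewrite -(agree_occ H xL) x0.
- by move=> yL; rewrite -(agree_occ H yL) yn.
move=> k kL; rewrite -(H' k kL) E// /move.
by rewrite /occ (H k kL).
Qed.

Lemma perm_refl L eta : perm L eta eta.
Proof.
pose s := \sum_(k <- L) `|k|%N.
have sL k : k \in L -> (`|k| <= s)%N.
  by move=> kL; rewrite /s (big_rem k)//= leq_addr.
(* A jump between two sites beyond the whole window leaves no trace in it. *)
exists (s.+1%:Z), (s.+1%:Z + 1); split; first by left.
- by move=> /sL; lia.
- by move=> /sL; lia.
by move=> k /sL ks; rewrite move_out//; apply/eqP; lia.
Qed.

Definition nnmove eta xi : Prop := exists x y : int,
  [/\ y = x + 1 \/ y = x - 1, (0 < occ eta x)%N, (occ eta y < n)%N & xi = move x y eta].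

Lemma nnmove_perm L eta xi : nnmove eta xi -> perm L eta xi.
Proof. by move=> [x [y [xy x0 yn ->]]]; exists x, y; split. Qed.

(** A priori each window shows its own jump. If the configurations differ at [k0], the jump seen in
    the window of radius |k0| + 2 touches [k0], so both its ends lie inside. One site is then known
    to lose a particle and one to gain a particle, which identifies the jump shown by every larger
    window. *)
Lemma perm_nnmove eta xi : (forall l : nat,
    perm [seq (i%:Z - l%:Z) | i <- iota 0 (l + l).+1] eta xi) ->
  xi = eta \/ nnmove eta xi.
Proof.
move=> H; pose W (l : nat) : seq int := [seq (i%:Z - l%:Z) | i <- iota 0 (l + l).+1].
have inW l (k : int) : (`|k| <= l)%N -> k \in W l.
  move=> kl; apply/mapP; exists (absz (k + l%:Z)); first by rewrite mem_iota; lia.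
  by lia.
have [->|] := pselect (xi = eta); first by left.
move=> E; right.
have [k0 kE] : exists k, occ eta k != occ xi k.
  apply: contrapT => /forallNP N; apply: E; apply/esym/conf_ext => k.
  by apply/eqP/negPn/negP; exact: N.
have [x [y [xy x0 yn A]]] := H (`|k0| + 2)%N.
have xny := nbr_neq xy.
have kxy : k0 = x \/ k0 = y.
  have [->|kx] := eqVneq k0 x; first by left.
  have [->|ky] := eqVneq k0 y; first by right.
  by move: kE; rewrite /occ A ?move_out ?eqxx//; apply: inW; lia.
have xb : (absz x <= absz k0 + 1)%N by clear -xy kxy; lia.
have yb : (absz y <= absz k0 + 1)%N by clear -xy kxy; lia.
have xW : x \in W (absz k0 + 2)%N by apply: inW; clear -xb; lia.
have yW : y \in W (absz k0 + 2)%N by apply: inW; clear -yb; lia.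
have {}x0 := x0 xW; have {}yn := yn yW.
exists x, y; split=> //; apply/funext => k.
have [x' [y' [xy' x0' yn' A']]] := H (absz k + absz k0 + 3)%N.
have xny' := nbr_neq xy'.
have W' (j : int) : (absz j <= absz k + absz k0 + 3)%N ->
    occ xi j = occ (move x' y' eta) j.
  by move=> jl; rewrite /occ A'//; exact: inW.
have Ex := W' x ltac:(clear -xb; lia); have Ey := W' y ltac:(clear -yb; lia).
rewrite {1}/occ (A x xW) -/(occ _ _) occ_move_src in Ex.
rewrite {1}/occ (A y yW) -/(occ _ _) occ_move_dst// in Ey.
have xx' : x = x'.
  apply/eqP/negPn/negP => xx'; move: Ex; rewrite occ_move//; last first.
    by move=> E'; apply: yn'; rewrite -E'; apply: inW; clear -xb; lia.
  by rewrite (negbTE xx'); case: ifP => _; clear -x0; lia.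
have yy' : y = y'.
  apply/eqP/negPn/negP => yy'; move: Ey; rewrite occ_move//; last first.
    by move=> Eyy'; move: yy'; rewrite Eyy' eqxx.
  by rewrite (negbTE yy'); case: ifP => _; clear; lia.
by rewrite A' ?xx' ?yy'//; apply: inW; clear; lia.
Qed.

(* When [xi] is obtained from [eta] by a nearest-neighbour jump, this is the net
   number of particles crossing the bond [(k - 1, k)]; other pairs get junk. *)
Definition delta (k : int) eta xi : int :=
  (((occ xi (k - 1)).+1 == occ eta (k - 1)) && (occ xi k == (occ eta k).+1))%:Z
  - (((occ eta (k - 1)).+1 == occ xi (k - 1)) && (occ eta k == (occ xi k).+1))%:Z.

Lemma delta_loc k eta eta' xi xi' : agree [:: k - 1; k] eta eta' ->
  agree [:: k - 1; k] xi xi' -> delta k eta xi = delta k eta' xi'.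
Proof.
move=> H H'; have k1 : k - 1 \in [:: k - 1; k] by rewrite !inE eqxx.
have k2 : k \in [:: k - 1; k] by rewrite !inE eqxx orbT.
by rewrite /delta !(agree_occ H)// !(agree_occ H').
Qed.

Lemma delta_refl k eta : delta k eta eta = 0.
Proof. by rewrite /delta; lia. Qed.

(** Continuity equation for one transition. A jump with only one end in the window does no harm:
    [delta] asks for opposite changes at both ends of a bond, so it does not count a jump over the
    neighbouring bond. *)
Lemma perm_conservation k eta xi : perm [:: k - 1; k; k + 1] eta xi ->
  (occ xi k)%:Z - (occ eta k)%:Z = delta k eta xi - delta (k + 1) eta xi.
Proof.
move=> [x [y [xy x0 yn A]]]; have xny := nbr_neq xy.
have k1 : k - 1 \in [:: k - 1; k; k + 1] by rewrite !inE eqxx.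
have k2 : k \in [:: k - 1; k; k + 1] by rewrite !inE eqxx orbT.
have k3 : k + 1 \in [:: k - 1; k; k + 1] by rewrite !inE eqxx !orbT.
have O j : j \in [:: k - 1; k; k + 1] ->
    (occ xi j)%:Z = (occ eta j)%:Z + (j == y)%:Z - (j == x)%:Z.
  move=> jL; rewrite /occ (A j jL) -/(occ _ _) occ_move//; last first.
    by move=> jy; apply: yn; rewrite -jy.
  rewrite -/(occ _ _); have [jx|jx] := eqVneq j x.
    have := x0; rewrite -jx => /(_ jL) j0.
    have -> : (j == y) = false by rewrite jx; exact: negbTE.
    by lia.
  by case: eqVneq => jy; lia.
have := O _ k1; have := O _ k2; have := O _ k3; rewrite /delta addrK.
move: (occ eta (k - 1)) (occ eta k) (occ eta (k + 1)) => a b c.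
move: (occ xi (k - 1)) (occ xi k) (occ xi (k + 1)) => a' b' c'.
clear -xy.
have H : x = k - 2 \/ x = k - 1 \/ x = k \/ x = k + 1 \/ x = k + 2 \/ x < k - 2 \/ k + 2 < x by lia.
(* Enumeration of the positions of the jump relative to the three sites. *)
case: xy => yx; repeat (case: H => H);
  have e1 : ((k - 1 == x) = false) \/ ((k - 1 == x) = true) by lia.
all: have e2 : ((k == x) = false) \/ ((k == x) = true) by lia.
all: have e3 : ((k + 1 == x) = false) \/ ((k + 1 == x) = true) by lia.
all: have e4 : ((k - 1 == y) = false) \/ ((k - 1 == y) = true) by lia.
all: have e5 : ((k == y) = false) \/ ((k == y) = true) by lia.
all: have e6 : ((k + 1 == y) = false) \/ ((k + 1 == y) = true) by lia.
all: case: e1 => e1; try (by exfalso; lia).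
all: case: e2 => e2; try (by exfalso; lia).
all: case: e3 => e3; try (by exfalso; lia).
all: case: e4 => e4; try (by exfalso; lia).
all: case: e5 => e5; try (by exfalso; lia).
all: case: e6 => e6; try (by exfalso; lia).
all: rewrite e1 e2 e3 e4 e5 e6; clear; move=> E3 E2 E1.
all: lia.
Qed.

End Moves.

(** * Cadlag paths and their currents *)

Section RealInduction.
Context {R : realType}.

Lemma near_at_right (s : R) (P : R -> Prop) :
  (\forall r \near s^'+, P r) -> exists2 e, 0 < e & forall r, s < r < s + e -> P r.
Proof.
move=> /nbhs_ballP[e /= e0 H]; exists e => // r /andP[sr re].
apply: H => //; rewrite -ball_normE /= ltr_distlC; apply/andP; split; lra.
Qed.

Lemma near_at_left (s : R) (P : R -> Prop) :
  (\forall r \near s^'-, P r) -> exists2 e, 0 < e & forall r, s - e < r < s -> P r.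
Proof.
move=> /nbhs_ballP[e /= e0 H]; exists e => // r /andP[sr re].
apply: H => //; rewrite -ball_normE /= ltr_distlC; apply/andP; split; lra.
Qed.

(** The set of [s] with [P] valid on [0, s] contains its supremum if it is bounded, by the third
    hypothesis, and then goes beyond it, by the second. *)
Lemma real_induction (P : R -> Prop) : P 0 ->
  (forall s, 0 <= s -> P s -> exists2 e, 0 < e & forall r, s < r < s + e -> P r) ->
  (forall s, 0 < s -> (forall r, 0 <= r < s -> P r) -> P s) ->
  forall t, 0 <= t -> P t.
Proof.
move=> P0 Pr Pl t t0; apply: contrapT => nPt.
pose A := [set s | 0 <= s /\ forall r, 0 <= r <= s -> P r].
have A0 : A 0 by split=> // r; rewrite -eq_le => /eqP <-.
have At s : A s -> s <= t.
  move=> [s0 sP]; rewrite leNgt; apply/negP => ts; apply: nPt; apply: sP.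
  by rewrite t0 ltW.
have hA : has_sup A by split; [exists 0|exists t].
set u := sup A.
have u0 : 0 <= u by exact: sup_upper_bound hA _ A0.
have Pu r : 0 <= r < u -> P r.
  move=> /andP[r0 ru].
  have [s [s0 sP] rs] := @sup_adherent _ A (u - r) ltac:(by rewrite subr_gt0) hA.
  by apply: sP; rewrite r0/=; apply: ltW; move: rs; rewrite subKr.
have Puu : P u.
  have [<-//|u0'] := eqVneq 0 u; apply: Pl => //.
  by rewrite lt_neqAle u0' u0.
have [e e0 eP] := Pr u u0 Puu.
have : A (u + e / 2).
  split; first by rewrite addr_ge0// divr_ge0// ltW.
  move=> r /andP[r0 ru]; have [ru'|ur] := ltP r u; first by apply: Pu; rewrite r0.
  have [<-//|ur'] := eqVneq u r; apply: eP; rewrite lt_neqAle ur' ur/=; lra.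
by move=> /(sup_upper_bound hA); rewrite -/u; lra.
Qed.

End RealInduction.

Section Paths.
Context {R : realType} {n : nat}.
Implicit Types (L : seq int) (eta xi zeta : conf n) (w : R -> conf n).

Lemma cadlag_flat w s L : cadlag w -> 0 <= s ->
  exists2 e, 0 < e & forall r, s <= r < s + e -> agree L (w s) (w r).
Proof.
move=> [cr _] s0; have [e e0 H] := near_at_right (cvg_agree _ L (cr s s0)).
exists e => // r /andP[sr re]; have [<-//|sr'] := eqVneq s r.
by apply: H; rewrite lt_neqAle sr' sr.
Qed.

Lemma left_flat w s zeta L : w r @[r --> s^'-] --> zeta ->
  exists2 e, 0 < e & forall r, s - e < r < s -> agree L zeta (w r).
Proof. by move=> H; exact: near_at_left (cvg_agree _ L H). Qed.

Lemma left_limit_uniq w s zeta zeta' : w r @[r --> s^'-] --> zeta ->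
  w r @[r --> s^'-] --> zeta' -> zeta = zeta'.
Proof.
move=> H H'; apply/funext => k.
have [e e0 He] := left_flat [:: k] H; have [e' e0' He'] := left_flat [:: k] H'.
pose r := s - Num.min e e' / 2.
have m0 : 0 < Num.min e e' by rewrite lt_min e0.
have me : Num.min e e' <= e by rewrite ge_min lexx.
have me' : Num.min e e' <= e' by rewrite ge_min lexx orbT.
rewrite (He r) ?inE// /r; last by apply/andP; split; lra.
by rewrite (He' r) ?inE// /r; apply/andP; split; lra.
Qed.

(** Occupation numbers are discrete, so through a finite window a cadlag path is constant just after
    and just before each time. Only flat stretches and single transitions from a left limit remain
    to be checked. *)
Lemma path_induction w L (P : R -> Prop) : cadlag w -> P 0 ->
  (forall s s', 0 <= s -> s < s' -> (forall r, s <= r <= s' -> agree L (w s) (w r)) ->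
     P s -> P s') ->
  (forall r s zeta, 0 <= r -> r < s -> w u @[u --> s^'-] --> zeta ->
     (forall u, r <= u < s -> agree L zeta (w u)) -> P r -> P s) ->
  forall t, 0 <= t -> P t.
Proof.
move=> cw P0 Pr Pl; apply: real_induction => //.
  move=> s s0 Ps; have [e e0 He] := cadlag_flat L cw s0; exists e => // r /andP[sr re].
  apply: (Pr s) => // u /andP[su ur]; apply: He; rewrite su/=.
  exact: le_lt_trans re.
move=> s s0 Ps; have [zeta Hz] := cw.2 s s0.
have [e e0 He] := left_flat L Hz.
pose r := Num.max 0 (s - e / 2).
have r0 : 0 <= r by rewrite /r le_max lexx.
have rs : r < s by rewrite /r gt_max s0/=; lra.
have re : s - e < r by rewrite /r lt_max; apply/orP; right; lra.
apply: (Pl r s zeta) => //; last by apply: Ps; rewrite r0.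
by move=> u /andP[ru us]; apply: He; rewrite us andbT (lt_le_trans re).
Qed.

(** The definition of the process does not impose this on every path. It holds almost surely
    ([ae_legit]), and the pathwise identities for currents rest on it. *)
Definition legit w : Prop := forall s zeta, 0 < s -> w r @[r --> s^'-] --> zeta ->
  w s = zeta \/ nnmove zeta (w s).

Lemma move_inj x y x' y' zeta : x != y -> x' != y' ->
  (0 < occ zeta x)%N -> (occ zeta y < n)%N -> (0 < occ zeta x')%N -> (occ zeta y' < n)%N ->
  move x y zeta = move x' y' zeta -> x = x' /\ y = y'.
Proof.
move=> xy xy' x0 yn x0' yn' E.
have Ex : occ (move x y zeta) x = occ (move x' y' zeta) x by rewrite E.
have Ey : occ (move x y zeta) y = occ (move x' y' zeta) y by rewrite E.
split.
  apply/eqP/negPn/negP => xx'; move: Ex; rewrite occ_move_src occ_move//.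
  by rewrite (negbTE xx'); case: ifP => _; lia.
apply/eqP/negPn/negP => yy'; move: Ey; rewrite occ_move_dst// occ_move//.
by rewrite (negbTE yy'); case: ifP => _; lia.
Qed.

Lemma jump_left w x y s zeta : w r @[r --> s^'-] --> zeta -> jump w x y s ->
  [/\ (0 < occ zeta x)%N, (occ zeta y < n)%N & w s = move x y zeta].
Proof. by move=> H [zeta' [H' x0 yn E]]; rewrite (left_limit_uniq H H'). Qed.

Lemma legit_jump w x y s : legit w -> 0 < s -> x != y -> jump w x y s ->
  y = x + 1 \/ y = x - 1.
Proof.
move=> lw s0 xy [zeta [H x0 yn E]].
have [E'|[x' [y' [xy' x0' yn' E']]]] := lw s zeta s0 H.
  by have := occ_move_src x y zeta; rewrite -E E'; lia.
by have [-> ->] := move_inj xy (nbr_neq xy') x0 yn x0' yn' (etrans (esym E) E').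
Qed.

(** A legitimate transition changes two neighbouring sites in opposite directions, so the occupation
    numbers at the ends of a bond reveal whether it was crossed. *)
Lemma delta_jump w k s zeta : legit w -> 0 < s -> w r @[r --> s^'-] --> zeta ->
  delta k zeta (w s) = `[<jump w (k - 1) k s>]%:Z - `[<jump w k (k - 1) s>]%:Z.
Proof.
move=> lw s0 H.
have k1k : k - 1 != k by lia.
have E1 : ((occ (w s) (k - 1)).+1 == occ zeta (k - 1)) && (occ (w s) k == (occ zeta k).+1)
    = `[<jump w (k - 1) k s>].
  apply/idP/asboolP; last first.
    move=> /(jump_left H)[x0 yn ->].
    by rewrite occ_move_src occ_move_dst// eqxx andbT prednK.
  move=> /andP[/eqP E1 /eqP E2].
  have [E|[x [y [xy x0 yn E]]]] := lw s zeta s0 H; first by move: E1; rewrite E; lia.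
  have xny := nbr_neq xy.
  move: E1 E2; rewrite E !occ_move//.
  have [kx|n1] := eqVneq (k - 1) x; last first.
    by case: ifP => _; lia.
  rewrite -kx eq_sym (negbTE k1k); have [ky|n2] := eqVneq k y; last by lia.
  by move=> _ _; exists zeta; rewrite kx ky; split=> //; rewrite -?kx.
have E2 : ((occ zeta (k - 1)).+1 == occ (w s) (k - 1)) && (occ zeta k == (occ (w s) k).+1)
    = `[<jump w k (k - 1) s>].
  apply/idP/asboolP; last first.
    move=> /(jump_left H)[x0 yn ->].
    by rewrite occ_move_src occ_move_dst// 1?eq_sym// eqxx /= prednK.
  move=> /andP[/eqP E2 /eqP E3].
  have [E|[x [y [xy x0 yn E]]]] := lw s zeta s0 H; first by move: E2; rewrite E; lia.
  have xny := nbr_neq xy.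
  move: E2 E3; rewrite E !occ_move//.
  have [kx|n1] := eqVneq k x; last first.
    by move=> _; case: ifP => _; lia.
  rewrite -kx (negbTE k1k); have [ky|n2] := eqVneq (k - 1) y; last by lia.
  by move=> _ _; exists zeta; rewrite ky kx; split=> //; by [].
by rewrite /delta E1 E2.
Qed.

Lemma no_jump w x y L s u c : x != y -> x \in L -> s < u ->
  (forall r, s <= r <= u -> agree L c (w r)) -> ~ jump w x y u.
Proof.
move=> xy xL su H [zeta [Hz x0 yn E]].
have [e e0 He] := left_flat L Hz.
pose r := Num.max s (u - e / 2).
have sr : s <= r by rewrite /r le_max lexx.
have ru : r < u by rewrite /r gt_max su/=; lra.
have re : u - e < r by rewrite /r lt_max; apply/orP; right; lra.
have A1 := agree_occ (He r _) xL; rewrite re ru in A1; have {}A1 := A1 isT.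
have A2 := agree_occ (H r _) xL; rewrite sr (ltW ru) in A2; have {}A2 := A2 isT.
have A3 := agree_occ (H u _) xL; rewrite lexx (ltW su) in A3; have {}A3 := A3 isT.
by move: A3; rewrite E occ_move_src; lia.
Qed.

Definition fin_times (A : set R) (t : R) := finite_set [set s | 0 < s <= t /\ A s].

Lemma times_ext (A : set R) s s' : s <= s' -> (forall u, s < u <= s' -> ~ A u) ->
  [set u | 0 < u <= s' /\ A u] = [set u | 0 < u <= s /\ A u].
Proof.
move=> ss' H; apply/seteqP; split => u /= [/andP[u0 us] Au]; split=> //; rewrite u0/=.
  by rewrite leNgt; apply/negP => su; apply: (H u) => //; rewrite su.
exact: le_trans ss'.
Qed.

Lemma ntimes_flat (A : set R) s s' : s <= s' -> (forall u, s < u <= s' -> ~ A u) ->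
  ntimes A s' = ntimes A s.
Proof. by move=> ss' /(times_ext ss'); rewrite /ntimes => ->. Qed.

Lemma times_step (A : set R) r s : 0 <= r -> r < s -> (forall u, r < u < s -> ~ A u) ->
  fin_times A r ->
  fin_times A s /\ ntimes A s = ntimes A r + `[<A s>]%:Z.
Proof.
move=> r0 rs H Fr; have [As|nAs] := asboolP (A s); last first.
  have E : [set u | 0 < u <= s /\ A u] = [set u | 0 < u <= r /\ A u].
    apply: times_ext; first exact: ltW.
    move=> u /andP[ru]; rewrite le_eqVlt => /orP[/eqP->//|us]; apply: H.
    by rewrite ru.
  by rewrite /fin_times /ntimes E addr0.
have E : [set u | 0 < u <= s /\ A u] = s |` [set u | 0 < u <= r /\ A u].
  apply/seteqP; split => u /=.
    move=> [/andP[u0 us] Au]; have [->|us'] := eqVneq u s; [by left|right; split=> //].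
    rewrite u0/= leNgt; apply/negP => ru; apply: (H u) => //.
    by rewrite ru lt_neqAle us' us.
  move=> [->|[/andP[u0 ur] Au]]; split=> //; first by rewrite lexx (le_lt_trans r0).
  by rewrite u0 (le_trans ur (ltW rs)).
split; first by rewrite /fin_times E; rewrite finite_setU; split => //; exact: finite_set1.
rewrite /ntimes E fset_setU1// cardfsU1.
have -> : s \notin fset_set [set u | 0 < u <= r /\ A u].
  by rewrite in_fset_set// notin_setE => -[/andP[_ sr] _]; move: sr; rewrite leNgt rs.
by rewrite addrC.
Qed.

Lemma fin_jump w x y t : cadlag w -> x != y -> 0 <= t -> fin_times (jump w x y) t.
Proof.
move=> cw xy; apply: (@path_induction w [:: x; y]) => //.
- by rewrite /fin_times (_ : [set _ | _] = set0)// -subset0 => s /= [/andP[s0 s0']]; lra.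
- move=> s s' s0 ss' H; rewrite /fin_times (times_ext (ltW ss'))// => u /andP[su us'].
  apply: (@no_jump _ _ _ [:: x; y] s u (w s)) => //; first by rewrite inE eqxx.
  by move=> r /andP[sr ru]; apply: H; rewrite sr (le_trans ru).
- move=> r s zeta r0 rs Hz H Fr; apply: (proj1 (times_step r0 rs _ Fr)) => u /andP[ru us].
  apply: (@no_jump _ _ _ [:: x; y] r u zeta) => //; first by rewrite inE eqxx.
  by move=> v /andP[rv vu]; apply: H; rewrite rv (le_lt_trans vu).
Qed.

Lemma current0 w i : current w i 0 = 0.
Proof.
rewrite /current /ntimes; do 2 (rewrite (_ : [set _ | _] = set0) ?fset_set0 ?cardfs0//;
  last by rewrite -subset0 => s /= [/andP[s0 s0']]; lra).
Qed.

Lemma current_flat w L i s s' : i - 1 \in L -> i \in L -> s <= s' ->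
  (forall r, s <= r <= s' -> agree L (w s) (w r)) -> current w i s' = current w i s.
Proof.
move=> i1 i2 ss' H; rewrite /current; congr (_ - _); apply: ntimes_flat => // u /andP[su us'].
  apply: (@no_jump _ _ _ L s u (w s)) => //; first by lia.
  by move=> r /andP[sr ru]; apply: H; rewrite sr (le_trans ru).
apply: (@no_jump _ _ _ L s u (w s)) => //; first by lia.
by move=> r /andP[sr ru]; apply: H; rewrite sr (le_trans ru).
Qed.

Lemma current_step w L i r s zeta : cadlag w -> legit w -> i - 1 \in L -> i \in L ->
  0 <= r -> r < s -> w u @[u --> s^'-] --> zeta ->
  (forall u, r <= u < s -> agree L zeta (w u)) ->
  current w i s = current w i r + delta i zeta (w s).
Proof.
move=> cw lw i1 i2 r0 rs Hz H; rewrite (delta_jump i lw _ Hz) ?(le_lt_trans r0)// /current.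
have NJ x y : x != y -> x \in L -> forall u, r < u < s -> ~ jump w x y u.
  move=> xy xL u /andP[ru us]; apply: (@no_jump _ _ _ L r u zeta) => //.
  by move=> v /andP[rv vu]; apply: H; rewrite rv (le_lt_trans vu).
have a1 : i - 1 != i by lia.
have a2 : i != i - 1 by lia.
have [_ ->] := times_step r0 rs (NJ _ _ a1 i1) (fin_jump cw a1 r0).
have [_ ->] := times_step r0 rs (NJ _ _ a2 i2) (fin_jump cw a2 r0).
by ring.
Qed.

Lemma occ_conservation w k t : cadlag w -> legit w -> 0 <= t ->
  (occ (w t) k)%:Z - (occ (w 0) k)%:Z = current w k t - current w (k + 1) t.
Proof.
move=> cw lw.
have k1 : k - 1 \in [:: k - 1; k; k + 1] by rewrite !inE eqxx.
have k2 : k \in [:: k - 1; k; k + 1] by rewrite !inE eqxx orbT.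
have k2' : k + 1 - 1 \in [:: k - 1; k; k + 1] by rewrite addrK.
have k3 : k + 1 \in [:: k - 1; k; k + 1] by rewrite !inE eqxx !orbT.
move: t; apply: (@path_induction w [:: k - 1; k; k + 1]) => //.
- by rewrite !current0 !subrr.
- move=> s s' s0 ss' H E.
  rewrite (current_flat k1 k2 (ltW ss') H) (current_flat k2' k3 (ltW ss') H) -E.
  by rewrite (agree_occ (H s' _) k2)// lexx ltW.
- move=> r s zeta r0 rs Hz H E.
  rewrite (current_step cw lw k1 k2 r0 rs Hz H) (current_step cw lw k2' k3 r0 rs Hz H).
  have E' : occ zeta k = occ (w r) k by apply: (agree_occ (H r _) k2); rewrite lexx.
  have P : perm [:: k - 1; k; k + 1] zeta (w s).
    have [->|] := lw s zeta (le_lt_trans r0 rs) Hz; first exact: perm_refl.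
    exact: nnmove_perm.
  have F := perm_conservation P; rewrite E' in F; move: F E; clear.
  move: (delta k zeta (w s)) (delta (k + 1) zeta (w s)).
  by move: (current w k r) (current w (k + 1) r) => a b c d; lia.
Qed.

End Paths.

(** * Reading transitions and currents off a time grid *)

Section Grids.
Context {R : realType} {n : nat}.
Implicit Types (L : seq int) (eta xi zeta : conf n) (w : R -> conf n).

Lemma near_mesh (t e : R) : 0 < e ->
  \forall N \near \oo, (0 < N)%N /\ t / N%:R < e.
Proof.
move=> e0; near=> N; have N0 : (0 < N)%N by near: N; exact: nbhs_infty_gt.
split=> //; rewrite ltr_pdivrMr ?ltr0n// mulrC -ltr_pdivrMr//.
by near: N; exact: nbhs_infty_gtr.
Unshelve. all: by end_near.
Qed.

Lemma grid_cell (s t : R) N : (0 < N)%N -> 0 < s <= t ->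
  exists2 m, (m < N)%N & m%:R * (t / N%:R) < s <= m.+1%:R * (t / N%:R).
Proof.
move=> N0 /andP[s0 st]; pose Q (m : nat) := s <= m.+1%:R * (t / N%:R).
have exQ : exists m, Q m.
  by exists N.-1; rewrite /Q prednK// mulrCA divff ?mulr1// pnatr_eq0 -lt0n.
have [m Qm mmin] := ex_minnP exQ; exists m.
  rewrite -(prednK N0) ltnS; apply: mmin.
  by rewrite /Q prednK// mulrCA divff ?mulr1// pnatr_eq0 -lt0n.
apply/andP; split; last exact: Qm.
case: m Qm mmin => [|m] Qm mmin; first by rewrite mul0r.
by rewrite ltNge; apply/negP => /(mmin m); rewrite ltnn.
Qed.

(** Once the mesh is shorter than the flat stretches before and after [s], the cell containing [s]
    starts in the first and ends in the second. *)
Lemma grid_detect w L (B : conf n -> conf n -> Prop) s t zeta : cadlag w ->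
  (forall eta eta' xi xi', agree L eta eta' -> agree L xi xi' -> B eta xi -> B eta' xi') ->
  0 < s <= t -> w r @[r --> s^'-] --> zeta -> B zeta (w s) ->
  \forall N \near \oo, exists2 m, (m < N)%N &
    B (w (m%:R * (t / N%:R))) (w (m.+1%:R * (t / N%:R))).
Proof.
move=> cw BL st Hz Bs; have /andP[s0 _] := st.
have [e e0 He] := left_flat L Hz.
have [e' e0' He'] := cadlag_flat L cw (ltW s0).
near=> N.
have [N0 te] : (0 < N)%N /\ t / N%:R < e by near: N; exact: near_mesh.
have [_ te'] : (0 < N)%N /\ t / N%:R < e' by near: N; exact: near_mesh.
have [m mN /andP[ms sm]] := grid_cell N0 st.
exists m => //; move: ms sm; rewrite -[m.+1]addn1 natrD mulrDl mul1r => ms sm.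
apply: BL Bs; first by apply: He; rewrite ms andbT; lra.
by apply: He'; rewrite sm/=; lra.
Unshelve. all: by end_near.
Qed.

(** The cut-off [b] serves path induction: the grid stays tied to [t] while [b] grows from 0 to [t].
    For [b = t] and [N > 0] it is inactive. *)
Definition grid_count w i (t b : R) N : int :=
  \sum_(m < N) delta i (w (Num.min (m%:R * (t / N%:R)) b))
                       (w (Num.min (m.+1%:R * (t / N%:R)) b)).

Lemma grid_current w i t b : cadlag w -> legit w -> 0 <= b -> b <= t ->
  \forall N \near \oo, grid_count w i t b N = current w i b.
Proof.
move=> cw lw; pose L := [:: i - 1; i].
have i1 : i - 1 \in L by rewrite inE eqxx.
have i2 : i \in L by rewrite !inE eqxx orbT.
move: b; apply: (@path_induction _ _ w L) => //.
- move=> t0; apply: nearW => N; rewrite current0 /grid_count big1// => m _.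
  rewrite !min_r ?delta_refl//; rewrite mulr_ge0// divr_ge0//.
- move=> s s' s0 ss' H IH s't.
  have := IH (le_trans (ltW ss') s't); apply: filterS => N.
  rewrite (current_flat i1 i2 (ltW ss') H) => <-.
  apply: eq_bigr => m _.
  have W (u : R) : agree L (w (Num.min u s')) (w (Num.min u s)).
    have [us|su] := leP u s; first by rewrite min_l ?(le_trans us) ?ltW.
    by apply/agreeC/H; rewrite le_min (ltW su) (ltW ss')/= ge_min lexx orbT.
  by apply: delta_loc; exact: W.
- move=> r s zeta r0 rs Hz H IH st.
  have IH' := IH (le_trans (ltW rs) st).
  near=> N.
  have [N0 te] : (0 < N)%N /\ t / N%:R < s - r.
    by near: N; apply: near_mesh; rewrite subr_gt0.
  have <- : grid_count w i t r N + delta i zeta (w s) = current w i s.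
    rewrite (current_step cw lw i1 i2 r0 rs Hz H); congr (_ + _).
    by near: N.
  have s0 : 0 < s := le_lt_trans r0 rs.
  have h0 : 0 <= t / N%:R by rewrite divr_ge0// (le_trans (ltW s0)).
  (* Only the cell containing [s] contributes differently when the cut-off moves from [r] to [s].
     The mesh is below [s - r], so this cell starts after [r] and contributes 0 under the cut-off
     [r]. *)
  have [m0 m0N] : exists2 m, (m < N)%N & m%:R * (t / N%:R) < s <= m.+1%:R * (t / N%:R).
    by apply: grid_cell => //; rewrite s0.
  move=> /andP[ms sm]; pose m1 := Ordinal m0N.
  rewrite /grid_count (bigD1 m1)//= [in RHS](bigD1 m1)//= .
  have rm : r < m0%:R * (t / N%:R).
    by move: sm; rewrite -[m0.+1]addn1 natrD mulrDl mul1r; lra.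
  have -> : delta i (w (Num.min (m0%:R * (t / N%:R)) r)) (w (Num.min (m0.+1%:R * (t / N%:R)) r)) = 0.
    by rewrite !min_r ?delta_refl ?(ltW rm)// ltW// (lt_le_trans rs).
  have -> : delta i (w (Num.min (m0%:R * (t / N%:R)) s)) (w (Num.min (m0.+1%:R * (t / N%:R)) s)) = delta i zeta (w s).
    rewrite min_l ?(ltW ms)// min_r//; apply: delta_loc => //; apply/agreeC.
    by apply: H; rewrite (ltW rm) ms.
  rewrite add0r addrC; congr (_ + _); apply: eq_bigr => m mm1.
  have [mm0|m0m] := ltnP m m0.
    have E : m.+1%:R * (t / N%:R) < s.
      by apply: le_lt_trans ms; rewrite ler_wpM2r// ler_nat.
    have W (u : R) : u < s -> agree L (w (Num.min u s)) (w (Num.min u r)).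
      move=> us; rewrite min_l ?(ltW us)//; have [//|ru] := leP u r.
      apply: (@agree_trans _ L _ zeta); last by apply: H; rewrite lexx.
      by apply/agreeC/H; rewrite (ltW ru).
    apply: delta_loc; apply: W => //; apply: le_lt_trans E.
    by rewrite ler_wpM2r// ler_nat.
  have {}m0m : (m0 < m)%N.
    by rewrite ltn_neqAle m0m andbT; apply: contra_neq mm1 => E; apply: val_inj.
  have E : s <= m%:R * (t / N%:R).
    by apply: le_trans sm _; rewrite ler_wpM2r// ler_nat.
  have E' : s <= m.+1%:R * (t / N%:R).
    by apply: le_trans sm _; rewrite ler_wpM2r// ler_nat ltnW.
  by rewrite !min_r ?delta_refl// (le_trans (ltW rs)).
Unshelve. all: by end_near.
Qed.

End Grids.

(** * Markov semigroups *)

Section Semigroups.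
Context {R : realType} {T : topologicalType}.
Implicit Types (f g : T -> R).

Lemma bcont_cst (c : R) : bcont (fun _ : T => c).
Proof. by split; [exact: cst_continuous|exists `|c|]. Qed.

Lemma bcont_lin (a : R) f g : bcont f -> bcont g -> bcont (fun x => a * f x + g x).
Proof.
move=> [cf [M fM]] [cg [M' gM]]; split.
  by move=> x; apply: cvgD; [apply: cvgM; [exact: cvg_cst|exact: cf]|exact: cg].
exists (`|a| * M + M') => x; apply: le_trans (ler_normD _ _) _.
by rewrite normrM lerD// ler_wpM2l.
Qed.

Lemma bcont_mul f g : bcont f -> bcont g -> bcont (fun x => f x * g x).
Proof.
move=> [cf [M fM]] [cg [M' gM]]; split.
  by move=> x; apply: cvgM; [exact: cf|exact: cg].
by exists (M * M') => x; rewrite normrM ler_pM.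
Qed.

Lemma bcontD f g : bcont f -> bcont g -> bcont (fun x => f x + g x).
Proof.
by move=> bf bg; have := bcont_lin 1 bf bg; under eq_fun do rewrite mul1r.
Qed.

Lemma bcontZ (a : R) f : bcont f -> bcont (fun x => a * f x).
Proof.
by move=> bf; have := bcont_lin a bf (bcont_cst 0); under eq_fun do rewrite addr0.
Qed.

Lemma bcontB f g : bcont f -> bcont g -> bcont (fun x => f x - g x).
Proof.
move=> bf bg; have := bcont_lin (-1) bg bf.
by under eq_fun do rewrite mulN1r addrC.
Qed.

Variable S : R -> (T -> R) -> T -> R.
Hypothesis hS : markov_semigroup S.

Lemma sgB t f g : 0 <= t -> bcont f -> bcont g ->
  S t (fun x => f x - g x) = (fun x => S t f x - S t g x).
Proof.
move=> t0 bf bg; have := ms_linear hS (-1) t0 bg bf.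
under eq_fun do rewrite mulN1r addrC.
by under [RHS]eq_fun do rewrite mulN1r addrC.
Qed.

Lemma sgD t f g : 0 <= t -> bcont f -> bcont g ->
  S t (fun x => f x + g x) = (fun x => S t f x + S t g x).
Proof.
move=> t0 bf bg; have := ms_linear hS 1 t0 bf bg.
under eq_fun do rewrite mul1r.
by under [RHS]eq_fun do rewrite mul1r.
Qed.

Lemma sgC t (c : R) : 0 <= t -> S t (fun=> c) = (fun=> c).
Proof.
move=> t0; have Z : S t (fun=> 0) = (fun=> 0).
  have := sgB t0 (bcont_cst 1) (bcont_cst 1).
  by under eq_fun do rewrite subrr; under [RHS]eq_fun do rewrite subrr.
have := ms_linear hS c t0 (bcont_cst 1) (bcont_cst 0).
under eq_fun do rewrite mulr1 addr0.
by rewrite (ms_one hS t0) Z; under [RHS]eq_fun do rewrite mulr1 addr0.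
Qed.

Lemma sgZ t (a : R) f : 0 <= t -> bcont f -> S t (fun x => a * f x) = (fun x => a * S t f x).
Proof.
move=> t0 bf; have := ms_linear hS a t0 bf (bcont_cst 0).
under eq_fun do rewrite addr0.
by rewrite sgC//; under [RHS]eq_fun do rewrite addr0.
Qed.

Lemma sg_le t f g x : 0 <= t -> bcont f -> bcont g -> (forall y, f y <= g y) ->
  S t f x <= S t g x.
Proof.
move=> t0 bf bg fg; have := ms_ge0 hS t0 (bcontB bg bf).
by rewrite sgB// => /(_ _ x); rewrite subr_ge0; apply => y; rewrite subr_ge0.
Qed.

Lemma sg_bound t f (M : R) x : 0 <= t -> bcont f -> (forall y, `|f y| <= M) ->
  `|S t f x| <= M.
Proof.
move=> t0 bf fM; rewrite ler_norml.
have -> : S t f x <= M.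
  rewrite -[leRHS](congr1 (@^~ x) (sgC M t0)); apply: sg_le => //; first exact: bcont_cst.
  by move=> y; apply: le_trans (fM y); exact: ler_norm.
rewrite andbT -[leLHS](congr1 (@^~ x) (sgC (- M) t0)); apply: sg_le => //.
  exact: bcont_cst.
by move=> y; have := fM y; rewrite ler_norml => /andP[].
Qed.

Lemma generator_near (D : set (T -> R)) L f e : has_generator S D L -> D f -> bcont f ->
  0 < e -> \forall h \near 0^'+, forall x, `|S h f x - f x - h * L f x| <= h * e.
Proof.
move=> hG Df bf e0; have := hG f Df.
have N : nbhs (L f : {uniform T -> R}) [set g | forall x, `|L f x - g x| < e].
  apply/uniform_nbhs; exists [set xy | ball xy.1 e xy.2]; split.
    exact: (entourage_ball _ (PosNum e0)).
  by move=> g /= H x; have := H x I; rewrite -ball_normE.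
move=> /(_ _ N) H; near=> h; move=> x.
have h0 : 0 < h by near: h; exact: nbhs_right_gt.
have Hh : forall x, `|L f x - h^-1 * (S h f x - f x)| < e by near: h.
have := ltW (Hh x); rewrite -(ler_pM2l h0) -{1}(gtr0_norm h0) -normrM distrC.
by rewrite mulrBr mulrA divff ?gt_eqF// mul1r distrC.
Unshelve. all: by end_near.
Qed.

End Semigroups.

(** * Kernels weighted by both ends of a time step *)

Section Kernels.
Context {R : realType} {n : nat}.
Implicit Types (L : seq int) (eta xi zeta : conf n) (phi psi : conf n -> conf n -> R).

Definition wloc L phi := forall eta eta' xi xi', agree L eta eta' -> agree L xi xi' ->
  phi eta xi = phi eta' xi'.

Lemma wloc_r L phi eta : wloc L phi -> loc L (phi eta).
Proof. by move=> H xi xi'; apply: H; exact: agree_refl. Qed.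

Lemma wloc_l L phi eta eta' : wloc L phi -> agree L eta eta' -> phi eta = phi eta'.
Proof. by move=> H E; apply/funext => xi; apply: H => //; exact: agree_refl. Qed.

Lemma wloc_bound L phi : wloc L phi -> exists M, forall eta xi, `|phi eta xi| <= M.
Proof.
move=> H; exists (\sum_(z : (size L).-tuple 'I_n.+1)
    \sum_(z' : (size L).-tuple 'I_n.+1) `|phi (fill z) (fill z')|) => eta xi.
rewrite -(H _ _ _ _ (@fill_win _ L eta) (@fill_win _ L xi)).
rewrite (bigD1 (win L eta))//= (bigD1 (win L xi))//= -addrA lerDl.
by rewrite addr_ge0// ?sumr_ge0// => z _; rewrite sumr_ge0.
Qed.

Variable S : R -> (conf n -> R) -> conf n -> R.
Hypothesis hS : markov_semigroup S.

(** The expectation from [eta] of phi(X_0, X_h) f(X_h): a one-step Feynman-Kac kernel whose weight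
    depends on the transition. *)
Definition ker h phi (f : conf n -> R) eta : R := S h (fun xi => phi eta xi * f xi) eta.

Lemma bcont_wloc L phi f eta : wloc L phi -> bcont f -> bcont (fun xi => phi eta xi * f xi).
Proof. by move=> H bf; exact (bcont_mul (loc_bcont (wloc_r eta H)) bf). Qed.

(** The weight changes with the starting point, but it is constant near [eta] because it reads a
    finite window; there [ker] is [S h] of one fixed function. *)
Lemma ker_bcont L h phi f : 0 <= h -> wloc L phi -> bcont f -> bcont (ker h phi f).
Proof.
move=> h0 H bf; split; last first.
  have [M HM] := wloc_bound H; have [_ [M' HM']] := bf; exists (M * M') => eta.
  by apply: sg_bound => //; [exact: (bcont_wloc eta H bf)|move=> xi; rewrite normrM ler_pM].
move=> eta U Ue; have [cg _] := ms_bcont hS h0 (bcont_wloc eta H bf).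
apply: filterS (filterI (near_agree L eta) (cg eta U Ue)) => xi [A] /=.
by rewrite /ker (wloc_l H A).
Qed.

Lemma ker_lin L h phi a f g : 0 <= h -> wloc L phi -> bcont f -> bcont g ->
  ker h phi (fun x => a * f x + g x) = (fun x => a * ker h phi f x + ker h phi g x).
Proof.
move=> h0 H bf bg; apply/funext => eta; rewrite /ker.
rewrite -[RHS](congr1 (@^~ eta) (ms_linear hS a h0 (bcont_wloc eta H bf) (bcont_wloc eta H bg))).
by congr (S h _ eta); apply/funext => xi; ring.
Qed.

Lemma ker_bound L h phi psi f (M : R) eta : 0 <= h -> wloc L phi -> wloc L psi -> bcont f ->
  0 <= M ->
  (forall xi, `|phi eta xi| <= psi eta xi) -> (forall xi, `|f xi| <= M) ->
  `|ker h phi f eta| <= M * S h (psi eta) eta.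
Proof.
move=> h0 H H' bf M0 pp fM.
have b1 := bcont_wloc eta H bf.
have b2 := loc_bcont (wloc_r eta H').
rewrite -[leRHS](congr1 (@^~ eta) (sgZ hS M h0 b2)).
have B xi : `|phi eta xi * f xi| <= M * psi eta xi by rewrite normrM mulrC ler_pM.
rewrite ler_norml; apply/andP; split; last first.
  apply: sg_le => //; first exact: bcontZ.
  by move=> xi; apply: le_trans (B xi); exact: ler_norm.
have -> : - S h (fun x => M * psi eta x) eta = S h (fun x => - M * psi eta x) eta.
  by rewrite !(sgZ hS _ h0 b2) mulNr.
apply: sg_le => //; first exact: bcontZ.
by move=> xi; have := B xi; rewrite ler_norml mulNr => /andP[].
Qed.

(** As [eta] varies, [phi eta] runs over finitely many local functions, one per window, so one
    threshold serves all starting points. The value [h = 0] is included because the mesh is 0 when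
    [t = 0]. *)
Lemma generator_wloc (D : set (conf n -> R)) Lg L phi e :
  has_generator S D Lg -> (forall f, local_fun f -> D f) -> wloc L phi -> 0 < e ->
  exists2 h0, 0 < h0 & forall h eta, 0 <= h -> h < h0 ->
    `|S h (phi eta) eta - phi eta eta - h * Lg (phi eta) eta| <= h * e.
Proof.
move=> hG lD H e0.
have : \forall h \near (0:R)^'+, forall z : (size L).-tuple 'I_n.+1, forall x,
    `|S h (phi (fill z)) x - phi (fill z) x - h * Lg (phi (fill z)) x| <= h * e.
  apply: filter_forall => z; have Hz := wloc_r (fill z) H.
  exact: (generator_near hG (lD _ (loc_local Hz)) (loc_bcont Hz) e0).
move=> /near_at_right[h1 h10 Hh]; exists h1 => // h eta h0 hh.
rewrite -(wloc_l H (@fill_win _ L eta)).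
have [<-|hn] := eqVneq 0 h.
  rewrite (ms_zero hS); last exact: loc_bcont (wloc_r _ H).
  by rewrite !mul0r subr0 subrr normr0.
by apply: Hh; rewrite add0r hh andbT lt_neqAle hn.
Qed.

End Kernels.

(** * Rates and Hopf-Cole transform *)

Section Rates.
Context {R : realType} (q : R) (n : nat) (hq : 0 < q < 1).

Let q0 : 0 < q. Proof. by case/andP: hq. Qed.
Let q1 : q < 1. Proof. by case/andP: hq. Qed.
Let qn0 : q != 0. Proof. by rewrite gt_eqF. Qed.
Let qq : q - q^-1 < 0.
Proof. by rewrite subr_lt0 (lt_trans q1)// invf_gt1. Qed.

Definition rate_r (a b : nat) : R :=
  q ^ (a%:Z - b%:Z - (n%:Z + 1)) * qint q a * qint q (n%:Z - b%:Z).
Definition rate_l (a b : nat) : R :=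
  q ^ (a%:Z - b%:Z + (n%:Z + 1)) * qint q (n%:Z - a%:Z) * qint q b.

Lemma qint0 : qint q 0 = 0.
Proof. by rewrite /qint oppr0 subrr mul0r. Qed.

Lemma qint_ge0 (m : int) : 0 <= m -> 0 <= qint q m.
Proof.
case: m => // m _; rewrite /qint; apply: mulr_le0; last by rewrite invr_le0 ltW.
rewrite subr_le0 -invr_expz -!exprnP; have m0 : 0 < q ^+ m by rewrite exprn_gt0.
have m1 : q ^+ m <= 1 by rewrite exprn_ile1// ltW.
by apply: (le_trans m1); rewrite invf_ge1.
Qed.

Lemma rate_r_ge0 a b : (b <= n)%N -> 0 <= rate_r a b.
Proof.
move=> bn; have nb : 0 <= n%:Z - b%:Z by clear -bn; lia.
rewrite /rate_r; apply: mulr_ge0 (qint_ge0 nb).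
by apply: mulr_ge0; [rewrite exprz_ge0 ?(ltW q0)|exact: qint_ge0].
Qed.

Lemma rate_l_ge0 a b : (a <= n)%N -> 0 <= rate_l a b.
Proof.
move=> an; have na : 0 <= n%:Z - a%:Z by clear -an; lia.
rewrite /rate_l; apply: mulr_ge0 => //; last exact: qint_ge0.
by apply: mulr_ge0; [rewrite exprz_ge0 ?(ltW q0)|exact: qint_ge0].
Qed.

Lemma rate_r0 b : rate_r 0 b = 0.
Proof. by rewrite /rate_r qint0 mulr0 mul0r. Qed.
Lemma rate_rn a : rate_r a n = 0.
Proof. by rewrite /rate_r subrr qint0 mulr0. Qed.
Lemma rate_l0 a : rate_l a 0 = 0.
Proof. by rewrite /rate_l qint0 mulr0. Qed.
Lemma rate_ln b : rate_l n b = 0.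
Proof. by rewrite /rate_l subrr qint0 mulr0 mul0r. Qed.

Definition rmax : R := \sum_(a < n.+1) \sum_(b < n.+1) (rate_r a b + rate_l a b).

Lemma rate_sum_le a b : (a <= n)%N -> (b <= n)%N -> rate_r a b + rate_l a b <= rmax.
Proof.
move=> an bn; have P i j : (i <= n)%N -> (j <= n)%N -> 0 <= rate_r i j + rate_l i j.
  by move=> ? ?; rewrite addr_ge0 ?rate_r_ge0 ?rate_l_ge0.
rewrite /rmax (bigD1 (inord a))//= (bigD1 (inord b))//= !inordK ?ltnS// -addrA lerDl.
apply: addr_ge0; apply: sumr_ge0 => i _; first by apply: P; rewrite // -ltnS.
by apply: sumr_ge0 => j _; apply: P; rewrite -ltnS.
Qed.

(** An empty source has rate 0 and any other holds at least one particle. Being linear in the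
    occupation number, the bound leads to closed inequalities for expected occupations. *)
Lemma rate_r_le a b : (a <= n)%N -> (b <= n)%N -> rate_r a b <= rmax * a%:R.
Proof.
move=> an bn; have [->|a0] := posnP a; first by rewrite rate_r0 mulr0.
have H := rate_sum_le an bn; have Hl := rate_l_ge0 b an; have Hr := rate_r_ge0 a bn.
apply: (@le_trans _ _ rmax); first lra.
by rewrite ler_peMr ?ler1n//; lra.
Qed.

Lemma rate_l_le a b : (a <= n)%N -> (b <= n)%N -> rate_l a b <= rmax * b%:R.
Proof.
move=> an bn; have [->|a0] := posnP b; first by rewrite rate_l0 mulr0.
have H := rate_sum_le an bn; have Hl := rate_l_ge0 b an; have Hr := rate_r_ge0 a bn.
apply: (@le_trans _ _ rmax); first lra.
by rewrite ler_peMr ?ler1n//; lra.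
Qed.

Lemma rmax_ge0 : 0 <= rmax.
Proof.
have H := @rate_sum_le 0 0 isT isT.
by apply: le_trans H; rewrite addr_ge0 ?rate_r_ge0 ?rate_l_ge0.
Qed.

(* The walk jumps left at rate [be] and right at rate [al], so that
   [lat al be (al + be)] is the generator of the reversed walk. *)
Definition al : R := q ^ (- n%:Z) * qint q n.
Definition be : R := q ^ n%:Z * qint q n.

Lemma al_ge0 : 0 <= al.
Proof. by rewrite mulr_ge0 ?qint_ge0 ?exprz_ge0 ?(ltW q0). Qed.
Lemma be_ge0 : 0 <= be.
Proof. by rewrite mulr_ge0 ?qint_ge0 ?exprz_ge0 ?(ltW q0). Qed.

(* The microscopic Hopf-Cole transform linearizes the current: this identity
   closes the equations for the q-exponential moments. *)
Lemma hopf_cole a b : rate_r a b * (q ^+ 2 - 1) + rate_l a b * ((q ^+ 2)^-1 - 1) =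
  al * ((q ^+ 2) ^ a%:Z - 1) + be * ((q ^+ 2) ^ (- b%:Z) - 1).
Proof.
have E (c d e : int) : q ^ (c - d + e) = q ^ c * (q ^ d)^-1 * q ^ e.
  by rewrite !expfzDr// invr_expz.
have E2 (c d : int) : q ^ (c - d) = q ^ c * (q ^ d)^-1 by rewrite expfzDr// invr_expz.
have S2 (c : int) : (q ^+ 2) ^ c = (q ^ c) ^+ 2.
  by rewrite (exprnP q 2) exprz_exp mulrC -exprz_exp -exprnP.
rewrite /rate_r /rate_l /al /be /qint -!invr_expz !S2.
rewrite !E !E2 !(expfzDr _ 1 qn0) -!invr_expz !expr1z.
set x := q ^ a; set y := q ^ b; set z := q ^ n.
have x0 : x != 0 by rewrite expfz_neq0.
have y0 : y != 0 by rewrite expfz_neq0.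
have z0 : z != 0 by rewrite expfz_neq0.
have q20 : q ^+ 2 - 1 != 0 by rewrite lt_eqF// subr_lt0 exprn_ilt1// ltW.
have E3 : q ^ (n%:Z + 1) = z * q by rewrite expfzDr.
rewrite !E3; field.
by rewrite x0 y0 z0 q20 qn0.
Qed.

Implicit Types (eta xi : conf n) (f : conf n -> R).

(** Where a jump is impossible its rate vanishes, so the increments of [f] have to be known only for
    admissible moves. *)
Lemma bond_eq i f eta c1 c2 :
  ((0 < occ eta i)%N -> (occ eta (i + 1) < n)%N -> f (move i (i + 1) eta) - f eta = c1) ->
  ((0 < occ eta (i + 1))%N -> (occ eta i < n)%N -> f (move (i + 1) i eta) - f eta = c2) ->
  asep_bond q i f eta = rate_r (occ eta i) (occ eta (i + 1)) * c1 +
                        rate_l (occ eta i) (occ eta (i + 1)) * c2.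
Proof.
move=> H1 H2; rewrite /asep_bond -/(rate_r _ _) -/(rate_l _ _).
have [a0|a0] := posnP (occ eta i); have [b0|b0] := posnP (occ eta (i + 1)).
- by rewrite a0 b0 !rate_r0 !rate_l0 !mul0r.
- rewrite a0 !rate_r0 !mul0r !add0r; have := occ_le eta i; rewrite leq_eqVlt => /orP[/eqP E|an].
    by rewrite -[0%N]a0 E !rate_ln !mul0r.
  by rewrite H2.
- rewrite b0 !rate_l0 !mul0r !addr0; have := occ_le eta (i + 1); rewrite leq_eqVlt => /orP[/eqP E|an].
    by rewrite -[0%N]b0 E !rate_rn !mul0r.
  by rewrite H1.
have := occ_le eta (i + 1); rewrite leq_eqVlt => /orP[/eqP Eb|bn];
have := occ_le eta i; rewrite leq_eqVlt => /orP[/eqP Ea|an].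
- by rewrite Ea Eb !rate_rn !rate_ln !mul0r.
- by rewrite Eb !rate_rn !mul0r H2.
- by rewrite Ea !rate_ln !mul0r H1.
- by rewrite H1// H2.
Qed.

Lemma gen_sum s f eta : uniq s -> (forall i, i \notin s -> asep_bond q i f eta = 0) ->
  asep_gen q f eta = \sum_(i <- s) asep_bond q i f eta.
Proof.
move=> us H; rewrite fsbig_seq// /asep_gen; apply/esym/fsbig_widen => // i [_ /= Hi].
by apply: H; apply/negP.
Qed.

(** Meant for quantities that no single jump can change: a vanishing generator then makes their
    expected change over a time [h] of order o(h). *)
Lemma gen_nn0 f eta : (forall xi, nnmove eta xi -> f xi = f eta) -> asep_gen q f eta = 0.
Proof.
move=> H; rewrite (@gen_sum [::])// ?big_nil// => i _.
rewrite (@bond_eq _ _ _ 0 0) ?mulr0 ?addr0// => a0 bn; apply/eqP; rewrite subr_eq0.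
  by apply/eqP/H; exists i, (i + 1); split=> //; left.
by apply/eqP/H; exists (i + 1), i; split=> //; right; rewrite addrK.
Qed.

Lemma delta_move_r k i eta : (0 < occ eta i)%N -> (occ eta (i + 1) < n)%N ->
  delta k eta (move i (i + 1) eta) = (i == k - 1)%:Z.
Proof.
move=> a0 bn; have ii : i != i + 1 by clear; lia.
rewrite /delta !occ_move//; case: (eqVneq i (k - 1)) => [ik|ik].
  have e1 : (k - 1 == k) = false by clear; lia.
  have e2 : (k == k - 1) = false by clear; lia.
  move: a0; rewrite ik subrK ?e1 ?e2 !eqxx ?e1 ?e2.
  by clear; lia.
have e1 : (k - 1 == i) = false by clear -ik; lia.
have e2 : (k == i + 1) = false by clear -ik; lia.
rewrite ?e1 ?e2.
by case: ifP => E1; case: ifP => E2; clear -E1 E2; lia.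
Qed.

Lemma delta_move_l k i eta : (0 < occ eta (i + 1))%N -> (occ eta i < n)%N ->
  delta k eta (move (i + 1) i eta) = - (i == k - 1)%:Z.
Proof.
move=> a0 bn; have ii : i + 1 != i by clear; lia.
rewrite /delta !occ_move//; case: (eqVneq i (k - 1)) => [ik|ik].
  have e1 : (k - 1 == k) = false by clear; lia.
  have e2 : (k == k - 1) = false by clear; lia.
  move: a0; rewrite ik subrK ?e1 ?e2 !eqxx ?e1 ?e2.
  by clear; lia.
have e1 : (k - 1 == i) = false by clear -ik; lia.
have e2 : (k == i + 1) = false by clear -ik; lia.
rewrite ?e1 ?e2.
by case: ifP => E1; case: ifP => E2; clear -E1 E2; lia.
Qed.

Lemma gen_delta (g : int -> R) k eta : asep_gen q (fun xi => g (delta k eta xi)) eta =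
  rate_r (occ eta (k - 1)) (occ eta k) * (g 1 - g 0) +
  rate_l (occ eta (k - 1)) (occ eta k) * (g (-1) - g 0).
Proof.
rewrite (@gen_sum [:: k - 1])// ?big_seq1.
  rewrite (@bond_eq _ _ _ (g 1 - g 0) (g (-1) - g 0)); first by rewrite subrK.
    by move=> a0 bn; rewrite delta_move_r// eqxx delta_refl.
  by move=> a0 bn; rewrite delta_move_l// eqxx delta_refl.
move=> i; rewrite inE => ik.
rewrite (@bond_eq _ _ _ 0 0) ?mulr0 ?addr0// => a0 bn.
  by rewrite delta_move_r// (negbTE ik) delta_refl subrr.
by rewrite delta_move_l// (negbTE ik) delta_refl subrr.
Qed.

(** Only the inflow from the two neighbours is kept; the outflow has the favourable sign. *)
Lemma gen_occ_le k eta :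
  asep_gen q (fun xi => (occ xi k)%:R) eta <=
    rmax * ((occ eta (k - 1))%:R + (occ eta (k + 1))%:R).
Proof.
rewrite (@gen_sum [:: k - 1; k]); last 2 first.
- by rewrite /= inE andbT; clear; lia.
- move=> i; rewrite !inE negb_or => /andP[i1 i2].
  have e1 : k != i by rewrite eq_sym.
  have e2 : k != i + 1 by clear -i1; lia.
  by rewrite (@bond_eq _ _ _ 0 0) ?mulr0 ?addr0// => _ _; rewrite /occ move_out// subrr.
rewrite big_cons big_seq1 (@bond_eq _ _ _ 1 (-1)); last 2 first.
- by rewrite subrK => a0 bn; rewrite occ_move_dst//; [rewrite -natr1 addrAC subrr add0r|clear; lia].
- rewrite subrK => a0 bn; rewrite occ_move_src.
  by case: (occ eta k) a0 => // m _; rewrite /= -natr1 opprD addrA subrr add0r.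
rewrite (@bond_eq _ _ _ (-1) 1); last 2 first.
- move=> a0 bn; rewrite occ_move_src.
  by case: (occ eta k) a0 => // m _; rewrite /= -natr1 opprD addrA subrr add0r.
- by move=> a0 bn; rewrite occ_move_dst//; [rewrite -natr1 addrAC subrr add0r|clear; lia].
rewrite subrK.
have H1 := rate_r_le (occ_le eta (k - 1)) (occ_le eta k).
have H2 := rate_l_le (occ_le eta k) (occ_le eta (k + 1)).
have H3 := rate_l_ge0 (occ eta k) (occ_le eta (k - 1)).
have H4 := rate_r_ge0 (occ eta k) (occ_le eta (k + 1)).
by lra.
Qed.

End Rates.

(** * Infinite particle counts and the pathwise identity *)

Section NatSeries.
Context {R : realType}.

Lemma nat_series_stop (a : nat -> nat) M : (forall k, (M <= k)%N -> a k = 0%N) ->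
  (\sum_(0 <= k <oo) ((a k)%:R : R)%:E = ((\sum_(k < M) a k)%N%:R)%:E)%E.
Proof.
move=> aM; apply/cvg_lim => //; apply: cvg_near_cst; near=> m.
have Mm : (M <= m)%N by near: m; exact: nbhs_infty_ge.
rewrite (big_cat_nat (leq0n M) Mm) /=.
have -> : (\sum_(M <= k < m) ((a k)%:R : R)%:E = 0)%E.
  by rewrite big_nat_cond big1// => k /andP[/andP[Mk _] _]; rewrite aM.
by rewrite adde0 sumEFin -natr_sum big_mkord.
Unshelve. all: by end_near.
Qed.

Lemma nat_series_unbounded (a : nat -> nat) :
  ~ (exists M, forall k, (M <= k)%N -> a k = 0%N) ->
  forall c : nat, exists m0, forall m, (m0 <= m)%N -> (c <= \sum_(k < m) a k)%N.
Proof.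
move=> H; elim=> [|c [m0 IH]]; first by exists 0%N.
have [k mk ak] : exists2 k, (m0 <= k)%N & (0 < a k)%N.
  apply: contrapT => N; apply: H; exists m0 => k mk; apply/eqP; rewrite -leqn0 leqNgt.
  by apply/negP => ak; apply: N; exists k.
exists k.+1 => m km.
have le : (\sum_(i < k.+1) a i <= \sum_(i < m) a i)%N.
  by rewrite -!(big_mkord predT a) (big_cat_nat (leq0n k.+1) km) /= leq_addr.
apply: leq_trans le; rewrite big_ord_recr /= -addn1; apply: leq_add => //.
exact: IH.
Qed.

Lemma nat_series_oo (a : nat -> nat) : ~ (exists M, forall k, (M <= k)%N -> a k = 0%N) ->
  (\sum_(0 <= k <oo) ((a k)%:R : R)%:E = +oo)%E.
Proof.
move=> H; apply: eq_infty => r.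
have [m0 Hm] := nat_series_unbounded H (Num.truncn r).+1.
apply: (@le_trans _ _ (\sum_(0 <= k < m0) ((a k)%:R : R)%:E)%E).
  rewrite sumEFin -natr_sum lee_fin big_mkord; apply: ltW.
  by apply: lt_le_trans (truncnS_gt r) _; rewrite ler_nat; exact: Hm.
by apply: nneseries_lim_ge => k _ _; rewrite lee_fin.
Qed.

End NatSeries.

Section PathCurrent.
Context {R : realType} {n : nat}.
Implicit Types (eta xi zeta : conf n) (w : R -> conf n).

Lemma Nright_series eta i :
  (Nright eta i = \sum_(0 <= m <oo) ((occ eta (i + m%:Z)%R)%:R : R)%:E)%E.
Proof.
rewrite nneseries_esumT; last by move=> m; rewrite lee_fin.
rewrite /Nright; apply: (reindex_esum _ _ (fun m : nat => i + m%:Z)); split.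
- by move=> m _ /=; clear; lia.
- by move=> m m' _ _ /=; clear; lia.
- by move=> k /= ik; exists (absz (k - i)%R) => //; clear -ik; lia.
Qed.

Lemma Nleft_series eta i :
  (Nleft eta i = \sum_(0 <= m <oo) ((occ eta (i - 1 - m%:Z))%:R : R)%:E)%E.
Proof.
rewrite nneseries_esumT; last by move=> m; rewrite lee_fin.
rewrite /Nleft; apply: (reindex_esum _ _ (fun m : nat => i - 1 - m%:Z)); split.
- by move=> m _ /=; clear; lia.
- by move=> m m' _ _ /=; clear; lia.
- by move=> k /= ik; exists (absz (i - 1 - k)%R) => //; clear -ik; lia.
Qed.

Lemma current_telescope w i t l : cadlag w -> legit w -> 0 <= t ->
  (\sum_(m < l) occ (w t) (i + m%:Z)%R)%N%:Z - (\sum_(m < l) occ (w 0%R) (i + m%:Z)%R)%N%:Z =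
  current w i t - current w (i + l%:Z) t.
Proof.
move=> cw lw t0; elim: l => [|l IH]; first by rewrite !big_ord0 -[RHS]/(_ - _) (_ : i + 0%:Z = i) ?subrr // addr0.
rewrite !big_ord_recr /= !PoszD.
have := occ_conservation (i + l%:Z) cw lw t0.
have -> : i + l.+1%:Z = i + l%:Z + 1 by clear; lia.
move: IH; move: (current _ _ _) (current _ _ _) (current _ _ _) => a b c.
by move: (\sum_(m < l) _)%N (\sum_(m < l) _)%N => x y; clear; lia.
Qed.

Lemma current_eq0 w i t T : cadlag w -> 0 <= t -> t <= T ->
  (forall s zeta, 0 < s <= T -> w r @[r --> s^'-] --> zeta -> delta i zeta (w s) = 0) ->
  current w i t = 0.
Proof.
move=> cw t0 tT H.
have NJ x y : (x = i - 1 /\ y = i) \/ (x = i /\ y = i - 1) ->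
    [set s | 0 < s <= t /\ jump w x y s] = set0.
  move=> xy; rewrite -subset0 => s /= [/andP[s0 st] [zeta [Hz x0 yn E]]].
  have := H s zeta; rewrite s0 (le_trans st tT) E => /(_ isT Hz).
  case: xy => -[ex ey]; subst x y.
    have := @delta_move_r n i (i - 1) zeta; rewrite subrK eqxx => -> //.
  by have := @delta_move_l n i (i - 1) zeta; rewrite subrK eqxx => -> //.
rewrite /current /ntimes NJ; last by left.
by rewrite NJ; [rewrite fset_set0 cardfs0|right].
Qed.

Lemma eq_ntimes (A B : set R) (t : R) : (forall s, 0 < s -> A s <-> B s) ->
  ntimes A t = ntimes B t.
Proof.
move=> H; rewrite /ntimes.
have -> : [set s | 0 < s <= t /\ A s] = [set s | 0 < s <= t /\ B s]; last by [].
by apply/seteqP; split => s /= [/andP[s0 st] ?]; split; [rewrite s0|apply/H|rewrite s0|apply/H].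
Qed.

(** With nearest-neighbour jumps the half-line can be entered or left only through the bond (i - 1,
    i). This settles the case of infinitely many particles to the right. *)
Lemma legit_entered w i t : legit w -> net_entered w i t = current w i t.
Proof.
move=> lw; rewrite /net_entered /current; congr (_ - _); apply: eq_ntimes => s s0; split.
- move=> [x [y [xi iy J]]].
  have xy : x != y by clear -xi iy; lia.
  have H := legit_jump lw s0 xy J.
  have [ex ey] : x = i - 1 /\ y = i by clear -H xi iy; lia.
  by subst x y.
- by move=> J; exists (i - 1), i; split=> //; clear; lia.
- move=> [x [y [xi iy J]]].
  have xy : y != x by clear -xi iy; lia.
  have H := legit_jump lw s0 xy J.
  have [ex ey] : x = i - 1 /\ y = i by clear -H xi iy; lia.
  by subst x y.
by move=> J; exists (i - 1), i; split=> //; clear; lia.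
Qed.

(* The last hypothesis says that no particle comes from infinity: some far bond
   stays uncrossed. *)
Lemma current_Nright_incr w i t : cadlag w -> legit w -> 0 <= t ->
  (forall K T M : nat, (forall k : int, K%:Z <= k -> occ (w 0%R) k = 0%N) ->
    exists2 p, (M <= p)%N & forall s zeta, 0 < s <= T%:R -> w r @[r --> s^'-] --> zeta ->
     delta (K%:Z + p%:Z + 1) zeta (w s) = 0) ->
  ((current w i t)%:~R : R)%:E = Nright_incr w i t.
Proof.
move=> cw lw t0 NE; rewrite /Nright_incr legit_entered//.
case: ifPn => // fin0.
have [[M HM]|NM] := pselect (exists M, forall m, (M <= m)%N -> occ (w 0%R) (i + m%:Z)%R = 0%N);
  last by move: fin0; rewrite Nright_series nat_series_oo.
pose K := (absz i + M)%N.
have HK (k : int) : K%:Z <= k -> occ (w 0%R) k = 0%N.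
  move=> Kk; have := HM (absz (k - i)%R).
  have -> : i + (absz (k - i)%R)%:Z = k by clear -Kk; lia.
  by apply; clear -Kk; lia.
pose a s m := occ (w s) (i + m%:Z)%R.
(* Cutting at an uncrossed bond beyond [m1] removes the current at the far end. The partial sum at
   time [t] then has the same value for arbitrarily long cuts, which forces [w t] to be empty far to
   the right as well. *)
have sums (m1 : nat) : exists2 l, (m1 <= l)%N &
    (\sum_(m < l) a t m)%N%:Z = (\sum_(m < M) a 0%R m)%N%:Z + current w i t.
  have [p m1p Hp] := NE K (Num.truncn t).+1 (m1 + M)%N HK.
  exists (absz (K%:Z + p%:Z + 1 - i)%R); first by clear -m1p; lia.
  have := current_telescope i (absz (K%:Z + p%:Z + 1 - i)%R) cw lw t0.
  have -> : i + (absz (K%:Z + p%:Z + 1 - i)%R)%:Z = K%:Z + p%:Z + 1 by clear; lia.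
  rewrite (@current_eq0 w _ t (Num.truncn t).+1%:R cw t0 _ Hp); last exact/ltW/truncnS_gt.
  have -> : (\sum_(m < absz (K%:Z + p%:Z + 1 - i)%R) occ (w 0%R) (i + m%:Z)%R = \sum_(m < M) a 0%R m)%N.
    have Ml : (M <= absz (K%:Z + p%:Z + 1 - i)%R)%N by clear -m1p; lia.
    rewrite -!(big_mkord predT (fun m : nat => occ (w 0%R) (i + m%:Z)%R)).
    rewrite (big_cat_nat (leq0n M) Ml) /= big_mkord [X in (_ + X)%N]big_nat_cond.
    rewrite [X in (_ + X)%N]big1 ?addn0// => m /andP[/andP[Mm _] _]; exact: HM.
  rewrite -/(a t) subr0; move: (current w i t); clear.
  move: (\sum_(m < M) _)%N => x c; rewrite /a; move: (\sum_(m < _) _)%N => y; lia.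
have [l0 _ E0] := sums 0%N.
have at0 m : (l0 <= m)%N -> a t m = 0%N.
  move=> lm; have [l ml El] := sums m.+1.
  have E : (\sum_(k < l) a t k = \sum_(k < l0) a t k)%N.
    by move: E0 El; clear; lia.
  move: E; rewrite -!(big_mkord predT (a t)) (big_cat_nat (leq0n l0) (leq_trans lm (ltnW ml))) /=.
  move=> /eqP; rewrite -[X in _ == X]addn0 eqn_add2l sum_nat_seq_eq0 => /allP/(_ m).
  by rewrite mem_index_iota lm ml => /(_ isT)/eqP.
rewrite !Nright_series (nat_series_stop at0) (nat_series_stop HM) -EFinB; congr (_%:E).
have -> : current w i t = (\sum_(k < l0) a t k)%N%:Z - (\sum_(m < M) a 0%R m)%N%:Z.
  by move: E0; clear; lia.
by rewrite intrB.
Qed.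

End PathCurrent.

(** * Exponential moments of the current on a grid *)

Section Weighted.
Context {R : realType} (q : R) (n : nat) (hq : 0 < q < 1).
Variable S : R -> (conf n -> R) -> conf n -> R.
Hypothesis hS : markov_semigroup S.
Hypothesis hG : has_generator S (@local_fun R n) (@asep_gen R q n).
Implicit Types (eta xi : conf n) (f g : conf n -> R) (th h : R).

Definition omega th k eta xi : R := th ^ delta k eta xi.

Lemma omega_wloc th k : wloc [:: k - 1; k] (omega th k).
Proof. by move=> eta eta' xi xi' H H'; rewrite /omega (delta_loc H H'). Qed.

Lemma omega_gt0 th k eta xi : 0 < th -> 0 < omega th k eta xi.
Proof. by move=> th0; rewrite exprz_gt0. Qed.

Lemma omega_refl th k eta : omega th k eta eta = 1.
Proof. by rewrite /omega delta_refl. Qed.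

(** For th = q^2, its N-th iterate on the constant 1 is the moment of the current through bond [k]
    as counted on a grid of N cells. *)
Definition tilt th k h : (conf n -> R) -> conf n -> R := ker S h (omega th k).

Lemma tilt1 th k h eta : tilt th k h (fun=> 1) eta = S h (omega th k eta) eta.
Proof. by rewrite /tilt /ker; congr (S h _ eta); apply/funext => xi; rewrite mulr1. Qed.

Lemma tilt_bcont th k h f : 0 <= h -> bcont f -> bcont (tilt th k h f).
Proof. by move=> h0 bf; exact: (ker_bcont hS h0 (@omega_wloc th k) bf). Qed.

Lemma iter_tilt_bcont th k h m f : 0 <= h -> bcont f -> bcont (iter m (tilt th k h) f).
Proof. by move=> h0 bf; elim: m => //= m IH; exact: tilt_bcont. Qed.

Lemma tilt_lin th k h a f g : 0 <= h -> bcont f -> bcont g ->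
  tilt th k h (fun x => a * f x + g x) =
  (fun x => a * tilt th k h f x + tilt th k h g x).
Proof. by move=> h0 bf bg; exact: (ker_lin hS a h0 (@omega_wloc th k) bf bg). Qed.

Lemma iter_tilt_lin th k h a m f g : 0 <= h -> bcont f -> bcont g ->
  iter m (tilt th k h) (fun x => a * f x + g x) =
  (fun x => a * iter m (tilt th k h) f x + iter m (tilt th k h) g x).
Proof.
by move=> h0 bf bg; elim: m => //= m ->; rewrite tilt_lin//; exact: iter_tilt_bcont.
Qed.

(** The final [+ 1] absorbs the remainder of the generator expansion, taken with accuracy 1. *)
Definition tilt_rate th : R := rmax q n * (`|th - 1| + `|th^-1 - 1|) + 1.

Lemma tilt_rate_ge0 th : 0 <= tilt_rate th.
Proof. by rewrite /tilt_rate addr_ge0// mulr_ge0 ?rmax_ge0// addr_ge0. Qed.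

Lemma gen_omega th k eta : asep_gen q (omega th k eta) eta =
  rate_r q n (occ eta (k - 1)) (occ eta k) * (th - 1) +
  rate_l q n (occ eta (k - 1)) (occ eta k) * (th^-1 - 1).
Proof. by rewrite (gen_delta q (fun d => th ^ d)) expr1z expr0z exprN1. Qed.

Lemma near_tilt1 th k e : 0 < e -> exists2 h0, 0 < h0 & forall h eta, 0 <= h -> h < h0 ->
  `|tilt th k h (fun=> 1) eta - 1 -
    h * (rate_r q n (occ eta (k - 1)) (occ eta k) * (th - 1) +
         rate_l q n (occ eta (k - 1)) (occ eta k) * (th^-1 - 1))| <= h * e.
Proof.
move=> e0; have [h0 h00 H] := generator_wloc hS hG (fun f lf => lf) (@omega_wloc th k) e0.
exists h0 => // h eta hh hh0; have := H h eta hh hh0; rewrite omega_refl gen_omega.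
by rewrite tilt1.
Qed.

Lemma tilt_bound th k : 0 < th -> exists2 h0, 0 < h0 & forall h, 0 <= h -> h < h0 ->
  forall f M eta, bcont f -> 0 <= M -> (forall xi, `|f xi| <= M) ->
  `|tilt th k h f eta| <= (1 + h * tilt_rate th) * M.
Proof.
move=> th0; have [h0 h00 H] := near_tilt1 th k (ltr01 : 0 < 1 :> R).
exists h0 => // h hh hh0 f M eta bf M0 fM.
have W := @omega_wloc th k.
have P xi : `|omega th k eta xi| <= omega th k eta xi.
  by rewrite ger0_norm// ltW// omega_gt0.
apply: le_trans (ker_bound hS hh W W bf M0 P fM) _.
rewrite mulrC ler_wpM2r//; have := H h eta hh hh0.
rewrite tilt1.
move: (S h (omega th k eta) eta) => s.
have Ho := rate_sum_le hq (occ_le eta (k - 1)) (occ_le eta k).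
have H1 := rate_r_ge0 hq (occ eta (k - 1)) (occ_le eta k).
have H2 := rate_l_ge0 hq (occ eta k) (occ_le eta (k - 1)).
move: (rate_r _ _ _ _) (rate_l _ _ _ _) Ho H1 H2 => r l Ho r0 l0.
rewrite ler_norml => /andP[_ Hs].
have K1 : r * (th - 1) <= rmax q n * `|th - 1|.
  apply: le_trans (ler_wpM2l r0 (ler_norm _)) _; apply: ler_wpM2r => //; lra.
have K2 : l * (th^-1 - 1) <= rmax q n * `|th^-1 - 1|.
  apply: le_trans (ler_wpM2l l0 (ler_norm _)) _; apply: ler_wpM2r => //; lra.
have := ler_wpM2l hh (lerD K1 K2); rewrite /tilt_rate; lra.
Qed.

Lemma iter_tilt_bound th k : 0 < th -> exists2 h0, 0 < h0 & forall h, 0 <= h -> h < h0 ->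
  forall f M m eta, bcont f -> 0 <= M -> (forall xi, `|f xi| <= M) ->
  `|iter m (tilt th k h) f eta| <= (1 + h * tilt_rate th) ^+ m * M.
Proof.
move=> th0; have [h0 h00 H] := tilt_bound k th0; exists h0 => // h hh hh0 f M m eta bf M0 fM.
have C0 : 0 <= 1 + h * tilt_rate th by rewrite addr_ge0// mulr_ge0// tilt_rate_ge0.
elim: m eta => [|m IH] eta; first by rewrite expr0 mul1r.
rewrite iterS exprS -mulrA; apply: H => //; first exact: iter_tilt_bcont.
by rewrite mulr_ge0// exprn_ge0.
Qed.

(* [chg] vanishes on jumps, so that multiplication by [th ^ occ _ k] intertwines
   the tilted kernels of the bonds on either side of [k] up to [o(h)]. *)
Definition chg th k eta xi : R :=
  th ^ ((occ eta k)%:Z - (occ xi k)%:Z + delta k eta xi) - th ^ delta (k + 1) eta xi.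

Lemma chg_wloc th k : wloc [:: k - 1; k; k + 1] (chg th k).
Proof.
move=> eta eta' xi xi' H H'; rewrite /chg.
have k2 : k \in [:: k - 1; k; k + 1] by rewrite !inE eqxx orbT.
rewrite (agree_occ H k2) (agree_occ H' k2); congr (_ ^ (_ + _) - _ ^ _); apply: delta_loc.
- by apply: agree_sub H => y; rewrite !inE => /orP[->//|->]; rewrite orbT.
- by apply: agree_sub H' => y; rewrite !inE => /orP[->//|->]; rewrite orbT.
- by apply: agree_sub H => y; rewrite !inE addrK => /orP[->|->]; rewrite !orbT.
- by apply: agree_sub H' => y; rewrite !inE addrK => /orP[->|->]; rewrite !orbT.
Qed.

Lemma chg_perm th k eta xi : perm [:: k - 1; k; k + 1] eta xi -> chg th k eta xi = 0.
Proof.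
move=> /perm_conservation E; apply/eqP; rewrite /chg subr_eq0; apply/eqP; congr (_ ^ _).
by move: E; move: (delta k eta xi) (delta (k + 1) eta xi) => a b; clear; lia.
Qed.

(** Conservation of particles makes [chg] vanish on the diagonal and on single jumps, so the
    generator gives nothing at first order. *)
Lemma near_chg th k e : 0 < e -> exists2 h0, 0 < h0 & forall h eta, 0 <= h -> h < h0 ->
  S h (fun xi => `|chg th k eta xi|) eta <= h * e.
Proof.
move=> e0; pose phi eta xi := `|chg th k eta xi|.
have W : wloc [:: k - 1; k; k + 1] phi.
  by move=> eta eta' xi xi' H H'; rewrite /phi (chg_wloc th H H').
have [h0 h00 H] := generator_wloc hS hG (fun f lf => lf) W e0.
exists h0 => // h eta hh hh0; have := H h eta hh hh0.
have phi0 : phi eta eta = 0 by rewrite /phi chg_perm ?normr0//; exact: perm_refl.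
rewrite gen_nn0 ?phi0; last first.
  by move=> xi /(nnmove_perm [:: k - 1; k; k + 1]) /(chg_perm th) E; rewrite /phi E normr0.
by rewrite mulr0 !subr0 => /(le_trans (ler_norm _)).
Qed.

Definition occM th k eta : R := th ^+ occ eta k.

Lemma occM_loc th k : loc [:: k] (occM th k).
Proof. by move=> eta xi H; rewrite /occM (agree_occ H)// inE. Qed.

Lemma occM_bcont th k : bcont (occM th k).
Proof. exact: loc_bcont (@occM_loc th k). Qed.

Lemma tilt_conj th k : 0 < th -> forall e, 0 < e ->
  exists2 h0, 0 < h0 & forall h, 0 <= h -> h < h0 ->
  forall f M eta, bcont f -> 0 <= M -> (forall xi, `|occM th k xi * f xi| <= M) ->
  `|occM th k eta * tilt th k h f eta - tilt th (k + 1) h (fun x => occM th k x * f x) eta|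
    <= h * e * M.
Proof.
move=> th0 e e0; have [h0 h00 H] := near_chg th k e0.
exists h0 => // h hh hh0 f M eta bf M0 fM.
have thn : th != 0 by rewrite gt_eqF.
have W := @chg_wloc th k.
have Wn : wloc [:: k - 1; k; k + 1] (fun eta xi => `|chg th k eta xi|).
  by move=> ? ? ? ? A A'; rewrite (W _ _ _ _ A A').
have bm : bcont (fun x => occM th k x * f x) by exact (bcont_mul (occM_bcont th k) bf).
have -> : occM th k eta * tilt th k h f eta - tilt th (k + 1) h (fun x => occM th k x * f x) eta
    = ker S h (chg th k) (fun x => occM th k x * f x) eta.
  have b1 := bcont_wloc eta (@omega_wloc th k) bf.
  have b2 := bcont_wloc eta (@omega_wloc th (k + 1)) bm.
  rewrite /tilt /ker.
  rewrite -[X in X - _](congr1 (@^~ eta) (sgZ hS (occM th k eta) hh b1)).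
  rewrite -[LHS](congr1 (@^~ eta) (sgB hS hh (bcontZ (occM th k eta) b1) b2)).
  (* Multiplying [chg] by th^(xi_k) gives exactly the difference of the two integrands, th^(eta_k)
     omega_k - omega_(k+1) th^(xi_k), up to the common factor f(xi). *)
  congr (S h _ eta); apply/funext => xi; rewrite /chg /omega.
  move: (delta k eta xi) (delta (k + 1) eta xi) => d d'.
  rewrite !expfzDr// -invr_expz /occM.
  rewrite -!exprnP; set a := th ^+ occ xi k.
  have a0 : a != 0 by rewrite expf_neq0.
  by field.
apply: le_trans (ker_bound hS hh W Wn bm M0 (fun xi => lexx _) fM) _.
by rewrite mulrC ler_wpM2r//; exact: H.
Qed.

(** An error [h * e] is made at each of the [m] steps and carried along at the growth rate
    [tilt_rate]; with [m * h] at most [t] the total is O(e). The bound [th <= 1] keeps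
    multiplication by [occM] from enlarging the iterates. *)
Lemma iter_tilt_conj th k : 0 < th -> th <= 1 -> forall e, 0 < e ->
  exists2 h0, 0 < h0 & forall h, 0 <= h -> h < h0 ->
  forall f M m eta, bcont f -> 0 <= M -> (forall xi, `|f xi| <= M) ->
  `|occM th k eta * iter m (tilt th k h) f eta -
    iter m (tilt th (k + 1) h) (fun x => occM th k x * f x) eta|
    <= m%:R * (h * e) * (1 + h * tilt_rate th) ^+ m * M.
Proof.
move=> th0 th1 e e0; have [h1 h10 H1] := tilt_conj k th0 e0.
have [h2 h20 H2] := iter_tilt_bound k th0.
have [h3 h30 H3] := tilt_bound (k + 1) th0.
exists (Num.min h1 (Num.min h2 h3)); first by rewrite !lt_min h10 h20.
move=> h hh; rewrite !lt_min => /and3P[hh1 hh2 hh3] f M m eta bf M0 fM.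
have C0 : 0 <= 1 + h * tilt_rate th by rewrite addr_ge0// mulr_ge0// tilt_rate_ge0.
have C1 : 1 <= 1 + h * tilt_rate th by rewrite lerDl mulr_ge0// tilt_rate_ge0.
set B := 1 + h * tilt_rate th in C0 C1 *.
elim: m eta => [|m IH] eta; first by rewrite /= subrr normr0 !mul0r.
set F := iter m (tilt th k h) f in IH *.
set G := iter m (tilt th (k + 1) h) (fun x => occM th k x * f x) in IH *.
have bF : bcont F by exact: iter_tilt_bcont.
have bm : bcont (fun x => occM th k x * f x) by exact (bcont_mul (occM_bcont th k) bf).
have bG : bcont G by exact: iter_tilt_bcont.
have bMF : bcont (fun x => occM th k x * F x) by exact (bcont_mul (occM_bcont th k) bF).
have FM xi : `|occM th k xi * F xi| <= B ^+ m * M.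
  rewrite normrM (ger0_norm (exprn_ge0 _ (ltW th0))).
  apply: le_trans (H2 h hh hh2 f M m xi bf M0 fM); rewrite ler_piMl// exprn_ile1//.
  exact: ltW.
have K1 := H1 h hh hh1 F _ eta bF (mulr_ge0 (exprn_ge0 m C0) M0) FM.
have K2 := H3 h hh hh3 (fun x => occM th k x * F x - G x) _ eta (bcontB bMF bG) _ IH.
rewrite !iterS -/F -/G.
have E : tilt th (k + 1) h (fun x => occM th k x * F x - G x) eta =
    tilt th (k + 1) h (fun x => occM th k x * F x) eta - tilt th (k + 1) h G eta.
  have := congr1 (@^~ eta) (tilt_lin th (k + 1) (-1) hh bG bMF).
  rewrite /= mulN1r => E0; rewrite [RHS]addrC -E0; congr (tilt _ _ _ _ eta).
  by apply/funext => x; rewrite mulN1r addrC.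
rewrite E in K2; have {}K2 := K2 _; rewrite -(subrKA (tilt th (k + 1) h (fun x => occM th k x * F x) eta)).
apply: le_trans (ler_normD _ _) _.
have P : 0 <= m%:R * (h * e) * B ^+ m * M.
  by rewrite !mulr_ge0// ?exprn_ge0// ltW.
apply: le_trans (lerD K1 (K2 P)) _; rewrite -/B exprS -natr1.
have Q : h * e * (B ^+ m * M) <= B * (h * e * (B ^+ m * M)).
  by rewrite ler_peMl// !mulr_ge0 ?exprn_ge0// ltW.
by move: Q; move: (B ^+ m) => b; lra.
Qed.

End Weighted.

Lemma compound_le {R : realType} (t C : R) (m N : nat) : 0 <= t -> 0 <= C -> (m <= N)%N ->
  (1 + t / N%:R * C) ^+ m <= expR (t * C).
Proof.
move=> t0 C0 mN; have [N0|N0] := posnP N.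
  move: mN; rewrite N0 leqn0 => /eqP ->; rewrite expr0 -expR0 ler_expR mulr_ge0//.
have h0 : 0 <= t / N%:R by rewrite divr_ge0.
have B1 : 0 <= 1 + t / N%:R * C by rewrite addr_ge0// mulr_ge0.
apply: (@le_trans _ _ (expR (t / N%:R * C) ^+ m)).
  by apply: lerXn2r; rewrite ?nnegrE ?expR_ge0 ?expR_ge1Dx.
rewrite -expRM_natl ler_expR mulrA ler_wpM2r// mulrCA ler_piMr//.
by rewrite ler_pdivrMr ?ltr0n// mul1r ler_nat.
Qed.

(** * The closed lattice equation for the moments *)

Section Moments.
Context {R : realType} (q : R) (n : nat) (hq : 0 < q < 1).
Variable S : R -> (conf n -> R) -> conf n -> R.
Hypothesis hS : markov_semigroup S.
Hypothesis hG : has_generator S (@local_fun R n) (@asep_gen R q n).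
Implicit Types (xi : conf n) (f g : conf n -> R) (h : R).

Local Notation th := (q ^+ 2).
Let q0 : 0 < q. Proof. by case/andP: hq. Qed.
Let q1 : q < 1. Proof. by case/andP: hq. Qed.
Let th0 : 0 < th. Proof. exact: exprn_gt0. Qed.
Let th1 : th <= 1. Proof. by rewrite exprn_ile1 ?ltW. Qed.

(** [Psi k] will be q^(2 (N_k - N_i)(eta)), finite even when both counts are infinite. The
    recurrence [PsiS] determines it up to a factor. *)
Variables (eta : conf n) (Psi : int -> R).
Hypothesis Psi_gt0 : forall k, 0 < Psi k.
Hypothesis PsiS : forall k, Psi k = occM th k eta * Psi (k + 1).

Definition moment (t : R) (N m : nat) (k : int) : R :=
  Psi k * iter m (tilt S th k (t / N%:R)) (fun=> 1) eta.

(** The innermost kernel is expanded ([iterSr]): [T 1] is 1 plus [h] times the right-hand side of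
    [hopf_cole], up to a small remainder. Its two exponential factors are pulled out of the [m]
    outer kernels, and [PsiS] identifies them with the ratios of [Psi] between neighbours. *)
Lemma moment_rec t k e : 0 <= t -> 0 < e -> \forall N \near \oo, forall m, (m < N)%N ->
  `|moment t N m.+1 k - moment t N m k -
    t / N%:R * lat (al q n) (be q n) (al q n + be q n) (moment t N m) k| <= t / N%:R * e.
Proof.
move=> t0 e0; pose E := expR (t * tilt_rate q n th).
have E0 : 0 < E by exact: expR_gt0.
have a0 := al_ge0 n hq; have b0 := be_ge0 n hq.
have [a aE] : exists a, a = al q n by eexists.
have [b bE] : exists b, b = be q n by eexists.
rewrite -aE -bE in a0 b0 *.
have [A2 A2E] : exists c, c = occM th k eta by eexists.
(* [D] collects what multiplies [e1] in the three remainders [K1], [K2], [K3]; [t + 1] replaces [t]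
   to keep it positive at [t = 0]. *)
pose D := (t + 1) * E * (1 + a + b * A2^-1 * (th ^+ n)^-1) * Psi k.
have M0 : 0 < A2 by rewrite A2E; exact: exprn_gt0.
have thn0 : 0 < th ^+ n by exact: exprn_gt0.
have D0 : 0 < D.
  have B0 : 0 <= b * A2^-1 * (th ^+ n)^-1.
    by apply: mulr_ge0; [apply: mulr_ge0 => //|]; rewrite invr_ge0 ltW.
  by rewrite !mulr_gt0//; [rewrite ltr_wpDl|rewrite -addrA ltr_wpDr// addr_ge0].
pose e1 := e / D; have e10 : 0 < e1 by rewrite divr_gt0.
have [h1 h10 H1] := near_tilt1 hS hG th k e10.
have [h2 h20 H2] := iter_tilt_bound hq hS hG k th0.
have [h3 h30 H3] := iter_tilt_conj hq hS hG (k - 1) th0 th1 e10.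
have [h4 h40 H4] := iter_tilt_conj hq hS hG k th0 th1 e10.
near=> N; move=> m mN.
have [_ N1] : (0 < N)%N /\ t / N%:R < h1 by near: N; exact: near_mesh.
have [_ N2] : (0 < N)%N /\ t / N%:R < h2 by near: N; exact: near_mesh.
have [_ N3] : (0 < N)%N /\ t / N%:R < h3 by near: N; exact: near_mesh.
have [N0 N4] : (0 < N)%N /\ t / N%:R < h4 by near: N; exact: near_mesh.
have hh : 0 <= t / N%:R by rewrite divr_ge0.
have mh : m%:R * (t / N%:R) <= t.
  rewrite mulrCA ler_piMr// ler_pdivrMr ?ltr0n// mul1r ler_nat; exact: ltnW.
set h := t / N%:R in hh N1 N2 N3 N4 mh *.
have cmp : (1 + h * tilt_rate q n th) ^+ m <= E.
  by apply: compound_le => //; [exact: tilt_rate_ge0|exact: ltnW].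
have B0 : 0 <= 1 + h * tilt_rate q n th.
  by apply: addr_ge0 => //; apply: mulr_ge0 => //; exact: tilt_rate_ge0.
have b1 : bcont (fun _ : conf n => (1 : R)) by exact: bcont_cst.
pose Mi xi := (th ^+ occ xi k)^-1.
have bMi : bcont Mi.
  apply: (@loc_bcont n R [:: k]) => xi xi' H; rewrite /Mi (agree_occ H)// inE.
  exact: eqxx.
have bM : bcont (occM th (k - 1) : conf n -> R) by exact: occM_bcont.
pose T := iter m (tilt S th k h).
pose rem xi := tilt S th k h (fun=> 1) xi -
  (h * a * occM th (k - 1) xi + (h * b * Mi xi + (1 - h * (a + b)))).
have bT1 : bcont (tilt S th k h (fun=> 1)) by exact: tilt_bcont.
have brem : bcont rem.
  apply: bcontB => //; apply: bcont_lin => //; apply: bcont_lin => //; exact: bcont_cst.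
have remE xi : `|rem xi| <= h * e1.
  apply: le_trans (H1 h xi hh N1); rewrite /rem.
  have := hopf_cole n hq (occ xi (k - 1)) (occ xi k).
  rewrite -invr_expz -!exprnP -/(Mi xi) -/(occM th (k - 1) xi) => ->; rewrite -aE -bE.
  by rewrite le_eqVlt; apply/orP; left; apply/eqP; congr `|_|; ring.
have T1 : T (tilt S th k h (fun=> 1)) eta =
    h * a * T (occM th (k - 1)) eta + (h * b * T Mi eta + (1 - h * (a + b)) * T (fun=> 1) eta) + T rem eta.
  have -> : tilt S th k h (fun=> 1) = fun xi => 1 * (h * a * occM th (k - 1) xi + (h * b * Mi xi + ((1 - h * (a + b)) * 1 + 0))) + rem xi.
    by apply/funext => xi; rewrite /rem; ring.
  have c0 : bcont (fun _ : conf n => (0 : R)) by exact: bcont_cst.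
  have c1 : bcont (fun _ : conf n => (1 - h * (a + b)) * 1 + 0 : R) by exact: bcont_cst.
  have c2 := bcont_lin (h * b) bMi c1.
  have c3 := bcont_lin (h * a) bM c2.
  rewrite /T (iter_tilt_lin hS th k 1 m hh c3 brem).
  rewrite (iter_tilt_lin hS th k _ m hh bM c2) (iter_tilt_lin hS th k _ m hh bMi c1).
  rewrite (iter_tilt_lin hS th k _ m hh b1 c0).
  have -> : iter m (tilt S th k h) (fun=> 0) = fun=> 0.
    have := iter_tilt_lin hS th k (-1) m hh b1 b1.
    by under eq_fun do rewrite mulN1r addNr; under [RHS]eq_fun do rewrite mulN1r addNr.
  by ring.
have K1 : `|T rem eta| <= E * (h * e1).
  apply: le_trans (H2 h hh N2 rem _ m eta brem _ remE) _; first exact: mulr_ge0 hh (ltW e10).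
  by apply: ler_wpM2r => //; exact: mulr_ge0 hh (ltW e10).
(* Conjugation at [k - 1] is applied to the constant 1. In [K3], conjugation at [k] is applied to
   [Mi], whose product with [occM th k] is 1. Both comparisons thus end at iterates on the constant
   1, that is, at moments of the neighbouring bonds. *)
have K2 : `|occM th (k - 1) eta * iter m (tilt S th (k - 1) h) (fun=> 1) eta - T (occM th (k - 1)) eta| <=
    t * e1 * E.
  have := H3 h hh N3 (fun=> 1) 1 m eta b1 ler01 (fun _ => ltac:(rewrite normr1; exact: lexx)).
  rewrite subrK mulr1.
  have -> : (fun x : conf n => occM th (k - 1) x * 1) = occM th (k - 1).
    by apply/funext => x; rewrite mulr1.
  move=> /le_trans; apply; rewrite mulrA; apply: ler_pM => //.
  - exact: mulr_ge0 (mulr_ge0 (ler0n _ _) hh) (ltW e10).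
  - exact: exprn_ge0 B0.
  - by rewrite ler_wpM2r// ltW.
have K3 : `|occM th k eta * T Mi eta - iter m (tilt S th (k + 1) h) (fun=> 1) eta| <=
    t * e1 * E * (th ^+ n)^-1.
  have MiB xi : `|Mi xi| <= (th ^+ n)^-1.
    have p0 : 0 < th ^+ occ xi k by exact: exprn_gt0.
    rewrite /Mi ger0_norm ?invr_ge0 ?(ltW p0)// lef_pV2 ?posrE//.
    by apply: ler_wiXn2l (ltW th0) th1 _ _ (occ_le xi k).
  have := H4 h hh N4 Mi _ m eta bMi (ltW _) MiB; rewrite invr_gt0 => /(_ thn0).
  have -> : (fun x : conf n => occM th k x * Mi x) = fun=> 1.
    by apply/funext => x; rewrite /occM /Mi divff// expf_neq0// gt_eqF.
  move=> /le_trans; apply; rewrite ler_wpM2r ?invr_ge0 ?(ltW thn0)//.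
  rewrite mulrA; apply: ler_pM => //.
  - exact: mulr_ge0 (mulr_ge0 (ler0n _ _) hh) (ltW e10).
  - exact: exprn_ge0 B0.
  - by rewrite ler_wpM2r// ltW.
have P1 : Psi (k - 1) = occM th (k - 1) eta * Psi k by rewrite PsiS subrK.
have P2 : Psi (k + 1) = (occM th k eta)^-1 * Psi k.
  by rewrite (PsiS k) mulrA mulVf ?mul1r// gt_eqF// -A2E.
rewrite /moment -/h /lat iterSr -/T T1 P1 P2 -/T.
move: (T (fun=> 1) eta) (T rem eta) (T Mi eta) (T (occM th (k - 1)) eta) K1 K2 K3.
move: (iter m (tilt S th (k - 1) h) (fun=> 1) eta) (iter m (tilt S th (k + 1) h) (fun=> 1) eta).
move=> um up v0 vr vp vm K1 K2 K3.
rewrite -A2E in K3 *; set A1 := occM th (k - 1) eta in K2 *.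
have -> : Psi k * (h * a * vm + (h * b * vp + (1 - h * (a + b)) * v0) + vr) - Psi k * v0 -
   h * (a * (A1 * Psi k * um) + b * (A2^-1 * Psi k * up) - (a + b) * (Psi k * v0)) =
   Psi k * (vr - h * (a * (A1 * um - vm)) + h * (b * A2^-1 * (A2 * vp - up))).
  by field; rewrite gt_eqF.
rewrite normrM gtr0_norm//.
have V : `|vr - h * (a * (A1 * um - vm)) + h * (b * A2^-1 * (A2 * vp - up))| <=
    E * (h * e1) + h * (a * (t * e1 * E)) + h * (b * A2^-1 * (t * e1 * E * (th ^+ n)^-1)).
  apply: le_trans (ler_normD _ _) _; apply: lerD.
    apply: le_trans (ler_normB _ _) _; apply: lerD => //.
    by rewrite normrM (ger0_norm hh) normrM (ger0_norm a0); do 2 apply: ler_wpM2l => //.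
  have bA : 0 <= b * A2^-1 by rewrite mulr_ge0// invr_ge0 ltW.
  by rewrite normrM (ger0_norm hh) normrM (ger0_norm bA); do 2 apply: ler_wpM2l => //.
apply: le_trans (ler_wpM2l (ltW (Psi_gt0 k)) V) _.
have -> : h * e = h * (e1 * D) by rewrite /e1 divfK ?gt_eqF.
have -> : Psi k * (E * (h * e1) + h * (a * (t * e1 * E)) + h * (b * A2^-1 * (t * e1 * E * (th ^+ n)^-1))) =
  (h * e1 * E * Psi k) * (1 + t * (a + b * A2^-1 * (th ^+ n)^-1)) by ring.
have -> : h * (e1 * D) = (h * e1 * E * Psi k) * ((t + 1) * (1 + a + b * A2^-1 * (th ^+ n)^-1)).
  by rewrite /D; ring.
apply: ler_wpM2l.
  exact: mulr_ge0 (mulr_ge0 (mulr_ge0 hh (ltW e10)) (ltW E0)) (ltW (Psi_gt0 k)).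
have : 0 <= b * A2^-1 * (th ^+ n)^-1.
  by apply: mulr_ge0; [apply: mulr_ge0 => //|]; rewrite invr_ge0 ltW.
move: (b * A2^-1 * (th ^+ n)^-1) => c c0.
have -> : (t + 1) * (1 + a + c) = 1 + t * (a + c) + (t + a + c) by ring.
by rewrite lerDl !addr_ge0.
Unshelve. all: by end_near.
Qed.

End Moments.

Section MomentLimit.
Context {R : realType} (q : R) (n : nat) (hq : 0 < q < 1).
Variable S : R -> (conf n -> R) -> conf n -> R.
Hypothesis hS : markov_semigroup S.
Hypothesis hG : has_generator S (@local_fun R n) (@asep_gen R q n).

Local Notation th := (q ^+ 2).
Let q0 : 0 < q. Proof. by case/andP: hq. Qed.
Let q1 : q < 1. Proof. by case/andP: hq. Qed.
Let th0 : 0 < th. Proof. exact: exprn_gt0. Qed.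
Let th1 : th <= 1. Proof. by rewrite exprn_ile1 ?ltW. Qed.

(** Norm bound for [G] in the sup norm weighted by [Psi]: one step to the right multiplies [Psi] by
    at most th^(-n), one step to the left by at most 1. *)
Definition spread_rate : R := al q n + be q n * (th ^+ n)^-1 + (al q n + be q n).

Lemma spread_rate_ge0 : 0 <= spread_rate.
Proof.
have a0 := al_ge0 n hq; have b0 := be_ge0 n hq.
apply: addr_ge0; last exact: addr_ge0.
by apply: addr_ge0 => //; apply: mulr_ge0 => //; rewrite invr_ge0 exprn_ge0// ltW.
Qed.

Lemma spread_bound (W : int -> R) k : (forall k, 0 <= W k) ->
  W (k - 1) <= W k -> W (k + 1) <= (th ^+ n)^-1 * W k ->
  `|al q n| * W (k - 1) + `|be q n| * W (k + 1) + `|al q n + be q n| * W k <=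
    spread_rate * W k.
Proof.
move=> W0 W1 W2; have a0 := al_ge0 n hq; have b0 := be_ge0 n hq.
rewrite !ger0_norm ?addr_ge0//.
have := ler_wpM2l a0 W1; have := ler_wpM2l b0 W2; rewrite /spread_rate; lra.
Qed.

Variables (eta : conf n) (Psi : int -> R).
Hypothesis Psi_gt0 : forall k, 0 < Psi k.
Hypothesis PsiS : forall k, Psi k = occM th k eta * Psi (k + 1).

Lemma occM_bounds k : th ^+ n <= occM th k eta <= 1.
Proof.
apply/andP; split; first exact: ler_wiXn2l (ltW th0) th1 _ _ (occ_le eta k).
exact: exprn_ile1 (ltW th0) th1.
Qed.

Lemma Psi_le k : Psi k <= Psi (k + 1).
Proof.
have /andP[_ H] := occM_bounds k.
rewrite (PsiS k); exact: ler_piMl (ltW (Psi_gt0 _)) H.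
Qed.

Lemma Psi_ge k : Psi (k + 1) <= (th ^+ n)^-1 * Psi k.
Proof.
have /andP[H _] := occM_bounds k; have tn : 0 < th ^+ n by rewrite exprn_gt0.
rewrite mulrC ler_pdivlMr// mulrC (PsiS k) ler_wpM2r// ltW//.
Qed.

Lemma moment_taylor t k L : 0 <= t ->
  moment q S eta Psi t N N k @[N --> \oo] --> L ->
  forall P, `|L - texp (al q n) (be q n) (al q n + be q n) t P Psi k| <=
    expR (t * tilt_rate q n th) * Psi k * ((spread_rate * t) ^+ P / P`!%:R).
Proof.
move=> t0 HL; pose W k := expR (t * tilt_rate q n th) * Psi k.
have E0 : 0 < expR (t * tilt_rate q n th) by exact: expR_gt0.
have W0 k' : 0 <= W k' by apply: mulr_ge0; apply: ltW.
apply: (@newton_taylor_lim _ _ _ _ (moment q S eta Psi t) Psi W) => //.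
- exact: spread_rate_ge0.
- move=> k'; apply: spread_bound => //; rewrite /W.
    by rewrite ler_pM2l//; have := Psi_le (k' - 1); rewrite subrK.
  by rewrite mulrCA ler_pM2l//; exact: Psi_ge.
- by move=> N k'; rewrite /moment mulr1.
- move=> k'; have [h2 h20 H2] := iter_tilt_bound hq hS hG k' th0.
  near=> N; move=> m mN.
  have [N0 N2] : (0 < N)%N /\ t / N%:R < h2 by near: N; exact: near_mesh.
  have hh : 0 <= t / N%:R by rewrite divr_ge0.
  rewrite /moment normrM (gtr0_norm (Psi_gt0 _)) /W mulrC.
  apply: ler_wpM2r; first exact: ltW.
  have one1 (xi : conf n) : `|(1 : R)| <= 1 by rewrite normr1.
  apply: le_trans (H2 _ hh N2 (fun=> 1) 1 m eta (bcont_cst 1) ler01 one1) _.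
  by rewrite mulr1; apply: compound_le => //; exact: tilt_rate_ge0.
- by move=> k' e e0; exact: (moment_rec hq hS hG Psi_gt0 PsiS).
Unshelve. all: by end_near.
Qed.

End MomentLimit.

(** * Expected occupation beyond the last particle, and rare transitions *)

Section Spread.
Context {R : realType} (q : R) (n : nat) (hq : 0 < q < 1).
Variable S : R -> (conf n -> R) -> conf n -> R.
Hypothesis hS : markov_semigroup S.
Hypothesis hG : has_generator S (@local_fun R n) (@asep_gen R q n).

Definition occR (k : int) (eta : conf n) : R := (occ eta k)%:R.

Lemma occR_loc k : loc [:: k] (occR k).
Proof. by move=> eta xi H; rewrite /occR (agree_occ H)// inE. Qed.

Lemma occR_bcont k : bcont (occR k).
Proof. exact: loc_bcont (@occR_loc k). Qed.

(** The expected occupation starts at 0 beyond [K] and, by [gen_occ_le], is fed only by the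
    neighbours, at rate at most [rmax]; [propagation_bound] applies to its values on a time grid. *)
Lemma occ_spread t K eta p k : 0 <= t -> (forall k, K <= k -> occ eta k = 0%N) ->
  K + p%:Z <= k -> S t (occR k) eta <= n%:R * ((2 * rmax q n * t) ^+ p / p`!%:R).
Proof.
move=> t0 e0K Kk; apply/ler_addgt0Pr => e e0.
pose u (N m : nat) (k : int) := S (m%:R * (t / N%:R)) (occR k) eta.
have hN N : 0 <= t / N%:R by rewrite divr_ge0.
have hm (N m : nat) : 0 <= m%:R * (t / N%:R) by rewrite mulr_ge0.
have C0 := rmax_ge0 n hq.
have := @propagation_bound R u t (rmax q n) n%:R K t0 C0 (ler0n _ _) _ _ _ p k e e0 Kk.
have H1 (N : nat) k' : K <= k' -> u N 0 k' <= 0.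
  move=> Kk'; rewrite /u mul0r (ms_zero hS); last exact: occR_bcont.
  by rewrite /occR e0K.
have H2 (N m : nat) k' : u N m k' <= n%:R.
  rewrite /u; apply: le_trans (ler_norm _) _; apply: (sg_bound hS eta (hm N m) (occR_bcont k')) => xi.
  by rewrite ger0_norm ?ler0n// ler_nat occ_le.
have H3 k' d : 0 < d -> \forall N \near \oo, forall m, (m < N)%N ->
    u N m.+1 k' - u N m k' <= t / N%:R * (rmax q n * (u N m (k' - 1) + u N m (k' + 1)) + d).
  move=> d0; have gn := generator_near hG (loc_local (@occR_loc k')) (occR_bcont k') d0.
  have [h1 h10 Hh] := near_at_right gn.
  near=> N; move=> m mN.
  have [N0 N1] : (0 < N)%N /\ t / N%:R < h1 by near: N; exact: near_mesh.
  have bk j := occR_bcont j.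
  rewrite /u -natr1 mulrDl mul1r (ms_add hS (hm N m) (hN N) (bk k')).
  have bS := ms_bcont hS (hN N) (bk k').
  rewrite -[X in X <= _](congr1 (@^~ eta) (sgB hS (hm N m) bS (bk k'))).
  set h := t / N%:R in N1 *.
  have -> : h * (rmax q n * (S (m%:R * h) (occR (k' - 1)) eta + S (m%:R * h) (occR (k' + 1)) eta) + d) =
      S (m%:R * h) (fun xi => h * rmax q n * (occR (k' - 1) xi + occR (k' + 1) xi) + h * d) eta.
    have b2 := bcontD (bk (k' - 1)) (bk (k' + 1)).
    rewrite (ms_linear hS (h * rmax q n) (hm N m) b2 (bcont_cst (h * d))).
    rewrite (sgD hS (hm N m) (bk (k' - 1)) (bk (k' + 1))) (sgC hS _ (hm N m)); ring.
  have bR := bcont_lin (h * rmax q n) (bcontD (bk (k' - 1)) (bk (k' + 1))) (bcont_cst (h * d)).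
  apply: (sg_le hS eta (hm N m) (bcontB bS (bk k')) bR) => xi; have [h00|hn0] := eqVneq 0 h.
    by rewrite -/h -h00 (ms_zero hS)// subrr !mul0r addr0.
  have hp : 0 < h by rewrite lt_neqAle hn0 hN.
  have := Hh h; rewrite add0r hp N1 => /(_ isT xi); rewrite ler_norml => /andP[_].
  have := ler_wpM2l (hN N) (gen_occ_le hq k' xi); rewrite -/h -/(occR _ _) -/(occR _ _).
  move: (asep_gen _ _ _) => g; lra.
move=> /(_ H1 H2 H3) H.
near (\oo : set_system nat) => N.
have N0 : (0 < N)%N by near: N; exact: nbhs_infty_gt.
have HN : forall m, (m <= N)%N ->
   u N m k <= n%:R * ((2 * rmax q n) ^+ p) * ((t / N%:R) ^+ p * 'C(m, p)%:R) + e by near: N.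
have := HN N (leqnn N); rewrite /u mulrCA divff ?mulr1 ?pnatr_eq0 -?lt0n//.
move=> /le_trans; apply; rewrite lerD2r (exprMn p (2 * rmax q n) t).
have c0 : 0 <= n%:R * (2 * rmax q n) ^+ p.
  by apply: mulr_ge0 => //; apply: exprn_ge0; exact: mulr_ge0.
by have := ler_wpM2l c0 (binomial_le p (leqnn N) t0 erefl); rewrite -!mulrA.
Unshelve. all: by end_near.
Qed.

Definition crossed (k : int) (eta xi : conf n) : R := (delta k eta xi != 0)%:R.

Lemma crossed_wloc k : wloc [:: k - 1; k] (crossed k).
Proof. by move=> eta eta' xi xi' H H'; rewrite /crossed (delta_loc H H'). Qed.

Lemma near_crossed k e : 0 < e -> exists2 h0, 0 < h0 & forall h eta, 0 <= h -> h < h0 ->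
  S h (crossed k eta) eta <= h * (rmax q n * (occR (k - 1) eta + occR k eta) + e).
Proof.
move=> e0; have [h0 h00 H] := generator_wloc hS hG (fun f lf => lf) (@crossed_wloc k) e0.
exists h0 => // h eta hh hh0; have := H h eta hh hh0.
have -> : crossed k eta eta = 0 by rewrite /crossed delta_refl eqxx.
rewrite [asep_gen q _ eta](gen_delta q (fun d => (d != 0)%:R)) eqxx /= !subr0 !mulr1.
rewrite ler_norml => /andP[_].
have := rate_r_le hq (occ_le eta (k - 1)) (occ_le eta k).
have := rate_l_le hq (occ_le eta (k - 1)) (occ_le eta k).
rewrite -/(occR _ _) -/(occR _ _) => B1 B2.
have := ler_wpM2l hh (lerD B1 B2).
move: (rate_r _ _ _ _) (rate_l _ _ _ _) (S h _ _) => r l s; lra.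
Qed.

Definition badp L (eta xi : conf n) : R := (`[< ~ perm L eta xi >])%:R.

Lemma badp_wloc L : wloc L (badp L).
Proof.
move=> eta eta' xi xi' H H'; rewrite /badp; congr (nat_of_bool _)%:R.
apply: asbool_equiv_eq; split=> N P; apply: N.
  by apply: perm_loc P; exact: agreeC.
exact: perm_loc P.
Qed.

(** Single jumps satisfy [perm], so the generator of this indicator vanishes at the starting point:
    a cell in which more than one jump is visible in [L] costs o(h). *)
Lemma near_badp L e : 0 < e -> exists2 h0, 0 < h0 & forall h eta, 0 <= h -> h < h0 ->
  S h (badp L eta) eta <= h * e.
Proof.
move=> e0; have [h0 h00 H] := generator_wloc hS hG (fun f lf => lf) (@badp_wloc L) e0.
exists h0 => // h eta hh hh0; have := H h eta hh hh0.
have B xi : perm L eta xi -> badp L eta xi = 0.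
  by move=> P; rewrite /badp; case: asboolP.
have B0 := B _ (perm_refl L eta).
rewrite gen_nn0 ?B0; last by move=> xi /(nnmove_perm L) /B ->.
by rewrite mulr0 !subr0 => /(le_trans (ler_norm _)).
Qed.

End Spread.

(** * Almost sure properties of the process *)

Section Filtration.
Context {R : realType} {T : topologicalType} {d : measure_display} {Omega : measurableType d}.
Variable X : R -> Omega -> T.
Local Notation F := (natural_filtration X).

Lemma filtrationC s A : F s A -> F s (~` A).
Proof. by move=> H; rewrite -setTD; exact: sigma_algebraCD. Qed.

Lemma filtration_bigcup s (A : nat -> set Omega) :
  (forall i, F s (A i)) -> F s (\bigcup_i A i).
Proof. exact: sigma_algebra_bigcup. Qed.

Lemma filtration_bigcap s (A : nat -> set Omega) :
  (forall i, F s (A i)) -> F s (\bigcap_i A i).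
Proof.
move=> H; rewrite -[X in F s X]setCK setC_bigcap; apply: filtrationC.
by apply: filtration_bigcup => i; apply: filtrationC.
Qed.

Lemma filtrationI s A B : F s A -> F s B -> F s (A `&` B).
Proof.
move=> FA FB; have -> : A `&` B = \bigcap_i (if i == 0%N then A else B).
  apply/seteqP; split => [w [Aw Bw] i _|w H]; first by case: ifP.
  by split; [have := H 0%N I|have := H 1%N I].
by apply: filtration_bigcap => i; case: ifP.
Qed.

Lemma filtration_open s r U : 0 <= r <= s -> open U -> F s (X r @^-1` U).
Proof. by move=> rs oU; apply: sub_sigma_algebra; exists r, U. Qed.

Lemma filtrationT s : F s setT.
Proof. by rewrite -setC0; apply: filtrationC; exact: sigma_algebra0. Qed.

Lemma filtration_mono s s' A : s <= s' -> F s A -> F s' A.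
Proof.
move=> ss'; apply: sub_sigma_algebra2 => _ [r [U [/andP[r0 rs] oU ->]]].
by exists r, U; split=> //; rewrite r0 (le_trans rs).
Qed.

Hypothesis mX : forall t U, 0 <= t -> open U -> measurable (X t @^-1` U).

Lemma filtration_measurable s A : F s A -> measurable A.
Proof.
move: A; apply: smallest_sub; first exact: sigma_algebra_measurable.
by move=> _ [r [U [/andP[r0 _] oU ->]]]; exact: mX.
Qed.

Lemma measurable_bcont (f : T -> R) t : 0 <= t -> bcont f ->
  measurable_fun setT (fun w => f (X t w)).
Proof.
move=> t0 [cf _]; apply: (measurability _ (RGenOpens.measurableE R)).
move=> _ [_ [a [b ->] <-]]; rewrite setTI.
apply: (@mX t (f @^-1` `]a, b[%classic)) => //.
by move/continuousP : cf; apply; exact: interval_open.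
Qed.

End Filtration.

Section FiniteDecomposition.
Context {R : realType} {d : measure_display} {Omega : measurableType d}.
Variable mu : {measure set Omega -> \bar R}.

Lemma measurable_finval {I : finType} (st : Omega -> I) (c : I -> R) :
  (forall i, measurable (st @^-1` [set i])) -> measurable_fun setT (fun w => c (st w)).
Proof.
move=> mst _ B mB; rewrite setTI.
have -> : (fun w => c (st w)) @^-1` B = \bigcup_(i in [set i | B (c i)]) st @^-1` [set i].
  apply/seteqP; split => [w Bw|w [i Bi /= E]]; first by exists (st w).
  by rewrite /= E.
by apply: fin_bigcup_measurable => //; exact: finite_finset.
Qed.

Lemma integral_finval {I : finType} (st : Omega -> I) (A : set Omega) (g : Omega -> \bar R) :
  (forall i, measurable (st @^-1` [set i])) -> measurable A ->
  measurable_fun setT g -> (forall w, 0 <= g w)%E ->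
  (\int[mu]_(w in A) g w = \sum_(i : I) \int[mu]_(w in A `&` st @^-1` [set i]) g w)%E.
Proof.
move=> mst mA mg g0.
have DE : \big[setU/set0]_(i <- index_enum I) (A `&` st @^-1` [set i]) = A.
  apply/seteqP; split => w.
    by rewrite -bigcup_seq => -[i _ []].
  by move=> Aw; rewrite -bigcup_seq; exists (st w) => //=; rewrite mem_index_enum.
rewrite -[in LHS]DE ge0_integral_bigsetU//.
- by move=> i; exact: measurableI.
- exact: index_enum_uniq.
- by move=> i j _ _ [w [[_ <-] [_ <-]]].
- exact: measurable_funTS.
Qed.

End FiniteDecomposition.

(** * Markov property for weights along a grid *)

Section MarkovKernel.
Context {R : realType} {n : nat} {d : measure_display} {Omega : measurableType d}.
Variables (P : probability Omega R) (S : R -> (conf n -> R) -> conf n -> R).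
Variable X : R -> Omega -> conf n.
Hypothesis hS : markov_semigroup S.
Hypothesis hX : markov_process_of P S X.
Local Notation F := (natural_filtration X).
Let mX := mp_measurable hX.

Lemma filtration_win s r L z : 0 <= r <= s -> F s ((fun w => win L (X r w)) @^-1` [set z]).
Proof.
move=> rs; apply: (@filtration_open _ _ _ _ X s r [set eta | win L eta = z] rs).
by apply: (@open_loc _ L) => eta xi H; rewrite /= (win_agree H).
Qed.

Lemma measurable_win r L z : 0 <= r -> measurable ((fun w => win L (X r w)) @^-1` [set z]).
Proof.
move=> r0; apply: (@filtration_measurable _ _ _ _ X mX r); apply: filtration_win.
by rewrite r0 lexx.
Qed.

Lemma measurable_wloc L (phi : conf n -> conf n -> R) s t : 0 <= s -> 0 <= t -> wloc L phi ->
  measurable_fun setT (fun w => phi (X s w) (X t w)).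
Proof.
move=> s0 t0 W; have -> : (fun w => phi (X s w) (X t w)) =
    (fun w => (fun zz => phi (fill zz.1) (fill zz.2)) (win L (X s w), win L (X t w))).
  by apply/funext => w /=; apply: W; apply/agreeC; exact: fill_win.
apply: (measurable_finval (st := fun w => (win L (X s w), win L (X t w)))
  (fun zz => phi (fill zz.1) (fill zz.2))) => -[z z'].
have -> : (fun w => (win L (X s w), win L (X t w))) @^-1` [set (z, z')] =
    ((fun w => win L (X s w)) @^-1` [set z]) `&` ((fun w => win L (X t w)) @^-1` [set z']).
  by apply/seteqP; split => w /=; [case=> -> ->|case=> -> ->].
by apply: measurableI; exact: measurable_win.
Qed.

Lemma ker_ge0 h phi (f : conf n -> R) L eta : 0 <= h -> wloc L phi -> bcont f ->
  (forall xi, 0 <= phi eta xi) -> (forall xi, 0 <= f xi) -> 0 <= ker S h phi f eta.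
Proof.
move=> h0 W bf p0 f0; apply: (ms_ge0 hS h0 (bcont_wloc eta W bf)) => xi.
exact: mulr_ge0.
Qed.

(** The Markov property speaks of functions of X_(s+h) alone. On each of the finitely many window
    values of X_s the weight is one fixed local function of X_(s+h), and these pieces are events
    known at time [s]. *)
Lemma markov_ker s h L phi f A : 0 <= s -> 0 <= h -> wloc L phi -> bcont f ->
  (forall eta xi, 0 <= phi eta xi) -> (forall xi, 0 <= f xi) -> F s A ->
  (\int[P]_(w in A) (phi (X s w) (X (s + h) w) * f (X (s + h) w))%:E =
   \int[P]_(w in A) (ker S h phi f (X s w))%:E)%E.
Proof.
move=> s0 h0 W bf p0 f0 FA.
have sh : 0 <= s + h by exact: addr_ge0.
have mA := filtration_measurable mX FA.
have ss : 0 <= s <= s by rewrite s0 lexx.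
rewrite (@integral_finval _ _ _ P _ (fun w => win L (X s w)) A)//; last 3 first.
- by move=> z; exact: measurable_win.
- apply/measurable_EFinP; apply: measurable_funM; first exact: measurable_wloc W.
  exact: (measurable_bcont mX sh bf).
- by move=> w; rewrite lee_fin mulr_ge0.
rewrite [RHS](@integral_finval _ _ _ P _ (fun w => win L (X s w)) A)//; last 3 first.
- by move=> z; exact: measurable_win.
- by apply/measurable_EFinP; exact: (measurable_bcont mX s0 (ker_bcont hS h0 W bf)).
- by move=> w; rewrite lee_fin; exact: ker_ge0 W bf _ _.
apply: eq_bigr => z _.
have FAz : F s (A `&` (fun w => win L (X s w)) @^-1` [set z]).
  by apply: filtrationI => //; exact: filtration_win.
have := mp_markov hX s0 h0 (bcont_wloc (fill z) W bf) FAz.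
have E w : win L (X s w) = z -> phi (X s w) = phi (fill z).
  by move=> <-; apply: (wloc_l W); apply/agreeC; exact: fill_win.
move=> H; rewrite (eq_integral (fun w => (phi (fill z) (X (s + h) w) * f (X (s + h) w))%:E)).
  rewrite H; apply: eq_integral => w; rewrite inE => -[_ /= /E Ez].
  by rewrite /ker Ez.
by move=> w; rewrite inE => -[_ /= /E ->].
Qed.

(** Induction on the number of cells, peeling off the earliest one. Once the windows at its two ends
    are fixed its weight is a constant, and the rest is the same statement one cell later; hence the
    general starting index [m] and event [A]. *)
Lemma prod_tilt (th : R) k h (j m : nat) A : 0 < th -> 0 <= h -> F (m%:R * h) A ->
  (\int[P]_(w in A)
     (\prod_(l < j) omega th k (X ((m + l)%:R * h) w) (X ((m + l).+1%:R * h) w))%:E =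
   \int[P]_(w in A) (iter j (tilt S th k h) (fun=> 1) (X (m%:R * h) w))%:E)%E.
Proof.
move=> th0 h0; have hm (i : nat) : 0 <= i%:R * h by rewrite mulr_ge0.
have W := @omega_wloc _ n th k.
have bT i : bcont (iter i (tilt S th k h) (fun=> 1)).
  by apply: iter_tilt_bcont => //; exact: bcont_cst.
have T0 i eta : 0 <= iter i (tilt S th k h) (fun=> 1) eta.
  elim: i eta => [|i IH] eta //=.
  by apply: (ker_ge0 h0 W (bT i)) => // xi; apply: ltW; exact: omega_gt0.
have mprod j' m' : measurable_fun setT (fun w => (\prod_(l < j')
    omega th k (X ((m' + l)%:R * h) w) (X ((m' + l).+1%:R * h) w))).
  by apply: measurable_prod => l _; exact: measurable_wloc W.
elim: j m A => [|j IH] m A FA.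
  by apply: eq_integral => w _; rewrite big_ord0.
have mA := filtration_measurable mX FA.
pose L := [:: k - 1; k].
have mS : (m.+1)%:R * h = m%:R * h + h by rewrite -natr1 mulrDl mul1r.
have FA' : F (m.+1%:R * h) A.
  by apply: filtration_mono FA; rewrite mS lerDl.
have -> : (\int[P]_(w in A) (iter j.+1 (tilt S th k h) (fun=> 1) (X (m%:R * h) w))%:E =
   \int[P]_(w in A) (omega th k (X (m%:R * h) w) (X (m.+1%:R * h) w) *
      iter j (tilt S th k h) (fun=> 1) (X (m.+1%:R * h) w))%:E)%E.
  rewrite mS (markov_ker (hm m) h0 W (bT j) _ (T0 j) FA)//.
  by move=> eta xi; apply: ltW; exact: omega_gt0.
pose st w := (win L (X (m%:R * h) w), win L (X (m.+1%:R * h) w)).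
have Fst z : F (m.+1%:R * h) (st @^-1` [set z]).
  have -> : st @^-1` [set z] = ((fun w => win L (X (m%:R * h) w)) @^-1` [set z.1]) `&`
       ((fun w => win L (X (m.+1%:R * h) w)) @^-1` [set z.2]).
    by case: z => z z'; apply/seteqP; split => w /=; rewrite /st; [case=> -> ->|case=> -> ->].
  apply: filtrationI; apply: filtration_win; last by rewrite hm lexx.
  by rewrite hm/= mS lerDl.
have mst z : measurable (st @^-1` [set z]) by exact: (filtration_measurable mX (Fst z)).
rewrite (@integral_finval _ _ _ P _ st A)//; last 2 first.
- exact/measurable_EFinP.
- move=> w; rewrite lee_fin prodr_ge0// => l _; apply: ltW; exact: omega_gt0.
rewrite [RHS](@integral_finval _ _ _ P _ st A)//; last 2 first.
- apply/measurable_EFinP; apply: measurable_funM; first exact: measurable_wloc W.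
  exact: (measurable_bcont mX (hm _) (bT _)).
- by move=> w; rewrite lee_fin mulr_ge0// ltW// omega_gt0.
apply: eq_bigr => z _.
have FAz : F (m.+1%:R * h) (A `&` st @^-1` [set z]) by exact: filtrationI.
have mAz := filtration_measurable mX FAz.
have E w : st w = z -> omega th k (X (m%:R * h) w) (X (m.+1%:R * h) w) =
    omega th k (fill z.1) (fill z.2).
  by move=> <-; apply: W; apply/agreeC; exact: fill_win.
set c := omega th k (fill z.1) (fill z.2) in E.
have c0 : 0 <= c by apply: ltW; exact: omega_gt0.
transitivity (c%:E * \int[P]_(w in A `&` st @^-1` [set z]) (\prod_(l < j)
    omega th k (X ((m.+1 + l)%:R * h) w) (X ((m.+1 + l).+1%:R * h) w))%:E)%E.
  rewrite -ge0_integralZl//; last 2 first.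
  - by apply: measurable_funTS; exact/measurable_EFinP.
  - by move=> w _; rewrite lee_fin prodr_ge0// => l _; apply: ltW; exact: omega_gt0.
  apply: eq_integral => w; rewrite inE => -[_ /= /E Ez].
  rewrite -EFinM big_ord_recl addn0 Ez; congr (_ * _)%:E.
  by apply: eq_bigr => l _; rewrite lift0 addnS addSn.
rewrite IH// -ge0_integralZl//; last 2 first.
- by apply: measurable_funTS; apply/measurable_EFinP; exact: (measurable_bcont mX (hm _) (bT _)).
- by move=> w _; rewrite lee_fin.
by apply: eq_integral => w; rewrite inE => -[_ /= /E ->]; rewrite EFinM.
Qed.

End MarkovKernel.

(** * Events detected on fine grids *)

Section LimInfSets.
Context {R : realType} {d : measure_display} {Omega : measurableType d}.
Variable P : probability Omega R.

Definition liminf_set (C : nat -> set Omega) : set Omega :=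
  \bigcup_M \bigcap_(N in [set N | (M <= N)%N]) C N.

Lemma measurable_liminf_set C : (forall N, measurable (C N)) -> measurable (liminf_set C).
Proof.
move=> mC; apply: bigcupT_measurable => M; exact: bigcap_measurableType.
Qed.

(** Fatou's lemma for events: the intersections from rank M on increase to the lower limit, and each
    is contained in [C M]. *)
Lemma liminf_set_le C (b : R) : (forall N, measurable (C N)) ->
  (\forall N \near \oo, P (C N) <= b%:E)%E -> (P (liminf_set C) <= b%:E)%E.
Proof.
move=> mC Cb; pose G M := \bigcap_(N in [set N | (M <= N)%N]) C N.
have mG M : measurable (G M) by exact: bigcap_measurableType.
have ndG : nondecreasing_seq G.
  move=> M M' MM'; apply/subsetPset => w H N /= MN; apply: H => /=.
  exact: leq_trans MN.
have H : (P \o G) M @[M --> \oo] --> P (liminf_set C).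
  exact: nondecreasing_cvg_mu mG (bigcupT_measurable _ mG) ndG.
rewrite -(cvg_lim _ H)//; apply: lime_le; first by apply/cvg_ex; exists (P (liminf_set C)).
near=> M; apply: (@le_trans _ _ (P (C M))); last by near: M.
by apply: le_measure; rewrite ?inE//; move=> w; apply => /=.
Unshelve. all: by end_near.
Qed.

Lemma measure_ord_le (D : nat -> set Omega) (N : nat) (c : R) :
  (forall m, measurable (D m)) -> (forall m, (m < N)%N -> (P (D m) <= c%:E)%E) ->
  (P (\big[setU/set0]_(m < N) D m) <= (N%:R * c)%:E)%E.
Proof.
move=> mD; elim: N => [|N IH] H; first by rewrite big_ord0 measure0 mul0r.
rewrite big_ord_recr /= -natr1 mulrDl mul1r EFinD.
have mB : measurable (\big[setU/set0]_(m < N) D m) by exact: bigsetU_measurable.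
apply: le_trans (measureU2 P mB (mD N)) _; apply: leeD; last exact: H.
by apply: IH => m mN; apply: H; rewrite ltnW.
Qed.

End LimInfSets.

Section AlmostSure.
Context {R : realType} (q : R) (n : nat) (hq : 0 < q < 1).
Context {d : measure_display} {Omega : measurableType d}.
Variables (P : probability Omega R) (S : R -> (conf n -> R) -> conf n -> R).
Variable X : R -> Omega -> conf n.
Hypothesis hS : markov_semigroup S.
Hypothesis hG : has_generator S (@local_fun R n) (@asep_gen R q n).
Hypothesis hX : markov_process_of P S X.
Local Notation F := (natural_filtration X).
Let mX := mp_measurable hX.

Definition step_set (b : conf n -> conf n -> bool) (A : set Omega) (t : R) (N m : nat) : set Omega :=
  A `&` [set w | b (X (m%:R * (t / N%:R)) w) (X (m.+1%:R * (t / N%:R)) w)].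

Definition grid_set b A t N : set Omega := \big[setU/set0]_(m < N) step_set b A t N m.

Definition indp (b : conf n -> conf n -> bool) eta xi : R := (b eta xi)%:R.

Lemma step_set_measurable b L A t N m : 0 <= t -> wloc L (indp b) -> measurable A ->
  measurable (step_set b A t N m).
Proof.
move=> t0 W mA; apply: measurableI => //.
have hm (i : nat) : 0 <= i%:R * (t / N%:R) by rewrite mulr_ge0// divr_ge0.
have := measurable_wloc hX (hm m) (hm m.+1) W measurableT (measurable_set1 1).
rewrite setTI; congr (measurable _); apply/seteqP; split => w; rewrite /= /indp.
  by case: (b _ _) => // /eqP; rewrite eq_sym oner_eq0.
by move=> ->.
Qed.

Lemma step_set_prob b L A t N m : 0 <= t -> wloc L (indp b) ->
  F (m%:R * (t / N%:R)) A ->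
  P (step_set b A t N m) =
   (\int[P]_(w in A) (S (t / N%:R) (indp b (X (m%:R * (t / N%:R)) w)) (X (m%:R * (t / N%:R)) w))%:E)%E.
Proof.
move=> t0 W FA; have h0 : 0 <= t / N%:R by rewrite divr_ge0.
have hm : 0 <= m%:R * (t / N%:R) by rewrite mulr_ge0.
have mA := filtration_measurable mX FA.
have := markov_ker hS hX hm h0 W (bcont_cst 1) _ (fun=> ler01) FA.
move=> /(_ (fun eta xi => ler0n _ _)) H.
have -> : (\int[P]_(w in A) (S (t / N%:R) (indp b (X (m%:R * (t / N%:R)) w)) (X (m%:R * (t / N%:R)) w))%:E)%E
  = (\int[P]_(w in A) (ker S (t / N%:R) (indp b) (fun=> 1) (X (m%:R * (t / N%:R)) w))%:E)%E.
  apply: eq_integral => w _; rewrite /ker; congr (S _ _ _)%:E.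
  by apply/funext => xi; rewrite mulr1.
rewrite -H.
have E : m%:R * (t / N%:R) + t / N%:R = m.+1%:R * (t / N%:R) by rewrite -natr1 mulrDl mul1r.
pose B := [set w | b (X (m%:R * (t / N%:R)) w) (X (m.+1%:R * (t / N%:R)) w)].
have mB : measurable B.
  by rewrite -[B]setTI; exact: (step_set_measurable N m t0 W measurableT).
rewrite /step_set -/B setIC -integral_indic//; apply: eq_integral => w _.
rewrite E mulr1 indicE /indp; congr ((nat_of_bool _)%:R)%:E.
by apply/idP/idP; rewrite inE.
Qed.

(* Along a fine grid every jump shows up as the transition of a single cell, so
   a transition of the path of type [b] puts [w] in [grid_set b A t N] for all
   large [N]. *)
Lemma transition_le b L A t (c : R) : 0 <= t -> wloc L (indp b) -> F 0 A ->
  (forall e, 0 < e -> exists2 h0, 0 < h0 & forall h s, 0 <= h -> h < h0 -> 0 <= s <= t ->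
    (\int[P]_(w in A) (S h (indp b (X s w)) (X s w))%:E <= (h * (c + e))%:E)%E) ->
  exists E, [/\ measurable E, (P E <= (t * c)%:E)%E & forall w, A w ->
    (exists s zeta, [/\ 0 < s <= t, X r w @[r --> s^'-] --> zeta & b zeta (X s w)]) -> E w].
Proof.
move=> t0 W FA H; exists (liminf_set (grid_set b A t)).
have mA := filtration_measurable mX FA.
have mG N : measurable (grid_set b A t N).
  by apply: bigsetU_measurable => m _; exact: step_set_measurable W mA.
split; first exact: measurable_liminf_set.
- apply/lee_addgt0Pr => e e0.
  have t1 : 0 < t + 1 by rewrite ltr_wpDl.
  (* The [N] cells of length [t / N] accumulate t e / (t + 1), which is at most [e], also for
     [t = 0]. *)
  have [h0 h00 Hh] := H (e / (t + 1)) (divr_gt0 e0 t1).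
  have -> : ((t * c)%:E + e%:E = (t * c + e)%:E)%E by rewrite EFinD.
  apply: liminf_set_le => //; near=> N.
  have [N0 N1] : (0 < N)%N /\ t / N%:R < h0 by near: N; exact: near_mesh.
  have hh : 0 <= t / N%:R by rewrite divr_ge0.
  apply: (@le_trans _ _ (N%:R * (t / N%:R * (c + e / (t + 1))))%:E).
    apply: measure_ord_le => [m|m mN]; first exact: step_set_measurable W mA.
    have hm : 0 <= m%:R * (t / N%:R) by rewrite mulr_ge0.
    rewrite (step_set_prob t0 W); last exact: filtration_mono FA.
    apply: Hh => //; rewrite hm/= mulrCA ler_piMr// ler_pdivrMr ?ltr0n// mul1r ler_nat.
    exact: ltnW.
  rewrite lee_fin mulrA (mulrC N%:R) divfK ?pnatr_eq0 -?lt0n// mulrDr lerD2l.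
  rewrite mulrCA; apply: ler_piMr; first exact: ltW.
  by rewrite ler_pdivrMr// mul1r lerDl.
- move=> w Aw [s [zeta [st Hz bs]]].
  have BL eta eta' xi xi' : agree L eta eta' -> agree L xi xi' -> b eta xi -> b eta' xi'.
    move=> A1 A2; have := W _ _ _ _ A1 A2; rewrite /indp.
    by case: (b eta xi) => //; case: (b eta' xi') => // /eqP; rewrite oner_eq0.
  have [M _ HM] := grid_detect (mp_cadlag hX w) BL st Hz bs.
  exists M => // N /= MN; have [m mN bm] := HM N MN.
  by rewrite /grid_set -bigcup_mkord; exists m => //; split.
Unshelve. all: by end_near.
Qed.

(** By [near_badp] transitions that no single jump explains have rate 0, and [transition_le] with
    [c = 0] makes their occurrence a null event. *)
Lemma ae_perm L t : 0 <= t ->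
  {ae P, forall w, forall s zeta, 0 < s <= t -> X r w @[r --> s^'-] --> zeta ->
     perm L zeta (X s w)}.
Proof.
move=> t0; pose b (eta xi : conf n) := `[< ~ perm L eta xi >].
have W : wloc L (indp b) by exact: badp_wloc.
have [E [mE PE HE]] : exists E, [/\ measurable E, (P E <= (t * 0)%:E)%E & forall w, setT w ->
    (exists s zeta, [/\ 0 < s <= t, X r w @[r --> s^'-] --> zeta & b zeta (X s w)]) -> E w].
  apply: (transition_le t0 W); first exact: filtrationT.
  move=> e e0; have [h0 h00 Hh] := near_badp hS hG L e0; exists h0 => // h s hh hh0 /andP[s0 _].
  apply: (@le_trans _ _ (\int[P]_(w in setT) (cst (h * e)%:E) w)%E).
    apply: ge0_le_integral => //.
    - move=> w _; rewrite lee_fin; apply: (ms_ge0 hS hh (loc_bcont (wloc_r _ W))) => xi.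
      exact: ler0n.
    - apply: measurable_funTS; apply/measurable_EFinP.
      have := measurable_bcont mX s0 (ker_bcont hS hh W (bcont_cst 1)).
      congr measurable_fun; apply/funext => w; rewrite /ker; congr (S _ _ _).
      by apply/funext => xi; rewrite mulr1.
    - by move=> w _; rewrite lee_fin; exact: Hh.
  rewrite integral_cst// add0r -[leRHS]mule1; apply: lee_wpmul2l; last exact: probability_le1.
  by rewrite lee_fin mulr_ge0// ltW.
exists E; split=> //.
  by apply/eqP; rewrite eq_le measure_ge0 andbT; move: PE; rewrite mulr0.
move=> w /= nH; apply: HE => //; apply: contrapT => N; apply: nH => s zeta st Hz.
apply: contrapT => np; apply: N; exists s, zeta; split=> //.
exact/asboolP.
Qed.

Lemma ae_legit : {ae P, forall w, legit (X ^~ w)}.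
Proof.
have : {ae P, forall w, forall (l T : nat) s zeta, 0 < s <= T%:R ->
    X r w @[r --> s^'-] --> zeta ->
    perm [seq (i%:Z - l%:Z) | i <- iota 0 (l + l).+1] zeta (X s w)}.
  (* Countably many windows and time horizons suffice, so one null set serves all. *)
  by apply: ae_foralln => l; apply: ae_foralln => T; exact: ae_perm.
apply: filterS => w H s zeta s0 Hz; apply: perm_nnmove => l.
have [T sT] : exists T : nat, s <= T%:R.
  by exists (Num.truncn s).+1; apply: ltW; exact: truncnS_gt.
by apply: (H l T) => //; rewrite s0.
Qed.

Definition vacant (K : nat) : set Omega :=
  [set w | forall k : int, K%:Z <= k -> occ (X 0 w) k = 0%N].

Lemma filtration_vacant K : F 0 (vacant K).
Proof.
have -> : vacant K = \bigcap_p (X 0 @^-1` [set eta | occ eta (K%:Z + p%:Z) = 0%N]).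
  apply/seteqP; split => w H.
    by move=> p _; apply: H; clear; lia.
  move=> k Kk; have := H (absz (k - K%:Z)) I => /=.
  by have -> : K%:Z + (absz (k - K%:Z))%:Z = k by clear -Kk; lia.
apply: filtration_bigcap => p; apply: filtration_open; first by rewrite lexx.
apply: (@open_loc _ [:: K%:Z + p%:Z]) => eta xi H; rewrite /= (agree_occ H)// inE.
exact: eqxx.
Qed.

(** The bond joins [K + p] and [K + p + 1], both at least [p] sites into the initially empty region.
    Its crossing rate is bounded by the occupations of its ends, whose expectations [occ_spread]
    bounds up to time [T]; [transition_le] integrates the rate. *)
Lemma crossing_le (T K p : nat) :
  exists E, [/\ measurable E,
   (P E <= (T%:R * (2 * rmax q n * (n%:R * ((2 * rmax q n * T%:R) ^+ p / p`!%:R))))%:E)%E &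
   forall w, vacant K w ->
    (exists s zeta, [/\ 0 < s <= T%:R, X r w @[r --> s^'-] --> zeta &
       delta (K%:Z + p%:Z + 1) zeta (X s w) != 0]) -> E w].
Proof.
pose m : int := K%:Z + p%:Z + 1.
have t0 : 0 <= T%:R :> R by [].
have C0 := rmax_ge0 n hq.
set c := 2 * rmax q n * (n%:R * ((2 * rmax q n * T%:R) ^+ p / p`!%:R)).
have W : wloc [:: m - 1; m] (indp (fun eta xi : conf n => delta m eta xi != 0)).
  exact: crossed_wloc.
apply: (transition_le t0 W); first exact: filtration_vacant.
move=> e e0; have [h0 h00 Hh] := near_crossed hq hS hG m e0; exists h0 => // h s hh hh0 /andP[s0 sT].
have mV := filtration_measurable mX (filtration_vacant K).
have bf : bcont (fun eta : conf n => rmax q n * (occR (m - 1) eta + occR m eta) + e : R).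
  by apply: bcont_lin; [apply: bcontD; exact: occR_bcont|exact: bcont_cst].
have f0 eta : 0 <= rmax q n * (occR (m - 1) eta + occR m eta) + e :> R.
  by apply: addr_ge0 (ltW e0); apply: mulr_ge0 => //; apply: addr_ge0; exact: ler0n.
apply: (@le_trans _ _ (\int[P]_(w in vacant K)
   (h%:E * (rmax q n * (occR (m - 1) (X s w) + occR m (X s w)) + e)%:E))%E).
  apply: ge0_le_integral => //.
  - move=> w _; rewrite lee_fin; apply: (ms_ge0 hS hh (loc_bcont (wloc_r _ W))) => xi.
    exact: ler0n.
  - apply: measurable_funTS; apply/measurable_EFinP.
    have := measurable_bcont mX s0 (ker_bcont hS hh W (bcont_cst 1)).
    congr measurable_fun; apply/funext => w; rewrite /ker; congr (S _ _ _).
    by apply/funext => xi; rewrite mulr1.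
  - apply: measurable_funTS; apply/measurable_EFinP; apply: measurable_funM => //.
    exact: (measurable_bcont mX s0 bf).
  - by move=> w _; rewrite -EFinM lee_fin; exact: Hh.
rewrite ge0_integralZl//; last 2 first.
- by apply: measurable_funTS; apply/measurable_EFinP; exact: (measurable_bcont mX s0 bf).
- by move=> w _; rewrite lee_fin.
rewrite EFinM lee_wpmul2l ?lee_fin//.
(* The Markov property at time 0 turns the expectation at time [s] into [S s] evaluated at the
   initial configuration, where vacancy can be used. *)
have := mp_markov hX (lexx 0) s0 bf (filtration_vacant K); rewrite add0r => ->.
apply: (@le_trans _ _ (\int[P]_(w in vacant K) (cst (c + e)%:E) w)%E).
  apply: ge0_le_integral => //.
  - by move=> w _; rewrite lee_fin; exact: ms_ge0.
  - apply: measurable_funTS; apply/measurable_EFinP.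
    exact: (measurable_bcont mX (lexx 0) (ms_bcont hS s0 bf)).
  - move=> w Vw; rewrite lee_fin.
    have b1 := @occR_bcont R n (m - 1); have b2 := @occR_bcont R n m.
    rewrite (ms_linear hS (rmax q n) s0 (bcontD b1 b2) (bcont_cst e)).
    rewrite (sgD hS s0 b1 b2) (sgC hS _ s0) lerD2r /c.
    have B k : K%:Z + p%:Z <= k -> S s (occR k) (X 0 w) <=
        n%:R * ((2 * rmax q n * T%:R) ^+ p / p`!%:R).
      move=> Kk; apply: le_trans (occ_spread hq hS hG s0 Vw Kk) _.
      apply: ler_wpM2l => //; apply: ler_wpM2r; first by rewrite invr_ge0.
      have r2 : 0 <= 2 * rmax q n by exact: mulr_ge0.
      apply: lerXn2r; rewrite ?nnegrE; [exact: mulr_ge0|exact: mulr_ge0|].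
      exact: ler_wpM2l.
    have B1 : S s (occR (m - 1)) (X 0 w) <= n%:R * ((2 * rmax q n * T%:R) ^+ p / p`!%:R).
      by apply: B; rewrite /m addrK.
    have B2 : S s (occR m) (X 0 w) <= n%:R * ((2 * rmax q n * T%:R) ^+ p / p`!%:R).
      by apply: B; rewrite /m; clear; lia.
    have := ler_wpM2l C0 (lerD B1 B2); move: (n%:R * (_ / _)) => v; lra.
rewrite integral_cst// -[leRHS]mule1; apply: lee_wpmul2l; last exact: probability_le1.
rewrite lee_fin; apply: addr_ge0 (ltW e0); apply: mulr_ge0; first exact: mulr_ge0.
apply: mulr_ge0 => //; apply: mulr_ge0; last by rewrite invr_ge0.
by apply: exprn_ge0; apply: mulr_ge0 => //; exact: mulr_ge0.
Qed.

(** If all bonds from rank [M] on were crossed, [w] would lie in every [E p] with [p >= M], and the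
    probabilities of these events tend to 0 like c^p / p!. *)
Lemma ae_no_escape : {ae P, forall w, forall K T M : nat, vacant K w ->
  exists2 p, (M <= p)%N & forall s zeta, 0 < s <= T%:R -> X r w @[r --> s^'-] --> zeta ->
     delta (K%:Z + p%:Z + 1) zeta (X s w) = 0}.
Proof.
apply: ae_foralln => K; apply: ae_foralln => T; apply: ae_foralln => M.
have [E HE] := choice (crossing_le T K).
pose b (p : nat) : R := T%:R * (2 * rmax q n * (n%:R * ((2 * rmax q n * T%:R) ^+ p / p`!%:R))).
pose G := \bigcap_(p in [set p | (M <= p)%N]) E p.
have mE p : measurable (E p) by have [] := HE p.
have mG : measurable G by exact: bigcap_measurableType.
exists G; split=> //.
  apply/eqP; rewrite eq_le measure_ge0 andbT.
  have bl : b p @[p --> \oo] --> (0 : R).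
    rewrite -(mulr0 T%:R); apply: cvgMr; rewrite -(mulr0 (2 * rmax q n)); apply: cvgMr.
    by rewrite -(mulr0 n%:R); apply: cvgMr; exact: cvg_exprn_fact.
  apply/lee_addgt0Pr => e e0; rewrite add0e.
  have /cvgr_lt/(_ e e0) be : b p @[p --> \oo] --> (0 : R) by [].
  near (\oo : set_system nat) => p.
  have bpe : b p < e by near: p.
  have Mp : (M <= p)%N by near: p; exact: nbhs_infty_ge.
  have [_ PE _] := HE p.
  apply: (@le_trans _ _ (P (E p))).
    by apply: le_measure; rewrite ?inE//; move=> w; apply.
  by apply: le_trans PE _; rewrite lee_fin; exact: ltW.
move=> w /= nH p /= Mp; have [_ _ HEp] := HE p.
have Vw : vacant K w by apply: contrapT => nV; apply: nH.
apply: HEp => //; apply: contrapT => N; apply: nH => _; exists p => // s zeta st Hz.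
by apply/eqP/negPn/negP => dn; apply: N; exists s, zeta.
Unshelve. all: by end_near.
Qed.

End AlmostSure.

(** * From the grid to the current *)

Section UniformIntegrability.
Import HBNNSimple.
Context {R : realType} {d : measure_display} {Omega : measurableType d}.
Variable P : probability Omega R.

(* [f] is not assumed measurable: the current is a limit of measurable functions
   only off a null set. *)
Lemma integral_mask (Z : set Omega) (f : Omega -> R) : measurable Z -> P Z = 0%E ->
  (forall w, 0 <= f w) ->
  (\int[P]_w (f w)%:E = \int[P]_w (f w * \1_(~` Z) w)%:E)%E.
Proof.
move=> mZ PZ f0; have mZC : measurable (~` Z) by exact: measurableC.
have g0 w : (0 <= (f w * \1_(~` Z) w)%:E)%E by rewrite lee_fin mulr_ge0.
have f0' w : (0 <= (f w)%:E)%E by rewrite lee_fin.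
rewrite !ge0_integralTE//; apply/eqP; rewrite eq_le; apply/andP; split.
  apply: ub_ereal_sup => _ [h hf <-].
  have -> : sintegral P h = sintegral P (proj_nnsfun h mZC).
    rewrite -!integralT_nnsfun; apply: ae_eq_integral => //.
    - by apply/measurable_EFinP.
    - by apply/measurable_EFinP.
    exists Z; split=> //= w nE; apply: contrapT => nZ; apply: nE => _.
    have E : h w = h w * \1_(~` Z) w by rewrite indicE mem_set// mulr1.
    by rewrite [LHS](congr1 EFin E).
  apply: ereal_sup_ubound; exists (proj_nnsfun h mZC) => // w.
  rewrite lee_fin /=; apply: ler_wpM2r => //.
  by have := hf w; rewrite lee_fin.
apply: ub_ereal_sup => _ [h hg <-]; apply: ereal_sup_ubound; exists h => // w.
apply: le_trans (hg w) _; rewrite lee_fin ler_piMr// indicE.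
Qed.

(** Bounded second moments give uniform integrability through x <= min(x, K) + x^2 / K for x >= 0.
    The truncated integrals converge in N by dominated convergence, the error C / K is uniform in N,
    and K is sent to infinity by monotone convergence. *)
Lemma expectation_cvg (Y : nat -> Omega -> R) (y : Omega -> R) (Z : set Omega) (C : R)
    (a : nat -> R) :
  (forall N, measurable_fun setT (Y N)) -> (forall N w, 0 <= Y N w) -> (forall w, 0 <= y w) ->
  measurable Z -> P Z = 0%E -> (forall w, ~ Z w -> Y N w @[N --> \oo] --> y w) ->
  (\forall N \near \oo, (\int[P]_w (Y N w ^+ 2)%:E <= C%:E)%E) ->
  (forall N, (\int[P]_w (Y N w)%:E = (a N)%:E)%E) ->
  exists L : R, (\int[P]_w (y w)%:E = L%:E)%E /\ a N @[N --> \oo] --> L.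
Proof.
move=> mY Y0 y0 mZ PZ YZ Y2 Ya.
(* Put to 0 on the exceptional set, the sequence converges everywhere, which makes its limit [y']
   measurable. *)
pose Y' N w := Y N w * \1_(~` Z) w; pose y' w := y w * \1_(~` Z) w.
have mI : measurable_fun setT (\1_(~` Z) : Omega -> R).
  by apply: measurable_indic; exact: measurableC.
have i0 w : 0 <= (\1_(~` Z) w : R) by [].
have mY' N : measurable_fun setT (Y' N) by exact: measurable_funM.
have Y'0 N w : 0 <= Y' N w by exact: mulr_ge0.
have y'0 w : 0 <= y' w by exact: mulr_ge0.
have Y'y w : Y' N w @[N --> \oo] --> y' w.
  rewrite /Y' /y' indicE; have [Zw|nZ] := pselect (Z w).
    rewrite memNset; last by move=> /=; apply.
    by rewrite mulr0; under eq_fun do rewrite mulr0; exact: cvg_cst.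
  by apply: cvgMl; exact: YZ.
have my' : measurable_fun setT y'.
  by apply: (measurable_fun_cvg (h := Y')) => // w _; exact: Y'y.
have Y'a N : (\int[P]_w (Y' N w)%:E = (a N)%:E)%E by rewrite -integral_mask.
have Y'2 : \forall N \near \oo, (\int[P]_w (Y' N w ^+ 2)%:E <= C%:E)%E.
  apply: filterS Y2 => N; apply: le_trans; apply: ge0_le_integral => //.
  - by move=> w _; rewrite lee_fin exprn_ge0.
  - by apply/measurable_EFinP; exact: measurable_funX.
  - by apply/measurable_EFinP; exact: measurable_funX.
  - move=> w _; rewrite lee_fin; apply: lerXn2r; rewrite ?nnegrE//.
    by rewrite ler_piMr// indicE; case: (_ \in _).
pose m (K : nat) (x : R) := Num.min x K%:R.
have m0 K x : 0 <= x -> 0 <= m K x by move=> x0; rewrite le_min x0 ler0n.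
have mle K x : m K x <= x by rewrite ge_min lexx.
have mK K x : m K x <= K%:R by rewrite ge_min lexx orbT.
have mm K (f : Omega -> R) : measurable_fun setT f -> measurable_fun setT (fun w => m K (f w)).
  move=> mf; have mc : measurable_fun setT (cst (K%:R : R) : Omega -> R).
    exact: measurable_cst.
  exact (measurable_minr mf mc).
have mI1 K (f : Omega -> R) : measurable_fun setT f -> (forall w, 0 <= f w) ->
    (\int[P]_w (m K (f w))%:E <= K%:R%:E)%E.
  move=> mf f0; apply: (@le_trans _ _ (\int[P]_w (cst K%:R%:E) w)%E).
    apply: ge0_le_integral => //.
    - by move=> w _; rewrite lee_fin; exact: m0.
    - by apply/measurable_EFinP; exact: mm.
    - by move=> w _; rewrite lee_fin.
  rewrite integral_cst// -[leRHS]mule1; apply: lee_wpmul2l; last exact: probability_le1.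
  by rewrite lee_fin.
have mI0 K (f : Omega -> R) : (forall w, 0 <= f w) -> (0 <= \int[P]_w (m K (f w))%:E)%E.
  by move=> f0; apply: integral_ge0 => w _; rewrite lee_fin; exact: m0.
pose aK K N := fine (\int[P]_w (m K (Y' N w))%:E)%E.
pose b K := fine (\int[P]_w (m K (y' w))%:E)%E.
have aKE K N : (\int[P]_w (m K (Y' N w))%:E = (aK K N)%:E)%E.
  by rewrite /aK fineK// ge0_fin_numE; [exact: le_lt_trans (mI1 K _ (mY' N) (Y'0 N)) (ltry _)|exact: mI0].
have bE K : (\int[P]_w (m K (y' w))%:E = (b K)%:E)%E.
  by rewrite /b fineK// ge0_fin_numE; [exact: le_lt_trans (mI1 K _ my' y'0) (ltry _)|exact: mI0].
have cvm K (u : nat -> R) l : u N @[N --> \oo] --> l -> m K (u N) @[N --> \oo] --> m K l.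
  move=> ul; apply/cvgrPdist_lt => e e0; move/cvgrPdist_lt : ul => /(_ e e0).
  apply: filterS => N; apply: le_lt_trans; rewrite /m.
  by case: (leP l) => ?; case: (leP (u N)) => ?; rewrite ler_norml; apply/andP; split;
    have := ler_norm (l - u N); have := ler_norm (u N - l); rewrite (distrC (u N)); lra.
have aKb K : aK K N @[N --> \oo] --> b K.
  have c1 : {ae P, forall w, setT w -> (m K (Y' N w))%:E @[N --> \oo] --> (m K (y' w))%:E}.
    apply: aeW => w _; apply: cvg_EFin; first exact: nearW.
    exact: (cvm K _ _ (Y'y w)).
  have c2 : P.-integrable setT (cst K%:R%:E) by exact: finite_measure_integrable_cst.
  have c3 : {ae P, forall w, forall N, setT w -> (`|(m K (Y' N w))%:E| <= cst K%:R%:E w)%E}.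
    apply: aeW => w N _; rewrite lee_fin ger0_norm; [exact: mK|exact: m0].
  have c4 N : measurable_fun setT (fun w => (m K (Y' N w))%:E).
    by apply/measurable_EFinP; exact: mm.
  have c5 : measurable_fun setT (fun w => (m K (y' w))%:E).
    by apply/measurable_EFinP; exact: mm.
  have [_ _] := dominated_convergence measurableT c4 c5 c1 c2 c3.
  rewrite bE => /fine_cvgP[_]; apply: cvg_trans; apply: near_eq_cvg; apply: nearW => N.
  by rewrite /= aKE.
have aKa K N : aK K N <= a N.
  rewrite -lee_fin -aKE -Y'a; apply: ge0_le_integral => //.
  - by move=> w _; rewrite lee_fin; exact: m0.
  - by apply/measurable_EFinP; exact: mm.
  - by apply/measurable_EFinP.
  - by move=> w _; rewrite lee_fin.
have aaK K : (0 < K)%N -> \forall N \near \oo, a N <= aK K N + C / K%:R.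
  move=> K0; apply: filterS Y'2 => N YN; have K0' : 0 < K%:R :> R by rewrite ltr0n.
  have m2 : measurable_fun setT (fun w => (Y' N w ^+ 2)%:E).
    by apply/measurable_EFinP; exact: measurable_funX.
  have m3 : measurable_fun setT (fun w => ((K%:R^-1)%:E * (Y' N w ^+ 2)%:E)%E).
    exact: measurable_funeM.
  have m4 : measurable_fun setT (fun w => (m K (Y' N w))%:E).
    by apply/measurable_EFinP; exact: mm.
  rewrite -lee_fin -Y'a EFinD -aKE.
  apply: (@le_trans _ _ (\int[P]_w ((m K (Y' N w))%:E + (K%:R^-1)%:E * (Y' N w ^+ 2)%:E))%E).
    apply: ge0_le_integral => //.
    - by move=> w _; rewrite lee_fin.
    - by apply/measurable_EFinP.
    - exact: emeasurable_funD.
    - move=> w _; rewrite -EFinM -EFinD lee_fin /m; have [YK|KY] := leP (Y' N w) K%:R.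
        by rewrite lerDl mulr_ge0// exprn_ge0.
      apply: ler_wpDl => //; rewrite mulrC ler_pdivlMr// expr2.
      by rewrite ler_wpM2l// ltW.
  rewrite ge0_integralD//; last 2 first.
  - by move=> w _; rewrite lee_fin; exact: m0.
  - by move=> w _; rewrite -EFinM lee_fin mulr_ge0// exprn_ge0.
  apply: leeD => //; rewrite ge0_integralZl//; last first.
    by move=> w _; rewrite lee_fin exprn_ge0.
  by rewrite mulrC EFinM; apply: lee_wpmul2l.
have C0 : 0 <= C.
  near (\oo : set_system nat) => N.
  have : (\int[P]_w (Y' N w ^+ 2)%:E <= C%:E)%E by near: N.
  rewrite -lee_fin; apply: le_trans; apply: integral_ge0 => w _.
  by rewrite lee_fin exprn_ge0.
have bC K : b K <= 1 + C.
  apply: (ler_cvg_to (aKb K) (cvg_cst _)).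
  apply: filterS (aaK 1%N isT) => N; rewrite divr1 => H.
  apply: le_trans (aKa K N) _; apply: le_trans H _; rewrite lerD2r.
  by rewrite -lee_fin -aKE; exact: mI1.
have limb : (b K)%:E @[K --> \oo] --> (\int[P]_w (y' w)%:E)%E.
  have c1 K : measurable_fun setT (fun w => (m K (y' w))%:E).
    by apply/measurable_EFinP; exact: mm.
  have c2 K w : setT w -> (0 <= (m K (y' w))%:E)%E by move=> _; rewrite lee_fin; exact: m0.
  have c3 w : setT w -> {homo (fun K => (m K (y' w))%:E) : K K' / (K <= K')%N >-> (K <= K')%E}.
    move=> _ K K' KK'; rewrite lee_fin /m le_min ge_min lexx /= ge_min.
    by rewrite ler_nat KK' orbT.
  have H := cvg_monotone_convergence measurableT c1 c2 c3 (mu := P).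
  have E : (\int[P]_w limn (fun K => (m K (y' w))%:E) = \int[P]_w (y' w)%:E)%E.
    apply: eq_integral => w _; apply/cvg_lim => //; apply: cvg_near_cst; near=> K.
    by rewrite /m min_l//; apply: ltW; near: K; exact: nbhs_infty_gtr.
  by move: H; rewrite E; under eq_fun do rewrite bE.
have yfin : (\int[P]_w (y' w)%:E)%E \is a fin_num.
  rewrite ge0_fin_numE; last by apply: integral_ge0 => w _; rewrite lee_fin.
  apply: (@le_lt_trans _ _ (1 + C)%:E); last exact: ltry.
  rewrite -(cvg_lim _ limb)//; apply: lime_le; first by apply/cvg_ex; eexists; exact: limb.
  by apply: nearW => K; rewrite lee_fin.
exists (fine (\int[P]_w (y' w)%:E)%E); split.
  by rewrite fineK//; exact: integral_mask.
set L := fine _; have bL : b K @[K --> \oo] --> L.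
  by move: limb; rewrite -(fineK yfin) => /fine_cvgP[_]; apply.
apply/cvgrPdist_le => e e0; pose e3 := e / 3; have e30 : 0 < e3 by rewrite divr_gt0.
near (\oo : set_system nat) => K.
have K0 : (0 < K)%N by near: K; exact: nbhs_infty_gt.
have LK : `|L - b K| <= e3 by near: K; move/cvgrPdist_le : bL; apply.
have CK : C / K%:R <= e3.
  have [_ H] : (0 < K)%N /\ C / K%:R < e3 by near: K; exact: near_mesh.
  exact: ltW.
near=> N.
have H1 : a N <= aK K N + C / K%:R by near: N; exact: aaK.
have H2 : `|b K - aK K N| <= e3 by near: N; move/cvgrPdist_le : (aKb K); apply.
have H3 := aKa K N.
have ed : e = e3 + e3 + e3 by rewrite /e3; field.
rewrite ed; move: LK H2; rewrite !ler_norml => /andP[? ?] /andP[? ?].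
by apply/andP; split; lra.
Unshelve. all: by end_near.
Qed.

End UniformIntegrability.

Section CurrentMoment.
Context {R : realType} (q : R) (n : nat) (hq : 0 < q < 1).
Context {d : measure_display} {Omega : measurableType d}.
Variables (P : probability Omega R) (S : R -> (conf n -> R) -> conf n -> R).
Variable X : R -> Omega -> conf n.
Hypothesis hS : markov_semigroup S.
Hypothesis hG : has_generator S (@local_fun R n) (@asep_gen R q n).
Hypothesis hX : markov_process_of P S X.
Let mX := mp_measurable hX.

Definition grid_weight (th : R) k t N w : R :=
  \prod_(l < N) omega th k (X (l%:R * (t / N%:R)) w) (X (l.+1%:R * (t / N%:R)) w).

Lemma grid_weight_gt0 th k t N w : 0 < th -> 0 < grid_weight th k t N w.
Proof. by move=> th0; apply: prodr_gt0 => l _; exact: omega_gt0. Qed.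

Lemma grid_weightE th k t N w : 0 < th -> 0 <= t -> (0 < N)%N ->
  grid_weight th k t N w = th ^ grid_count (X ^~ w) k t t N.
Proof.
move=> th0 t0 N0; rewrite /grid_weight /grid_count.
have E (m : nat) : (m <= N)%N -> Num.min (m%:R * (t / N%:R)) t = m%:R * (t / N%:R).
  move=> mN; rewrite min_l// mulrCA ler_piMr// ler_pdivrMr ?ltr0n// mul1r ler_nat//.
rewrite (big_morph (fun z : int => th ^ z) (id1 := 1) (op1 := *%R)); last 2 first.
- by move=> z z'; rewrite expfzDr// gt_eqF.
- by rewrite expr0z.
by apply: eq_bigr => m _; rewrite !E// ltnW.
Qed.

Lemma measurable_grid_weight th k t N : 0 <= t ->
  measurable_fun setT (grid_weight th k t N).
Proof.
move=> t0; apply: measurable_prod => l _.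
by apply: (measurable_wloc hX _ _ (@omega_wloc _ n th k)); rewrite mulr_ge0// divr_ge0.
Qed.

Lemma integral_grid_weight th k t N eta : 0 < th -> 0 <= t -> started_from P X eta ->
  (\int[P]_w (grid_weight th k t N w)%:E =
   (iter N (tilt S th k (t / N%:R)) (fun=> 1) eta)%:E)%E.
Proof.
move=> th0 t0 X0; have h0 : 0 <= t / N%:R by rewrite divr_ge0.
have FT : natural_filtration X (0%:R * (t / N%:R)) setT by exact: filtrationT.
have := prod_tilt hS hX k N th0 h0 FT.
under eq_integral do under eq_bigr do rewrite add0n.
rewrite -/(grid_weight th k t N) mul0r => ->.
have bT : bcont (iter N (tilt S th k (t / N%:R)) (fun=> 1)).
  by apply: iter_tilt_bcont => //; exact: bcont_cst.
rewrite (ae_eq_integral (cst (iter N (tilt S th k (t / N%:R)) (fun=> 1) eta)%:E))//.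
- by rewrite -[RHS](expectation_cst P) unlock.
- by apply/measurable_EFinP; exact: (measurable_bcont mX (lexx 0) bT).
- by apply: filterS X0 => w /= -> _.
Qed.

(** On a legitimate path the grid weight equals q^(2 J) exactly from some N on. What remains is to
    exchange this limit with the expectation. *)
Lemma current_moment k t eta : 0 <= t -> started_from P X eta ->
  exists L : R, ('E_P[fun w => (q ^ (2 * current (X ^~ w) k t))%R] = L%:E)%E /\
    iter N (tilt S (q ^+ 2) k (t / N%:R)) (fun=> 1) eta @[N --> \oo] --> L.
Proof.
move=> t0 X0; have q0 : 0 < q by case/andP: hq.
have th0 : 0 < q ^+ 2 by exact: exprn_gt0.
have [Z [mZ PZ HZ]] := ae_legit hS hG hX.
have qE (z : int) : q ^ (2 * z) = (q ^+ 2) ^ z by rewrite exprnP exprz_exp.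
rewrite unlock.
have -> : (\int[P]_w (q ^ (2 * current (X ^~ w) k t))%:E =
    \int[P]_w ((q ^+ 2) ^ current (X ^~ w) k t)%:E)%E.
  by apply: eq_integral => w _; rewrite qE.
apply: (@expectation_cvg _ _ _ P (grid_weight (q ^+ 2) k t) _ Z
  (expR (t * tilt_rate q n ((q ^+ 2) ^+ 2)))) => //.
- by move=> N; exact: measurable_grid_weight.
- by move=> N w; apply: ltW; exact: grid_weight_gt0.
- by move=> w; apply: exprz_ge0; exact: ltW.
- move=> w nZ; have lw : legit (X ^~ w) by apply: contrapT => nl; apply: nZ; exact: HZ.
  apply: cvg_near_cst; near=> N; have N0 : (0 < N)%N by near: N; exact: nbhs_infty_gt.
  rewrite grid_weightE//; congr (_ ^ _); near: N.
  exact: (grid_current k (mp_cadlag hX w) lw t0 (lexx t)).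
(* The square of the weight with base q^2 is the weight with base q^4, so the kernel estimate for
   that base bounds the second moments. *)
- have th20 : 0 < (q ^+ 2) ^+ 2 by exact: exprn_gt0.
  have [h0 h00 H] := iter_tilt_bound hq hS hG k th20.
  near=> N; have [N0 N1] : (0 < N)%N /\ t / N%:R < h0 by near: N; exact: near_mesh.
  have -> : (\int[P]_w (grid_weight (q ^+ 2) k t N w ^+ 2)%:E =
      \int[P]_w (grid_weight ((q ^+ 2) ^+ 2) k t N w)%:E)%E.
    apply: eq_integral => w _; rewrite !grid_weightE//; congr (_%:E).
    by rewrite !exprnP !exprz_exp; congr (_ ^ _); clear; lia.
  rewrite (integral_grid_weight k N th20 t0 X0) lee_fin.
  have hh : 0 <= t / N%:R by rewrite divr_ge0.
  have one1 (xi : conf n) : `|(1 : R)| <= 1 by rewrite normr1.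
  apply: le_trans (ler_norm _) _.
  apply: le_trans (H _ hh N1 (fun=> 1) 1 N eta (bcont_cst 1) ler01 one1) _.
  by rewrite mulr1; apply: compound_le => //; exact: tilt_rate_ge0.
- by move=> N; exact: integral_grid_weight.
Unshelve. all: by end_near.
Qed.

End CurrentMoment.

(** * The dual walk and the duality formula *)

Section Walk.
Context {R : realType} (q : R) (n : nat) (hq : 0 < q < 1).
Local Notation Z := (discrete_topology int).
Variable S : R -> (Z -> R) -> Z -> R.
Hypothesis hS : markov_semigroup S.
Hypothesis hG : has_generator S bcont (walk_gen q n).

Local Notation a := (be q n).
Local Notation b := (al q n).
Local Notation G := (lat a b (a + b)).
Let a0 : 0 <= a := be_ge0 n hq.
Let b0 : 0 <= b := al_ge0 n hq.

Lemma bcont_int (f : Z -> R) (M : R) : (forall k, `|f k| <= M) -> bcont f.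
Proof.
move=> fM; split; last by exists M.
move=> k U /nbhs_singleton Uk.
have sU : [set k] `<=` f @^-1` U by move=> y /= ->.
exact: (filterS sU (discrete_set1 (k : Z))).
Qed.

Lemma walk_genE (f : Z -> R) : walk_gen q n f = (G (f : int -> R) : Z -> R).
Proof. by apply/funext => k; rewrite /walk_gen /lat -/a -/b; ring. Qed.

Lemma walk_gen_bcont (f : Z -> R) : bcont f -> bcont (walk_gen q n f).
Proof.
move=> [_ [M fM]]; apply: (@bcont_int _ (a * M + b * M + (a + b) * M)) => k.
rewrite walk_genE /lat; apply: le_trans (ler_normB _ _) _.
apply: lerD; [apply: le_trans (ler_normD _ _) _; apply: lerD|]; rewrite normrM ger0_norm ?addr_ge0//;
  apply: ler_wpM2l; rewrite ?addr_ge0//; exact: fM.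
Qed.

(** Both sides are limits of (S_(s+h) f - S_s f) / h: one by linearity and contraction of [S s], the
    other because [S s f] is again bounded, hence in the domain of the generator. *)
Lemma walk_comm (f : Z -> R) s k : 0 <= s -> bcont f ->
  S s (walk_gen q n f) k = walk_gen q n (S s f) k.
Proof.
move=> s0 bf; have bS := ms_bcont hS s0 bf; have bL := walk_gen_bcont bf.
apply/eqP; rewrite -subr_eq0 -normr_le0; apply/ler_addgt0Pr => e e0; rewrite add0r.
have e20 : 0 < e / 2 by rewrite divr_gt0.
have [h [h0 [H1 H2]]] := filter_ex (filterI (nbhs_right_gt 0)
  (filterI (generator_near hG bS bS e20) (generator_near hG bf bf e20))).
have hh := ltW h0; have bh := ms_bcont hS hh bf.
have H3 : `|S s (fun x => S h f x - f x - h * walk_gen q n f x) k| <= h * (e / 2).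
  by apply: (sg_bound hS k s0 _ H2); exact: bcontB (bcontB bh bf) (bcontZ h bL).
have E : S s (fun x => S h f x - f x - h * walk_gen q n f x) k =
    S h (S s f) k - S s f k - h * S s (walk_gen q n f) k.
  rewrite (sgB hS s0 (bcontB bh bf) (bcontZ h bL)) (sgB hS s0 bh bf) (sgZ hS h s0 bL).
  by rewrite -(ms_add hS s0 hh bf) (addrC s h) (ms_add hS hh s0 bf).
rewrite E in H3; have := H1 k; move: H3; rewrite !ler_norml => /andP[A1 A2] /andP[A3 A4].
have K : `|h * (S s (walk_gen q n f) k - walk_gen q n (S s f) k)| <= h * e.
  by rewrite ler_norml; apply/andP; split; lra.
by rewrite -ler_norml; move: K; rewrite normrM (gtr0_norm h0) ler_pM2l.
Qed.

(** On bounded functions the generator has norm at most 2 (a + b), so the Taylor scheme applies with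
    a constant weight; [walk_comm] provides its one-step equation. *)
Lemma walk_taylor (f : Z -> R) t (M : R) k : 0 <= t -> 0 <= M -> (forall y, `|f y| <= M) ->
  texp a b (a + b) t P f k @[P --> \oo] --> S t f k.
Proof.
move=> t0 M0 fM; have bf := bcont_int fM.
have hN N : 0 <= t / N%:R by rewrite divr_ge0.
have hm (N m : nat) : 0 <= m%:R * (t / N%:R) by rewrite mulr_ge0.
apply: (@cvg_of_exp_bound _ _ M ((a + b + (a + b)) * t)).
apply: (@newton_taylor_lim _ _ _ _ (fun N m k => S (m%:R * (t / N%:R)) f k) f (fun=> M)) => //.
- by rewrite !addr_ge0.
- by move=> k'; rewrite !ger0_norm ?addr_ge0// !mulrDl.
- by move=> N k'; rewrite mul0r (ms_zero hS).
- by move=> k'; apply: nearW => N m _; exact: (sg_bound hS k' (hm N m) bf fM).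
- move=> k' e e0.
  have [h1 h10 Hh] := near_at_right (generator_near hG bf bf e0).
  near=> N; move=> m mN.
  have [N0 N1] : (0 < N)%N /\ t / N%:R < h1 by near: N; exact: near_mesh.
  have bL := walk_gen_bcont bf; have bh := ms_bcont hS (hN N) bf.
  rewrite -natr1 mulrDl mul1r (ms_add hS (hm N m) (hN N) bf).
  have -> : G (S (m%:R * (t / N%:R)) f) k' = S (m%:R * (t / N%:R)) (walk_gen q n f) k'.
    by rewrite walk_comm// walk_genE.
  set h := t / N%:R in bh N1 *.
  have E : S (m%:R * h) (S h f) k' - S (m%:R * h) f k' - h * S (m%:R * h) (walk_gen q n f) k' =
      S (m%:R * h) (fun x => S h f x - f x - h * walk_gen q n f x) k'.
    by rewrite (sgB hS (hm N m) (bcontB bh bf) (bcontZ h bL)) (sgB hS (hm N m) bh bf) (sgZ hS h (hm N m) bL).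
  rewrite E; apply: (sg_bound hS k' (hm N m)).
    exact: bcontB (bcontB bh bf) (bcontZ h bL).
  move=> y; have [h00|hn0] := eqVneq 0 h.
    by rewrite -h00 (ms_zero hS)// subrr !mul0r subr0 normr0.
  have hp : 0 < h by rewrite lt_neqAle hn0 hN.
  by apply: Hh; rewrite add0r hp N1.
- apply: cvg_near_cst; near=> N; have N0 : (0 < N)%N by near: N; exact: nbhs_infty_gt.
  by rewrite mulrCA divff ?mulr1// pnatr_eq0 -lt0n.
Unshelve. all: by end_near.
Qed.

Context {d : measure_display} {Omega : measurableType d} (Q : probability Omega R).
Variable x : R -> Omega -> Z.
Hypothesis hx : markov_process_of Q S x.

(** [F] may be unbounded, while the Markov property and [walk_taylor] concern bounded functions. It
    is truncated to |y| <= B: a given Taylor polynomial at [k] ignores a large B, the remainder is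
    bounded through [W] uniformly in B, and the expectations increase with B. *)
Lemma walk_expectation (F W : Z -> R) (C : R) t k : 0 <= t -> 0 <= C ->
  started_from Q x k -> (forall y, 0 <= W y) -> (forall y, 0 <= F y <= W y) ->
  (forall y : int, a * W (y - 1) + b * W (y + 1) + (a + b) * W y <= C * W y) ->
  exists L : R, (\int[Q]_w (F (x t w))%:E = L%:E)%E /\
    texp a b (a + b) t P F k @[P --> \oo] --> L.
Proof.
move=> t0 C0 xk W0 FW CW.
have F0 y : 0 <= F y by have /andP[] := FW y.
pose FB (B : nat) (y : Z) : R := if (absz (y : int) <= B)%N then F y else 0.
have FB0 B y : 0 <= FB B y by rewrite /FB; case: ifP.
have FBW B y : `|FB B y| <= W y.
  by rewrite ger0_norm// /FB; case: ifP => // _; have /andP[] := FW y.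
have FBbound B : exists M : R, 0 <= M /\ forall y, `|FB B y| <= M.
  exists (\sum_(j < B.+1) (F (j%:Z) + F (- j%:Z))).
  have P0 (j : 'I_B.+1) : 0 <= F (j%:Z) + F (- j%:Z) by exact: addr_ge0.
  split; first by apply: sumr_ge0 => j _; exact: P0.
  move=> y; rewrite ger0_norm// /FB; case: ifP => [yB|_]; last by apply: sumr_ge0 => j _; exact: P0.
  have yB' : (absz (y : int) < B.+1)%N by rewrite ltnS.
  rewrite (bigD1 (Ordinal yB'))//= -[leLHS]addr0; apply: lerD; last by apply: sumr_ge0 => j _; exact: P0.
  have [->|->] : y = (absz (y : int))%:Z \/ y = - (absz (y : int))%:Z by clear; lia.
    by rewrite absz_nat lerDl.
  by rewrite abszN absz_nat lerDr.
have bFB B : bcont (FB B) by have [M [_ HM]] := FBbound B; exact: bcont_int HM.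
pose s B := S t (FB B) k.
have mxF (f : Z -> R) : measurable_fun setT (fun w => f (x t w)).
  move=> _ A mA; rewrite setTI; apply: (mp_measurable hx (U := f @^-1` A) t0).
  exact: (@discrete_open Z).
have sE B : (\int[Q]_w (FB B (x t w))%:E = (s B)%:E)%E.
  have := mp_markov hx (lexx 0) t0 (bFB B) (@filtrationT _ _ _ _ x 0); rewrite add0r => ->.
  have bS := ms_bcont hS t0 (bFB B).
  rewrite (ae_eq_integral (cst (s B)%:E))//.
  - by rewrite -[RHS](expectation_cst Q) unlock.
  - apply/measurable_EFinP => _ A mA; rewrite setTI.
    by apply: (mp_measurable hx (U := S t (FB B) @^-1` A) (lexx 0)); exact: (@discrete_open Z).
  - by apply: filterS xk => w /= -> _.
pose tail P := W k * (expR (C * t) - series (exp_coeff (C * t)) P).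
have CW' y : `|a| * W (y - 1) + `|b| * W (y + 1) + `|a + b| * W y <= C * W y.
  by rewrite !ger0_norm ?addr_ge0.
have sP B P : `|s B - texp a b (a + b) t P (FB B) k| <= tail P.
  have [M [M0 HM]] := FBbound B.
  have H : `|texp a b (a + b) t P' (FB B) k - texp a b (a + b) t P (FB B) k| @[P' --> \oo] -->
      `|s B - texp a b (a + b) t P (FB B) k|.
    apply: cvg_norm; apply: cvgB; last exact: cvg_cst.
    exact: (walk_taylor t0 M0 HM).
  apply: (ler_cvg_to H (cvg_cst _)); near=> P'.
  apply: (texp_tail k t0 C0 W0 (FBW B) CW').
  by near: P'; exact: nbhs_infty_ge.
have FBP (P B : nat) : (P + absz (k : int) <= B)%N ->
    texp a b (a + b) t P (FB B) k = texp a b (a + b) t P F k.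
  move=> PB; apply: texp_ext => y yP; rewrite /FB ifT//.
  by move: PB yP; clear; lia.
have limE : (s B)%:E @[B --> \oo] --> (\int[Q]_w (F (x t w))%:E)%E.
  have c1 B : measurable_fun setT (fun w => (FB B (x t w))%:E).
    by apply/measurable_EFinP; exact: mxF.
  have c2 B w : setT w -> (0 <= (FB B (x t w))%:E)%E by move=> _; rewrite lee_fin.
  have c3 w : setT w -> {homo (fun B => (FB B (x t w))%:E) : B B' / (B <= B')%N >-> (B <= B')%E}.
    move=> _ B B' BB'; rewrite lee_fin /FB; case: ifP => [yB|_]; last by case: ifP.
    by rewrite (leq_trans yB).
  have H := cvg_monotone_convergence measurableT c1 c2 c3 (mu := Q).
  have E : (\int[Q]_w limn (fun B => (FB B (x t w))%:E) = \int[Q]_w (F (x t w))%:E)%E.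
    apply: eq_integral => w _; apply/cvg_lim => //; apply: cvg_near_cst; near=> B.
    by rewrite /FB ifT//; near: B; exact: nbhs_infty_ge.
  by move: H; rewrite E; under eq_fun do rewrite sE.
have sbound B : s B <= tail 0%N.
  have := sP B 0%N; rewrite /texp big_ord0 subr0; apply: le_trans; exact: ler_norm.
have Efin : (\int[Q]_w (F (x t w))%:E)%E \is a fin_num.
  rewrite ge0_fin_numE; last by apply: integral_ge0 => w _; rewrite lee_fin.
  apply: (@le_lt_trans _ _ (tail 0%N)%:E); last exact: ltry.
  rewrite -(cvg_lim _ limE)//; apply: lime_le; first by apply/cvg_ex; eexists; exact: limE.
  by apply: nearW => B; rewrite lee_fin.
exists (fine (\int[Q]_w (F (x t w))%:E)%E); split; first by rewrite fineK.
set L := fine _; have sL : s B @[B --> \oo] --> L.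
  by move: limE; rewrite -(fineK Efin) => /fine_cvgP[_]; apply.
have LP P : `|L - texp a b (a + b) t P F k| <= tail P.
  have H : `|s B - texp a b (a + b) t P F k| @[B --> \oo] --> `|L - texp a b (a + b) t P F k|.
    by apply: cvg_norm; apply: cvgB => //; exact: cvg_cst.
  apply: (ler_cvg_to H (cvg_cst _)); near=> B; rewrite -(FBP P B); first exact: sP.
  by near: B; exact: nbhs_infty_ge.
have tail0 : tail P @[P --> \oo] --> (0 : R).
  rewrite -(mulr0 (W k)); apply: cvgMr.
  rewrite -(subrr (expR (C * t))); apply: cvgB; first exact: cvg_cst.
  exact: is_cvg_series_exp_coeff.
have Ntail0 : - tail P @[P --> \oo] --> (0 : R) by rewrite -oppr0; exact: cvgN.
have : L - texp a b (a + b) t P F k @[P --> \oo] --> (0 : R).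
  by apply: (squeeze_cvgr _ Ntail0 tail0); near=> P; rewrite -ler_norml.
move=> /(cvgB (cvg_cst L)); rewrite subr0; apply: cvg_trans.
by apply: near_eq_cvg; near=> P; rewrite /= subKr.
Unshelve. all: by end_near.
Qed.

End Walk.

(** * Limits at minus infinity *)

Section LeftLimits.
Context {R : realType}.
Implicit Types (f g : int -> R).

Definition tends_left f (l : R) : Prop :=
  forall e, 0 < e -> exists K : int, forall k, k <= K -> `|f k - l| <= e.

Lemma tends_left_lin c f g l l' : tends_left f l -> tends_left g l' ->
  tends_left (fun k => f k + c * g k) (l + c * l').
Proof.
move=> H H' e e0.
have [d d0 ->] : exists2 d, 0 < d & e = d + `|c| * d.
  have c1 : 0 < 1 + `|c| by rewrite ltr_pwDl.
  by exists (e / (1 + `|c|)); [rewrite divr_gt0|field; rewrite gt_eqF].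
have [K HK] := H _ d0; have [K' HK'] := H' _ d0.
exists (Num.min K K') => k; rewrite le_min => /andP[kK kK'].
have -> : f k + c * g k - (l + c * l') = (f k - l) + c * (g k - l') by ring.
apply: le_trans (ler_normD _ _) _; rewrite normrM.
exact: lerD (HK k kK) (ler_wpM2l (normr_ge0 c) (HK' k kK')).
Qed.

Lemma tends_left_shift f l (j : int) : tends_left f l -> tends_left (fun k => f (k + j)) l.
Proof.
move=> H e /H[K HK]; exists (K - j) => k kK; apply: HK.
by move: kK; clear; lia.
Qed.

Lemma tends_left0 : tends_left (fun=> 0) 0.
Proof. by move=> e e0; exists 0 => k _; rewrite subrr normr0 ltW. Qed.

Lemma tends_left_ext f g l : f =1 g -> tends_left f l -> tends_left g l.
Proof. by move=> fg H e /H[K HK]; exists K => k /HK; rewrite fg. Qed.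

Lemma tends_left_lat a b f l : tends_left f l -> tends_left (lat a b (a + b) f) 0.
Proof.
move=> H; have H1 := tends_left_shift (-1) H; have H2 := tends_left_shift 1 H.
have := tends_left_lin (- (a + b)) (tends_left_lin b (tends_left_lin a tends_left0 H1) H2) H.
have -> : 0 + a * l + b * l + - (a + b) * l = 0 by ring.
by apply: tends_left_ext => k; rewrite /lat; ring.
Qed.

(** [lat a b (a + b)] kills constants, so at -oo only the term of order 0 survives; [P.+1]
    guarantees that this term is present. *)
Lemma tends_left_texp a b t P f l : tends_left f l ->
  tends_left (texp a b (a + b) t P.+1 f) l.
Proof.
move=> H; have I p : tends_left (iter p.+1 (lat a b (a + b)) f) 0.
  elim: p => [|p IH]; first exact: tends_left_lat H.
  by rewrite iterS; exact: tends_left_lat IH.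
elim: P => [|P IH].
  apply: tends_left_ext H => k.
  by rewrite /texp big_ord_recl big_ord0 addr0 expr0 fact0 divr1 mul1r.
have := tends_left_lin (t ^+ P.+1 / (P.+1)`!%:R) IH (I P); rewrite mulr0 addr0.
by apply: tends_left_ext => k; rewrite [RHS]/texp big_ord_recr.
Qed.

End LeftLimits.

Section Heights.
Context {R : realType} (q : R) (n : nat) (hq : 0 < q < 1) (eta : conf n) (i : int).
Let q0 : 0 < q. Proof. by case/andP: hq. Qed.
Let q1 : q < 1. Proof. by case/andP: hq. Qed.

Lemma Ndiff_rec k : Ndiff eta k i = Posz (occ eta k) + Ndiff eta (k + 1) i.
Proof.
rewrite /Ndiff; have [ki|ik] := leP k i; last first.
  have -> : (k + 1 <= i) = false by clear -ik; lia.
  have -> : absz (k + 1 - i)%R = (absz (k - i)%R).+1 by clear -ik; lia.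
  rewrite big_nat_recr //=; have -> : i + Posz (absz (k - i)%R) = k by clear -ik; lia.
  by rewrite opprD addrCA subrr addr0.
have [->|kni] := eqVneq k i.
  have -> : (i + 1 <= i) = false by clear; lia.
  have -> : absz (i + 1 - i)%R = 1%N by clear; lia.
  by rewrite subrr absz0 big_nil big_nat1 addr0 subrr.
have -> : (k + 1 <= i) = true by clear -ki kni; lia.
have -> : absz (i - k)%R = (absz (i - (k + 1))%R).+1 by clear -ki kni; lia.
rewrite big_nat_recl //= addr0; congr (_ + _); apply: eq_bigr => m _.
by congr (Posz (occ eta _)); clear; lia.
Qed.

Definition height k : R := q ^ (2 * Ndiff eta k i).

Lemma height_gt0 k : 0 < height k.
Proof. exact: exprz_gt0. Qed.

Lemma height_rec k : height k = occM (q ^+ 2) k eta * height (k + 1).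
Proof.
rewrite /height /occM Ndiff_rec mulrDr expfzDr ?gt_eqF//; congr (_ * _).
by rewrite !exprnP exprz_exp.
Qed.

Lemma height_self : height i = 1.
Proof. by rewrite /height /Ndiff lexx subrr absz0 big_nil mulr0 expr0z. Qed.

Lemma Ndiff_left M : Ndiff eta (i - M%:Z) i = (\sum_(m < M) occ eta (i - 1 - m%:Z)%R)%N%:Z.
Proof.
elim: M => [|M IH]; first by rewrite subr0 big_ord0 /Ndiff lexx subrr absz0 big_nil.
rewrite Ndiff_rec big_ord_recr /= PoszD -IH addrC.
have -> : i - M.+1%:Z + 1 = i - M%:Z by clear; lia.
by have -> : i - M.+1%:Z = i - 1 - M%:Z by clear; lia.
Qed.

Lemma height_left M : height (i - M%:Z) =
  q ^+ (2 * (\sum_(m < M) occ eta (i - 1 - m%:Z)%R)%N).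
Proof. by rewrite /height Ndiff_left. Qed.

(** With finitely many particles to the left the height is eventually constant; otherwise the
    exponent is unbounded and the height tends to 0, the value that [qpow_Nleft] takes there. *)
Lemma tends_left_height : tends_left height (qpow_Nleft q eta i).
Proof.
rewrite /qpow_Nleft Nleft_series.
pose a (m : nat) := occ eta (i - 1 - m%:Z).
have kE (k : int) M : k <= i - M%:Z -> exists2 M', (M <= M')%N & k = i - M'%:Z.
  by move=> kM; exists (absz (i - k)%R); [clear -kM; lia|clear -kM; lia].
have [[M HM]|NM] := pselect (exists M, forall m, (M <= m)%N -> a m = 0%N).
  rewrite (nat_series_stop HM) => e e0; exists (i - M%:Z) => k /kE[M' MM' ->].
  rewrite height_left; have -> : (\sum_(m < M') a m = \sum_(m < M) a m)%N.
    rewrite -!(big_mkord predT a) (big_cat_nat (leq0n M) MM') /=.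
    rewrite [X in (_ + X)%N]big_nat_cond [X in (_ + X)%N]big1 ?addn0//.
    by move=> m /andP[/andP[Mm _] _]; exact: HM.
  rewrite -natrM powR_mulrn ?(ltW q0)// subrr normr0.
  exact: ltW.
rewrite (nat_series_oo NM) => e e0.
have qM : q ^+ c @[c --> \oo] --> (0 : R).
  by apply: cvg_expr; rewrite ger0_norm ?(ltW q0).
have [c [_ Hc]] : exists c : nat, True /\ q ^+ c <= e.
  have : \forall c \near \oo, q ^+ c <= e.
    by move/cvgrPdist_le : qM => /(_ e e0); apply: filterS => c; rewrite sub0r normrN; apply: le_trans; exact: ler_norm.
  by move=> [c _ H]; exists c; split=> //; apply: H => /=.
have [m0 Hm0] := nat_series_unbounded NM c.
exists (i - m0%:Z) => k /kE[M' mM' ->]; rewrite height_left subr0 ger0_norm ?exprn_ge0 ?(ltW q0)//.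
apply: le_trans Hc; apply: ler_wiXn2l; rewrite ?(ltW q0) ?(ltW q1)//.
apply: leq_trans (Hm0 M' mM') _; rewrite leq_pmull//.
Qed.

End Heights.

(** * Matching the heights with the walk *)

Section Duality.
Context {R : realType} (q : R) (n : nat) (hq : 0 < q < 1).
Context {d : measure_display} {Omega : measurableType d}.
Variables (P : probability Omega R) (X : R -> Omega -> conf n).
Hypothesis hX : is_asep q P X.
Variables (eta : conf n) (i : int) (t : R).
Hypothesis X0 : started_from P X eta.
Hypothesis t0 : 0 <= t.

Let q0 : 0 < q. Proof. by case/andP: hq. Qed.
Let q1 : q < 1. Proof. by case/andP: hq. Qed.
Let qn0 : q != 0. Proof. by rewrite gt_eqF. Qed.

Local Notation Psi := (height q eta i).

Lemma asep_heights : exists v : int -> R,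
  [/\ ('E_P[fun w => (q ^ (2 * current (X ^~ w) i t))%R] = (v i)%:E)%E,
      tends_left v (qpow_Nleft q eta i) &
      forall k, texp (al q n) (be q n) (al q n + be q n) t p Psi k @[p --> \oo] --> v k].
Proof.
have [S [hS hG hXS]] := hX.
have /choice[L HL] := fun k => current_moment hq hS hG hXS k t0 X0.
have H k : moment q S eta Psi t N N k @[N --> \oo] --> Psi k * L k.
  by apply: cvgMr; have [] := HL k.
have B k := moment_taylor hq hS hG (height_gt0 hq eta i) (height_rec hq eta i) t0 (H k).
exists (fun k => Psi k * L k); split.
- by rewrite height_self mul1r; have [] := HL i.
(* The Taylor remainder is proportional to [Psi k], which is at most 1 for [k <= i]. One degree
   therefore serves all these sites, and the limit at -oo can be taken in the polynomial. *)
- move=> e e0.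
  pose E := expR (t * tilt_rate q n (q ^+ 2)).
  have E0 : 0 < E by exact: expR_gt0.
  have small : E * ((spread_rate q n * t) ^+ p / p`!%:R) @[p --> \oo] --> (0 : R).
    by rewrite -(mulr0 E); apply: cvgMr; exact: cvg_exprn_fact.
  have e20 : 0 < e / 2 by rewrite divr_gt0.
  have [p Hp] : exists p, E * ((spread_rate q n * t) ^+ p.+1 / (p.+1)`!%:R) <= e / 2.
    have : \forall p \near \oo, E * ((spread_rate q n * t) ^+ p / p`!%:R) <= e / 2.
      move/cvgrPdist_le : small => /(_ _ e20); apply: filterS => p.
      by rewrite sub0r normrN; apply: le_trans; exact: ler_norm.
    by move=> [p _ Hp]; exists p; apply: Hp => /=.
  have [K HK] := tends_left_texp (al q n) (be q n) t p (tends_left_height hq eta i) e20.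
  have Psi_i (m : nat) : Psi (i - m%:Z) <= 1.
    by rewrite height_left exprn_ile1 ?(ltW q0) ?(ltW q1).
  exists (Num.min K i) => k; rewrite le_min => /andP[kK ki].
  have P1 : Psi k <= 1.
    have -> : k = i - (absz (i - k)%R)%:Z by clear -ki; lia.
    exact: Psi_i.
  have := HK k kK; have := B k p.+1; rewrite -/E.
  have S0 : 0 <= (spread_rate q n * t) ^+ p.+1 / (p.+1)`!%:R.
    apply: divr_ge0 => //; apply: exprn_ge0; apply: mulr_ge0 => //.
    exact: spread_rate_ge0.
  have : E * Psi k * ((spread_rate q n * t) ^+ p.+1 / (p.+1)`!%:R) <= e / 2.
    apply: le_trans Hp; apply: ler_wpM2r => //; apply: ler_piMr => //; exact: ltW.
  move: (_ / (p.+1)`!%:R) => s /= H1 H2 H3.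
  have {}H2 := le_trans H2 H1.
  rewrite -(subrKA (texp (al q n) (be q n) (al q n + be q n) t p.+1 Psi k)).
  apply: le_trans (ler_normD _ _) _; apply: le_trans (lerD H2 H3) _; lra.
- by move=> k; exact: cvg_of_exp_bound (B k).
Qed.

(** As Psi(y + 1) = q^(-2 eta_y) Psi(y), the observable is minus q^(2ny) times the discrete gradient
    of the initial heights. Undoing the weight turns the series of the walk into that of [G], which
    commutes with translations, so the gradient of [v] comes out. *)
Lemma walk_heights {d' : measure_display} {Omega' : measurableType d'}
    (Q : probability Omega' R) (x : R -> Omega' -> discrete_topology int) (k : int) (v : int -> R) :
  is_walk q n Q x -> started_from Q x k ->
  (forall k, texp (al q n) (be q n) (al q n + be q n) t p Psi k @[p --> \oo] --> v k) ->
  ((q ^ (- 2 * Posz n * k))%R%:E *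
     'E_Q[fun w => let y : int := x t w in
       (q ^ (2 * Posz n * y) * (1 - q ^ (- 2 * Posz (occ eta y)))
        * q ^ (2 * Ndiff eta y i))%R] = (v k - v (k + 1))%:E)%E.
Proof.
move=> [S [hS hG hxS]] xk Hv.
pose r := q ^ (2 * Posz n); have r0 : 0 < r by exact: exprz_gt0.
have rE y : q ^ (2 * Posz n * y) = r ^ y by rewrite /r exprz_exp.
have q20 : 0 < q ^+ 2 by exact: exprn_gt0.
pose F (y : int) := r ^ y * (Psi (y + 1) - Psi y).
(* The factor r = q^(2n) compensates the fastest possible growth of [Psi] to the right, so [W] is
   nonincreasing; to the left it grows by at most 1 / r per step. *)
pose W (y : int) := r ^ y * Psi (y + 1).
have ry y : 0 < r ^ y by exact: exprz_gt0.
have Pg := height_gt0 hq eta i; have Prec := height_rec hq eta i.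
have W0 y : 0 <= W y by rewrite mulr_ge0// ltW.
have FW y : 0 <= F y <= W y.
  rewrite /F /W pmulr_rge0// subr_ge0 (Psi_le hq Pg Prec)/= ler_wpM2l ?(ltW (ry _))//.
  by rewrite lerBlDr lerDl ltW.
have rn : r = (q ^+ 2) ^+ n by rewrite /r exprnP exprnP exprz_exp.
have a0 := be_ge0 n hq; have b0 := al_ge0 n hq.
pose C := be q n * r^-1 + al q n + (be q n + al q n).
have C0 : 0 <= C.
  by apply: addr_ge0; apply: addr_ge0 => //; apply: mulr_ge0 => //; rewrite invr_ge0 ltW.
have CW (y : int) : be q n * W (y - 1) + al q n * W (y + 1) + (be q n + al q n) * W y <= C * W y.
  have W1 : W (y - 1) <= r^-1 * W y.
    rewrite /W expfzDr ?gt_eqF// exprN1 subrK mulrAC mulrC ler_wpM2l ?invr_ge0 ?(ltW r0)//.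
    by rewrite ler_wpM2l ?(ltW (ry _))//; exact: (Psi_le hq Pg Prec).
  have W2 : W (y + 1) <= W y.
    rewrite /W expfzDr ?gt_eqF// expr1z -mulrA ler_wpM2l ?(ltW (ry _))//.
    have := ler_wpM2l (ltW r0) (Psi_ge hq Pg Prec (y + 1)).
    by rewrite -rn mulrA divff ?mul1r ?gt_eqF.
  have := ler_wpM2l a0 W1; have := ler_wpM2l b0 W2; rewrite /C; lra.
have [L [EL TL]] := walk_expectation hq hS hG hxS t0 C0 xk W0 FW CW.
have LE : r ^ (- k) * L = v (k + 1) - v k.
  have T1 : r ^ (- k) * texp (be q n) (al q n) (be q n + al q n) t p F k @[p --> \oo] --> r ^ (- k) * L.
    exact: cvgMr.
  have T2 : texp (al q n) (be q n) (al q n + be q n) t p Psi (k + 1) -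
      texp (al q n) (be q n) (al q n + be q n) t p Psi k @[p --> \oo] --> v (k + 1) - v k.
    by apply: cvgB; exact: Hv.
  apply: (cvg_unique _ T1); first exact: Rhausdorff.
  apply: cvg_trans T2; apply: near_eq_cvg; apply: nearW => p.
  rewrite -texp_shift -texpB /texp mulr_sumr; apply: eq_bigr => j _.
  rewrite [RHS]mulrCA; congr (_ * _).
  rewrite [RHS](iter_lat_conj (be q n) (al q n) (be q n + al q n) j
    (fun y => Psi (y + 1) - Psi y) k r0).
  have rq : r = q ^ n%:Z * q ^ n%:Z.
    by rewrite -expfzDr// /r; congr (_ ^ _); clear; lia.
  have qnn : q ^ n%:Z != 0 by rewrite expfz_neq0.
  have -> : be q n / r = al q n.
    by rewrite /be /al rq -invr_expz; field; exact: qnn.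
  have -> : al q n * r = be q n.
    by rewrite /be /al rq -invr_expz; field; exact: qnn.
  by rewrite (addrC (be q n)).
have mF : measurable_fun setT (fun w => F (x t w)).
  move=> _ A mA; rewrite setTI.
  apply: (mp_measurable hxS (U := (F : discrete_topology int -> R) @^-1` A) t0).
  exact: (@discrete_open (discrete_topology int)).
have EF : ('E_Q[fun w => let y : int := x t w in
       (q ^ (2 * Posz n * y) * (1 - q ^ (- 2 * Posz (occ eta y)))
        * q ^ (2 * Ndiff eta y i))%R] = - L%:E)%E.
  rewrite unlock -EL -integral_ge0N; last first.
    by move=> w _; rewrite lee_fin; have /andP[] := FW (x t w).
  apply: eq_integral => w _; rewrite -EFinN; congr (_%:E).
  rewrite /F rE -mulrN opprB -mulrA; congr (_ * _).
  rewrite mulrBl mul1r; congr (_ - _).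
  have E : q ^ (2 * Posz (occ eta (x t w))) * (q ^ (- 2 * Posz (occ eta (x t w)))) = 1.
    by rewrite -expfzDr// mulNr subrr expr0z.
  rewrite -/(height q eta i (x t w)) (Prec (x t w)) mulrA /occM.
  have -> : (q ^+ 2) ^+ occ eta (x t w) = q ^ (2 * Posz (occ eta (x t w))).
    by rewrite !exprnP exprz_exp.
  by rewrite (mulrC (q ^ (- 2 * _))) E mul1r.
rewrite EF muleN -EFinM -EFinN; congr (_%:E).
have -> : - 2 * Posz n * k = 2 * Posz n * (- k) by ring.
by rewrite rE LE opprB.
Qed.

End Duality.

Theorem lemma3p1 (R : realType) (q : R) (n : nat)
    (hq : 0 < q < 1) (hn : (0 < n)%N)
    (d : measure_display) (Omega : measurableType d) (P : probability Omega R)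
    (X : R -> Omega -> conf n) (hX : is_asep q P X) :
  {ae P, forall w, forall (i : int) (t : R), 0 <= t ->
     ((current (X ^~ w) i t)%:~R)%:E = Nright_incr (X ^~ w) i t}
  /\
  forall (eta : conf n) (hX0 : started_from P X eta)
    (d' : measure_display) (Omega' : measurableType d')
    (Q : int -> probability Omega' R)
    (x : R -> Omega' -> discrete_topology int)
    (hwalk : forall k : int, is_walk q n (Q k) x)
    (hwalk0 : forall k : int, started_from (Q k) x k)
    (i : int) (t : R) (ht : 0 <= t),
  ('E_P[fun w => (q ^ (2 * current (X ^~ w) i t))%R] =
   (qpow_Nleft q eta i)%:E -
   \sum_(0 <= m <oo)
     let k : int := (i - 1 - Posz m)%R in
     (q ^ (- 2 * Posz n * k))%R%:E *
     'E_(Q k)[fun w => let y : int := x t w in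
       (q ^ (2 * Posz n * y) * (1 - q ^ (- 2 * Posz (occ eta y)))
        * q ^ (2 * Ndiff eta y i))%R])%E.
Proof.
split.
  have [S [hS hG hXS]] := hX.
  have lX := ae_legit hS hG hXS; have eX := ae_no_escape hq hS hG hXS.
  (* The two exceptional sets depend neither on [i] nor on [t], so the identity holds for all bonds
     and times simultaneously. *)
  suff sub : [set w | legit (X ^~ w)] `&` [set w | forall K T M : nat, vacant X K w ->
      exists2 p, (M <= p)%N & forall s zeta, 0 < s <= T%:R -> X r w @[r --> s^'-] --> zeta ->
      delta (K%:Z + p%:Z + 1) zeta (X s w) = 0] `<=` [set w | forall (i : int) (t : R), 0 <= t ->
     ((current (X ^~ w) i t)%:~R)%:E = Nright_incr (X ^~ w) i t].
    by exact: (filterS sub (filterI lX eX)).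
  move=> w [lw NE] i t t0.
  apply: current_Nright_incr => //; first exact: mp_cadlag hXS w.
move=> eta X0 d' Omega' Q x hwalk hwalk0 i t t0.
have [v [Ev vlim Hv]] := asep_heights hq hX i X0 t0.
rewrite Ev.
have -> : ((\sum_(0 <= m <oo)
     let k : int := (i - 1 - Posz m)%R in
     (q ^ (- 2 * Posz n * k))%R%:E *
     'E_(Q k)[fun w => let y : int := x t w in
       (q ^ (2 * Posz n * y) * (1 - q ^ (- 2 * Posz (occ eta y)))
        * q ^ (2 * Ndiff eta y i))%R]) = (qpow_Nleft q eta i - v i)%:E)%E.
  apply/cvg_lim => //.
  have E (M : nat) : ((\sum_(0 <= m < M)
     let k : int := (i - 1 - Posz m)%R in
     (q ^ (- 2 * Posz n * k))%R%:E *
     'E_(Q k)[fun w => let y : int := x t w in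
       (q ^ (2 * Posz n * y) * (1 - q ^ (- 2 * Posz (occ eta y)))
        * q ^ (2 * Ndiff eta y i))%R]) = (v (i - M%:Z) - v i)%:E)%E.
    elim: M => [|M IH]; first by rewrite big_nil subr0 subrr.
    rewrite big_nat_recr//= IH (walk_heights hq t0 (hwalk _) (hwalk0 _) Hv) -EFinD.
    congr (_%:E).
    have -> : i - 1 - M%:Z + 1 = i - M%:Z by clear; lia.
    have -> : i - M.+1%:Z = i - 1 - M%:Z by clear; lia.
    by ring.
  under eq_fun do rewrite E.
  apply: cvg_EFin; first exact: nearW.
  apply: cvgB; last exact: cvg_cst.
  apply/cvgrPdist_le => e e0; have [K HK] := vlim e e0.
  near=> M; rewrite distrC; apply: HK.
  have : (absz (i - K)%R <= M)%N by near: M; exact: nbhs_infty_ge.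
  by clear; lia.
by rewrite -EFinB opprB addrC subrK.
Unshelve. all: by end_near.
Qed.
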